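(* Let $\mathcal{D}=\{x\in\mathbb{R}^3:\ x_1^2+x_2^2<1\}$ and let $(u,p)$, with $u=u_r(r,z)\boldsymbol{e_r}+u_\theta(r,z)\boldsymbol{e_\theta}+u_z(r,z)\boldsymbol{e_z}$, be a smooth axially symmetric solution of the stationary Navier-Stokes equations $$u\cdot\nabla u+\nabla p-\Delta u=0,\qquad \nabla\cdot u=0\qquad\text{in }\mathcal{D},$$ subject to the total Navier-slip boundary condition $$(\mathbb{S}u\cdot\boldsymbol{n})_\tau=0,\qquad u\cdot\boldsymbol{n}=0\qquad\text{on }\partial\mathcal{D}.$$ Suppose that one of the following holds. I. $u_\theta$ is independent of $z$, and there are constants $C>0$, $\gamma_0<\alpha$, $\delta_0<1$ and $M_0>0$ such that, uniformly in $r\in[0,1]$, $$|u_r(r,z)|\le C\,r\,e^{\gamma_0|z|}\ \text{ for all } z\in\mathbb{R},\qquad |u_z(r,z)|\le C|z|^{\delta_0}\ \text{ and }\ |\omega_\theta(r,z)|\le C|z|^{M_0}\ \text{ for all } |z|\ge 1,$$ where $\alpha\approx 3.83171$ is the smallest positive root of the Bessel function $J_1$ and $\omega_\theta=\partial_zu_r-\partial_ru_z$. II. $u_z$ is independent of $z$. Then there are constants $C_1,C_2\in\mathbb{R}$ such that $$u=C_1r\,\boldsymbol{e_\theta}+C_2\,\boldsymbol{e_z},\qquad p=\frac{C_1^2r^2}{2}\quad\text{(up to an additive constant)}.$$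
   Context: Smooth means smooth up to the boundary. $\mathbb{S}u=\frac12(\nabla u+(\nabla u)^T)$, $\boldsymbol{n}$ is the unit outer normal on $\partial\mathcal{D}$, and $v_\tau=v-(v\cdot\boldsymbol{n})\boldsymbol{n}$ is the tangential part of a vector field $v$. Cylindrical coordinates: $x=(r\cos\theta,r\sin\theta,z)$, with $\boldsymbol{e_r}=(x_1/r,x_2/r,0)$, $\boldsymbol{e_\theta}=(-x_2/r,x_1/r,0)$, $\boldsymbol{e_z}=(0,0,1)$. Axially symmetric means that the components $u_r,u_\theta,u_z$ (and the pressure $p$) do not depend on $\theta$. In these coordinates the boundary condition reads $\partial_ru_\theta-u_\theta/r=0$, $\partial_ru_z=0$, $u_r=0$ on $r=1$. $J_1(s)=\sum_{n\ge0}\frac{(-1)^n}{n!\,\Gamma(n+2)}\left(\frac{s}{2}\right)^{2n+1}$ is the Bessel function of the first kind of order $1$. No size or growth assumption is made on $u$ in case II. *)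

(* Defs.v *)
From Stdlib Require Import Reals List Factorial.
From Coquelicot Require Import Coquelicot.
Open Scope R_scope.

Definition R3 : Type := (R * R * R)%type.

Inductive axis : Set := ax1 | ax2 | ax3.

Definition coord (i : axis) (x : R3) : R :=
  match i with ax1 => fst (fst x) | ax2 => snd (fst x) | ax3 => snd x end.

Definition vec (f : axis -> R) : R3 := (f ax1, f ax2, f ax3).

Definition basis (i : axis) : R3 :=
  match i with ax1 => (1, 0, 0) | ax2 => (0, 1, 0) | ax3 => (0, 0, 1) end.

Definition sum3 (f : axis -> R) : R := f ax1 + f ax2 + f ax3.

Definition dot (v w : R3) : R := sum3 (fun i => coord i v * coord i w).

Definition component (i : axis) (u : R3 -> R3) (x : R3) : R := coord i (u x).

Definition cylinder (x : R3) : Prop := coord ax1 x ^ 2 + coord ax2 x ^ 2 < 1.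
Definition closed_cylinder (x : R3) : Prop :=
  coord ax1 x ^ 2 + coord ax2 x ^ 2 <= 1.
Definition cylinder_boundary (x : R3) : Prop :=
  coord ax1 x ^ 2 + coord ax2 x ^ 2 = 1.

Definition on_line (f : R3 -> R) (x : R3) (i : axis) (t : R) : R :=
  f (plus x (scal t (basis i))).

Definition partial (i : axis) (f : R3 -> R) (x : R3) : R :=
  Derive (on_line f x i) 0.

Definition ex_partial (i : axis) (f : R3 -> R) (x : R3) : Prop :=
  ex_derive (on_line f x i) 0.

Definition partials (l : list axis) (f : R3 -> R) : R3 -> R :=
  fold_right partial f l.

(** Value at [x] of the continuous extension of [g] from [A] to its closure.
    It is meaningful when the limit exists, and only values of [g] on [A]
    matter. *)
Definition extend {U : UniformSpace} (A : U -> Prop) (g : U -> R) (x : U) : R :=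
  iota (fun l : R => filterlim g (within A (locally x)) (locally l)).

(** All partial derivatives of all orders exist in the open cylinder and extend
    continuously to the closed one; on the boundary [f] agrees with the
    extension of its values in the interior.  Values of [f] outside the closed
    cylinder are irrelevant. *)
Definition smooth_up_to_boundary (f : R3 -> R) : Prop :=
  (forall (l : list axis) (i : axis) (x : R3),
     cylinder x -> ex_partial i (partials l f) x) /\
  (forall (l : list axis) (x : R3), closed_cylinder x ->
     exists y : R,
       filterlim (partials l f) (within cylinder (locally x)) (locally y)) /\
  (forall x : R3, closed_cylinder x ->
     filterlim f (within cylinder (locally x)) (locally (f x))).

Definition laplacian (f : R3 -> R) (x : R3) : R :=
  sum3 (fun j => partial j (partial j f) x).

Definition divergence (u : R3 -> R3) (x : R3) : R :=
  sum3 (fun j => partial j (component j u) x).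

Definition stationary_navier_stokes (u : R3 -> R3) (p : R3 -> R) : Prop :=
  forall x : R3, cylinder x ->
    (forall i : axis,
       sum3 (fun j => component j u x * partial j (component i u) x)
       + partial i p x - laplacian (component i u) x = 0) /\
    divergence u x = 0.

(** Partial derivative up to the boundary. *)
Definition partial_bar (i : axis) (f : R3 -> R) : R3 -> R :=
  extend cylinder (partial i f).

Definition strain (u : R3 -> R3) (x : R3) (i j : axis) : R :=
  1 / 2 * (partial_bar j (component i u) x + partial_bar i (component j u) x).

(** The unit outer normal at points of [cylinder_boundary]. *)
Definition normal (x : R3) : R3 := (coord ax1 x, coord ax2 x, 0).

Definition tangential (x v : R3) : R3 :=
  minus v (scal (dot v (normal x)) (normal x)).

Definition strain_normal (u : R3 -> R3) (x : R3) : R3 :=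
  vec (fun i => sum3 (fun j => strain u x i j * coord j (normal x))).

Definition total_navier_slip (u : R3 -> R3) : Prop :=
  forall x : R3, cylinder_boundary x ->
    tangential x (strain_normal u x) = (0, 0, 0) /\ dot (u x) (normal x) = 0.

Definition radius (x : R3) : R := sqrt (coord ax1 x ^ 2 + coord ax2 x ^ 2).

(** On the axis the numerators vanish, so [e_r] and [e_theta] are 0 there
    (0 times the unspecified [/ 0]). *)
Definition e_r (x : R3) : R3 :=
  (coord ax1 x / radius x, coord ax2 x / radius x, 0).
Definition e_theta (x : R3) : R3 :=
  (- coord ax2 x / radius x, coord ax1 x / radius x, 0).
Definition e_z : R3 := (0, 0, 1).

Definition cyl (r theta z : R) : R3 := (r * cos theta, r * sin theta, z).

Definition theta_independent (f : R3 -> R) : Prop :=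
  forall r theta theta' z : R, 0 <= r <= 1 ->
    f (cyl r theta z) = f (cyl r theta' z).

Definition axially_symmetric (u : R3 -> R3) : Prop :=
  theta_independent (fun x => dot (u x) (e_r x)) /\
  theta_independent (fun x => dot (u x) (e_theta x)) /\
  theta_independent (fun x => dot (u x) e_z).

(** The cylindrical components as functions of (r, z), read off at theta = 0.
    With the convention for [e_r] and [e_theta] on the axis, [u_r] and
    [u_theta] vanish at r = 0, which is their limit there for a continuous
    axially symmetric field. *)
Definition u_r (u : R3 -> R3) (r z : R) : R :=
  dot (u (cyl r 0 z)) (e_r (cyl r 0 z)).
Definition u_theta (u : R3 -> R3) (r z : R) : R :=
  dot (u (cyl r 0 z)) (e_theta (cyl r 0 z)).
Definition u_z (u : R3 -> R3) (r z : R) : R :=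
  dot (u (cyl r 0 z)) e_z.

(** [omega_theta] is d_z u_r - d_r u_z for 0 < r < 1, extended by continuity to
    r = 0 and r = 1. *)
Definition omega_theta (u : R3 -> R3) (r z : R) : R :=
  extend (fun q : R * R => 0 < fst q < 1)
    (fun q : R * R => Derive (fun s => u_r u (fst q) s) (snd q)
              - Derive (fun s => u_z u s (snd q)) (fst q))
    (r, z).

Definition z_independent (g : R -> R -> R) : Prop :=
  forall r z z' : R, 0 <= r <= 1 -> g r z = g r z'.

(** The factorial of n + 1 is Gamma(n + 2). *)
Definition BesselJ1 (s : R) : R :=
  Series (fun n : nat =>
    (-1) ^ n / (INR (fact n) * INR (fact (n + 1))) * (s / 2) ^ (2 * n + 1)).

Definition smallest_positive_root (f : R -> R) (a : R) : Prop :=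
  0 < a /\ f a = 0 /\ forall s : R, 0 < s -> f s = 0 -> a <= s.

(* Main.v *)
Require Import Defs.
From Stdlib Require Import Reals List Factorial Lra Lia Psatz.
From Stdlib Require Import Classical IndefiniteDescription.
From Coquelicot Require Import Coquelicot.
Open Scope R_scope.

(** The flow is read off in the meridional plane x_2 = 0, as four functions of
    (r, z): a = u_r, b = u_theta, c = u_z and q = p, smooth on -1 < r < 1 and
    with bounded derivatives on bounded pieces of that strip
    ([meridional_flow_of_solution]).  Both cases are reduced to a = 0, b
    independent of z and c constant.  Then the angular equation is Euler's
    equation for b, whose solutions that vanish on the axis are C1 r, and the
    pressure follows from D1 q = b^2 / r and D2 q = 0 ([parallel_flow]).

    Case II.  If c depends on r only, incompressibility reads D1 (r a) = 0, so
    a = 0.  The axial equation makes D2 q a function of r only, and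
    differentiating D1 q = b^2 / r in z shows that b^2 is affine in z along each
    line.  Being nonnegative it is constant, so b is independent of z and D2 q
    is a constant k.  Integrating (r c')' = k r from the axis gives c' = k r / 2,
    and the slip condition c'(1) = 0 gives k = 0
    ([parallel_of_axial_z_independent]).

    Case I, vorticity.  Since b is independent of z, w = D2 a - D1 c satisfies
    an equation without swirl, and Omega = w / r is transported by the flow and
    diffused by the five-dimensional Laplacian.  The slip condition gives
    Omega = 0 on the wall.  For a convex h, multiply that equation by
    r h'(Omega) and integrate in r only.  As (r a, r c) is divergence free, the
    radial velocity leaves boundary terms only, and they vanish: so its
    exponential growth does not matter.  With a Poincare inequality in r, the
    functions F(z), the integral of r h(Omega), and Q(z), that of r c h(Omega),
    satisfy F'' - Q' >= F and |Q| <= A (1 + z^2)^(1/2 - e) F.  The growth of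
    c, with exponent less than 1, leaves room for a weight
    exp (- kappa (1 + z^2)^e) which absorbs the drift and decays faster than the
    polynomial growth of F, so F = 0 ([weighted_integral_bound],
    [vorticity_vanishes]).
    The hypothesis bounds w and not w / r, so h is chosen of growth 3/2 instead
    of 2: then r h(w / r) is integrable at the axis.  The whole computation is
    done on eps < r < 1 - eps, where everything is smooth; the boundary terms
    are of order eps or have a favourable sign ([radial_flux_margin]).

    Case I, velocity.  When w = 0, a solves
    D1 D1 a + D1 a / r - a / r^2 + D2 D2 a = 0 and vanishes at r = 0 and r = 1.
    For 0 < gamma < alpha with gamma0 < gamma, J_1(gamma r) cosh(gamma z) solves the same
    equation, is positive for 0 < r <= 1 because gamma < alpha, and dominates a
    at infinity because gamma0 < gamma.  The maximum principle gives a = 0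
    ([radial_phragmen_lindelof]), and w = 0 together with incompressibility
    makes c constant. *)

(** * One-variable calculus *)

Lemma is_derive_eq (f : R -> R) (x l l' : R) :
  is_derive f x l -> l = l' -> is_derive f x l'.
Proof. now intros H <-. Qed.

Lemma is_derive_nondecreasing (f df : R -> R) (a b : R) :
  a <= b -> (forall x, a <= x <= b -> is_derive f x (df x)) ->
  (forall x, a <= x <= b -> 0 <= df x) -> f a <= f b.
Proof.
intros ab Hf Hdf.
destruct (MVT_gen f a b df) as [c [Hc E]];
  rewrite ?(Rmin_left a b), ?(Rmax_right a b) in * by lra.
- intros x Hx; apply Hf; lra.
- intros x Hx; apply continuity_pt_filterlim, @ex_derive_continuous.
  exists (df x); apply Hf; lra.
- specialize (Hdf c Hc); nra.
Qed.

Lemma is_derive_increment_le (f df : R -> R) (a b B : R) :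
  a <= b -> (forall x, a <= x <= b -> is_derive f x (df x)) ->
  (forall x, a <= x <= b -> Rabs (df x) <= B) ->
  Rabs (f b - f a) <= B * (b - a).
Proof.
intros ab Hf Hdf.
destruct (MVT_gen f a b df) as [c [Hc E]];
  rewrite ?(Rmin_left a b), ?(Rmax_right a b) in * by lra.
- intros x Hx; apply Hf; lra.
- intros x Hx; apply continuity_pt_filterlim, @ex_derive_continuous.
  exists (df x); apply Hf; lra.
- rewrite E, Rabs_mult, (Rabs_pos_eq (b - a)) by lra.
  apply Rmult_le_compat_r; [lra | exact (Hdf c Hc)].
Qed.

Lemma is_derive_zero_eq (f : R -> R) (a b : R) :
  a <= b -> (forall x, a <= x <= b -> is_derive f x 0) -> f a = f b.
Proof.
intros ab Hf.
assert (H := is_derive_increment_le f (fun _ => 0) a b 0 ab Hf).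
assert (H' : Rabs (f b - f a) <= 0 * (b - a)).
{ apply H; intros; rewrite Rabs_R0; lra. }
assert (H2 := Rabs_pos (f b - f a)).
assert (H3 : Rabs (f b - f a) = 0) by lra.
destruct (Req_dec (f b - f a) 0) as [E | E]; [lra |].
now apply Rabs_no_R0 in E.
Qed.


(** The right-hand side minus the left-hand side, as a function of the upper end,
    has the nonnegative derivative [f - dS]: monotonicity replaces integration
    of [dS]. *)
Lemma increment_le_RInt (S dS f : R -> R) (a b : R) :
  a <= b -> (forall x, a <= x <= b -> is_derive S x (dS x)) ->
  (forall x, a <= x <= b -> continuous f x) ->
  (forall x, a <= x <= b -> dS x <= f x) ->
  S b - S a <= RInt f a b.
Proof.
intros ab HS Hf Hle.
destruct (Rle_lt_or_eq_dec a b ab) as [ab' | <-].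
2:{ rewrite RInt_point; unfold zero; simpl; lra. }
(* a continuous extension makes the indefinite integral differentiable also at
   the two ends *)
set (g := extension_C0 f a b).
assert (Hg : forall x, continuous g x).
{ intros x; apply (extension_C0_continuous f (Finite a) (Finite b)); simpl; [lra |].
  intros y Hy1 Hy2; apply Hf; lra. }
assert (Eg : forall x, a <= x <= b -> g x = f x).
{ intros x Hx; apply (extension_C0_ext f (Finite a) (Finite b)); simpl; lra. }
rewrite <- (RInt_ext g f).
2:{ intros x Hx; rewrite Rmin_left, Rmax_right in Hx by lra; apply Eg; lra. }
assert (H : RInt g a a - S a <= RInt g a b - S b).
{ apply (is_derive_nondecreasing (fun x => RInt g a x - S x)
           (fun x => g x - dS x)); [lra | |].
  - intros x Hx; apply @is_derive_minus; [| apply HS; lra].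
    apply @is_derive_RInt with a; [| apply Hg].
    apply filter_forall; intros y.
    apply (@RInt_correct R_CompleteNormedModule), @ex_RInt_continuous.
    intros; apply Hg.
  - intros x Hx; rewrite Eg by lra; specialize (Hle x Hx); lra. }
rewrite RInt_point in H; unfold zero in H; simpl in H; lra.
Qed.

Lemma RInt_le_increment (S dS f : R -> R) (a b : R) :
  a <= b -> (forall x, a <= x <= b -> is_derive S x (dS x)) ->
  (forall x, a <= x <= b -> continuous f x) ->
  (forall x, a <= x <= b -> f x <= dS x) ->
  RInt f a b <= S b - S a.
Proof.
intros ab HS Hf Hle.
assert (H : - S b - - S a <= RInt (fun x => - f x) a b).
{ apply (increment_le_RInt (fun x => - S x) (fun x => - dS x)); [exact ab | | |].
  - intros x Hx; now apply @is_derive_opp, HS.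
  - intros x Hx; now apply @continuous_opp, Hf.
  - intros x Hx; apply Ropp_le_contravar, Hle, Hx. }
assert (E : RInt (fun x => - f x) a b = - RInt f a b).
{ apply (RInt_opp f a b), @ex_RInt_continuous.
  rewrite Rmin_left, Rmax_right by lra; exact Hf. }
lra.
Qed.

(** * Compactness of rectangles *)

Lemma rectangle_finite_cover (a b c d : R) (delta : R -> R -> posreal) :
  exists l : list (R * R), forall x y, a <= x <= b -> c <= y <= d ->
    exists s t, In (s, t) l /\ a <= s <= b /\ c <= t <= d /\
      Rabs (x - s) < delta s t /\ Rabs (y - t) < delta s t.
Proof.
apply NNPP; intros H.
apply (compactness_list 2 (a, (c, tt)) (b, (d, tt))
         (fun p => delta (fst p) (fst (snd p)))).
intros [l Hl]; apply H.
exists (map (fun p : Compactness.Tn 2 R => (fst p, fst (snd p))) l).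
intros x y Hx Hy.
destruct (Hl (x, (y, tt))) as [[s [t []]] [H1 [H2 H3]]]; simpl in *; [tauto |].
exists s, t; repeat split; try tauto.
apply in_map_iff; exists (s, (t, tt)); auto.
Qed.

Lemma list_uniform_bound {T : Type} (P : T -> R -> Prop) (l : list T) :
  (forall t B B', P t B -> B <= B' -> P t B') ->
  (forall t, In t l -> exists B, P t B) -> exists B, forall t, In t l -> P t B.
Proof.
intros mono; induction l as [| t l IH]; intros H; [exists 0; simpl; tauto |].
destruct IH as [B HB]; [intros; apply H; simpl; tauto |].
destruct (H t) as [B' HB']; [simpl; tauto |].
exists (Rmax B B'); intros s [<- | Hs].
- apply mono with B'; [exact HB' | apply Rmax_r].
- apply mono with B; [now apply HB | apply Rmax_l].
Qed.

(** [A] will be the open strip: the limits at the wall bound a function near the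
    points of the wall, which belong to the closed rectangle but not to [A]. *)
Lemma rectangle_bounded (A : R -> R -> Prop) (f : R -> R -> R) (a b c d : R) :
  (forall s t, a <= s <= b -> c <= t <= d -> exists (e : posreal) (B : R),
     forall x y, A x y -> Rabs (x - s) < e -> Rabs (y - t) < e ->
       Rabs (f x y) <= B) ->
  exists B, forall x y, a <= x <= b -> c <= y <= d -> A x y ->
    Rabs (f x y) <= B.
Proof.
intros H.
assert (Hc : forall p : R * R, exists e : posreal,
  a <= fst p <= b -> c <= snd p <= d -> exists B, forall x y, A x y ->
    Rabs (x - fst p) < e -> Rabs (y - snd p) < e -> Rabs (f x y) <= B).
{ intros [s t]; simpl.
  destruct (classic (a <= s <= b /\ c <= t <= d)) as [[H1 H2] | H1].
  - destruct (H s t H1 H2) as [e He]; exists e; auto.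
  - exists (mkposreal 1 Rlt_0_1); tauto. }
destruct (functional_choice _ Hc) as [delta Hdelta].
destruct (rectangle_finite_cover a b c d (fun s t => delta (s, t))) as [l Hl].
destruct (list_uniform_bound (fun p B => a <= fst p <= b -> c <= snd p <= d ->
   forall x y, A x y -> Rabs (x - fst p) < delta p ->
     Rabs (y - snd p) < delta p -> Rabs (f x y) <= B) l) as [B HB].
- intros p B B' HB le H1 H2 x y Hxy H3 H4; apply Rle_trans with B; auto.
- intros p _.
  destruct (classic (a <= fst p <= b /\ c <= snd p <= d)) as [[H1 H2] | H1].
  + destruct (Hdelta p H1 H2) as [B HB]; exists B; auto.
  + exists 0; tauto.
- exists B; intros x y Hx Hy Hxy.
  destruct (Hl x y Hx Hy) as [s [t [I [H1 [H2 [H3 H4]]]]]].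
  now apply (HB (s, t)).
Qed.

Lemma list_argmax {T : Type} (f : T -> R) (t0 : T) (l : list T) :
  exists m, In m (t0 :: l) /\ forall t, In t (t0 :: l) -> f t <= f m.
Proof.
induction l as [| t l [m [I Hm]]].
- exists t0; split; [simpl; tauto | intros t [<- | []]; lra].
- destruct (Rle_dec (f t) (f m)) as [le | nle].
  + exists m; split; [simpl in *; tauto |].
    intros s [<- | [<- | Hs]]; [apply Hm; simpl; tauto | exact le |].
    apply Hm; simpl; tauto.
  + exists t; split; [simpl; tauto |].
    intros s [<- | [<- | Hs]]; [| lra |];
      (apply Rle_trans with (f m); [apply Hm; simpl; tauto | lra]).
Qed.

Definition continuous2 (f : R -> R -> R) (x y : R) : Prop :=
  continuous (fun p : R * R => f (fst p) (snd p)) (x, y).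

Lemma continuous2_iff (f : R -> R -> R) (x y : R) :
  continuous2 f x y <-> continuity_2d_pt f x y.
Proof. symmetry; apply continuity_2d_pt_filterlim. Qed.

Lemma rectangle_max (f : R -> R -> R) (a b c d : R) :
  a <= b -> c <= d ->
  (forall x y, a <= x <= b -> c <= y <= d -> continuous2 f x y) ->
  exists x0 y0, a <= x0 <= b /\ c <= y0 <= d /\
    forall x y, a <= x <= b -> c <= y <= d -> f x y <= f x0 y0.
Proof.
intros ab cd Hf; apply NNPP; intros N.
(* otherwise each point has a neighbourhood where f is below the value of f at
   some other point of the rectangle *)
assert (Hc : forall p : R * R, exists eq : posreal * (R * R),
  a <= fst p <= b -> c <= snd p <= d ->
  (a <= fst (snd eq) <= b /\ c <= snd (snd eq) <= d) /\
  forall x y, Rabs (x - fst p) < fst eq -> Rabs (y - snd p) < fst eq ->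
    f x y < f (fst (snd eq)) (snd (snd eq))).
{ intros [s t]; simpl.
  destruct (classic (a <= s <= b /\ c <= t <= d)) as [[H1 H2] | H1].
  2:{ exists (mkposreal 1 Rlt_0_1, (0, 0)); tauto. }
  destruct (classic (exists x y, a <= x <= b /\ c <= y <= d /\ f s t < f x y))
    as [[x [y [Hx [Hy lt]]]] | no].
  2:{ exfalso; apply N; exists s, t; repeat split; try tauto.
      intros x y Hx Hy; apply Rnot_lt_le; intros lt; apply no.
      exists x, y; auto. }
  assert (Hp : 0 < f x y - f s t) by lra.
  destruct (proj1 (continuous2_iff f s t) (Hf s t H1 H2) (mkposreal _ Hp))
    as [e He]; simpl in He.
  exists (e, (x, y)); simpl; intros _ _; split; [tauto |].
  intros x' y' Hx' Hy'; specialize (He x' y' Hx' Hy').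
  apply Rabs_lt_between in He; lra. }
destruct (functional_choice _ Hc) as [g Hg].
destruct (rectangle_finite_cover a b c d (fun s t => fst (g (s, t)))) as [l Hl].
set (l' := filter (fun p => if Rle_dec a (fst p) then if Rle_dec (fst p) b then
   if Rle_dec c (snd p) then if Rle_dec (snd p) d then true else false
   else false else false else false) l).
assert (Hl' : forall p, In p l' <-> In p l /\ a <= fst p <= b /\ c <= snd p <= d).
{ intros p; unfold l'; rewrite filter_In.
  destruct (Rle_dec a (fst p)), (Rle_dec (fst p) b), (Rle_dec c (snd p)),
    (Rle_dec (snd p) d); intuition (try lra; congruence). }
destruct (list_argmax (fun p => f (fst (snd (g p))) (snd (snd (g p)))) (a, c) l')
  as [m [I Hm]].
assert (Rm : a <= fst m <= b /\ c <= snd m <= d).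
{ destruct I as [<- | I]; [simpl; lra | apply Hl'; exact I]. }
destruct (Hg m (proj1 Rm) (proj2 Rm)) as [[Rx Ry] _].
destruct (Hl _ _ Rx Ry) as [s [t [Ist [H1 [H2 [H3 H4]]]]]].
destruct (Hg (s, t) H1 H2) as [_ Hst]; specialize (Hst _ _ H3 H4).
assert (Hmst := Hm (s, t)).
apply (Rlt_irrefl (f (fst (snd (g m))) (snd (snd (g m))))).
eapply Rlt_le_trans; [exact Hst |]; apply Hmst; right; apply Hl'; simpl; auto.
Qed.

(** * Integrals depending on a parameter *)

(** The margins between [lo], [a], [b] and [hi] make the derivative in the
    parameter jointly continuous at the ends of the interval too. *)
Lemma is_derive_integral (G dG : R -> R -> R) (lo a b hi y : R) :
  lo < a -> a <= b -> b < hi ->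
  (forall x z, lo < x < hi -> is_derive (G x) z (dG x z)) ->
  (forall x z, lo < x < hi -> continuous2 G x z) ->
  (forall x z, lo < x < hi -> continuous2 dG x z) ->
  is_derive (fun z => RInt (fun x => G x z) a b) y
    (RInt (fun x => dG x y) a b).
Proof.
intros la ab bh HG cG cdG.
rewrite (RInt_ext _ (fun x => Derive (fun z => G x z) y)).
2:{ rewrite Rmin_left, Rmax_right by lra.
    intros x Hx; symmetry; apply is_derive_unique, HG; lra. }
apply (is_derive_RInt_param (fun z x => G x z));
  rewrite ?Rmin_left, ?Rmax_right by lra.
- apply filter_forall; intros z x Hx; exists (dG x z); apply HG; lra.
- intros x Hx.
  assert (Hd : 0 < Rmin (x - lo) (hi - x)) by (apply Rmin_pos; lra).
  apply continuity_2d_pt_ext_loc with (fun u v => dG v u).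
  + exists (mkposreal _ Hd); simpl; intros u v _ Hv.
    symmetry; apply is_derive_unique, HG.
    assert (H1 := Rmin_l (x - lo) (hi - x)).
    assert (H2 := Rmin_r (x - lo) (hi - x)).
    apply Rabs_lt_between in Hv; lra.
  + intros e; destruct (proj1 (continuous2_iff dG x y)
      (cdG x y ltac:(lra)) e) as [d Hde].
    exists d; intros u v Hu Hv; now apply Hde.
- apply filter_forall; intros z; apply @ex_RInt_continuous.
  rewrite Rmin_left, Rmax_right by lra; intros x Hx.
  apply (continuous_comp_2 (fun x => x) (fun _ => z) G);
    [apply continuous_id | apply continuous_const | apply cG; lra].
Qed.

(** * Smooth functions on the strip *)

Definition D1 (g : R -> R -> R) (r z : R) : R := Derive (fun s => g s z) r.
Definition D2 (g : R -> R -> R) (r z : R) : R := Derive (fun s => g r s) z.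

(** The strip is -1 < r < 1; it is crossed by the axis so that parity in [r]
    can be used there.  Bounds on bounded pieces of the strip encode smoothness
    up to its boundary.  Coinduction covers the derivatives of all orders: those
    of a smooth function are smooth by projection. *)
CoInductive strip_smooth (g : R -> R -> R) : Prop := Strip_smooth {
  strip_ex1 : forall r z, -1 < r < 1 -> ex_derive (fun s => g s z) r;
  strip_ex2 : forall r z, -1 < r < 1 -> ex_derive (fun s => g r s) z;
  strip_cont : forall r z, -1 < r < 1 -> continuous2 g r z;
  strip_bounded : forall Z, exists B, forall r z, -1 < r < 1 -> Rabs z <= Z ->
    Rabs (g r z) <= B;
  strip_D1 : strip_smooth (D1 g);
  strip_D2 : strip_smooth (D2 g) }.

Lemma strip_locally (P : R -> Prop) (r : R) : -1 < r < 1 ->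
  (forall s, -1 < s < 1 -> P s) -> locally r P.
Proof.
intros Hr HP.
apply filter_imp with (fun s => -1 < s /\ s < 1); [intros s [? ?]; apply HP; lra |].
apply filter_and; [apply (open_gt (-1)) | apply (open_lt 1)]; tauto.
Qed.

Lemma strip_locally2 (P : R * R -> Prop) (r z : R) : -1 < r < 1 ->
  (forall s t, -1 < s < 1 -> P (s, t)) -> locally (r, z) P.
Proof.
intros Hr HP.
destruct (strip_locally (fun s => forall t, P (s, t)) r Hr) as [e He].
{ intros; now apply HP. }
exists e; intros [s t] [H1 _]; now apply He.
Qed.

Lemma D1_ext (f g : R -> R -> R) :
  (forall r z, -1 < r < 1 -> f r z = g r z) ->
  forall r z, -1 < r < 1 -> D1 f r z = D1 g r z.
Proof.
intros E r z Hr; apply Derive_ext_loc, strip_locally; auto.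
Qed.

Lemma D2_ext (f g : R -> R -> R) :
  (forall r z, -1 < r < 1 -> f r z = g r z) ->
  forall r z, -1 < r < 1 -> D2 f r z = D2 g r z.
Proof. intros E r z Hr; apply Derive_ext; auto. Qed.

Lemma continuous2_ext (f g : R -> R -> R) (r z : R) :
  (forall r z, -1 < r < 1 -> f r z = g r z) -> -1 < r < 1 ->
  continuous2 g r z -> continuous2 f r z.
Proof.
intros E Hr Hg; unfold continuous2.
apply (continuous_ext_loc _ (fun p => g (fst p) (snd p))); [| exact Hg].
apply strip_locally2; [exact Hr |]; intros s t Hs; symmetry; now apply E.
Qed.

Lemma strip_smooth_minus (g h : R -> R -> R) :
  strip_smooth g -> strip_smooth h ->
  strip_smooth (fun r z => g r z - h r z).
Proof.
intros Hg Hh.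
(* an arbitrary f that agrees with the difference, so that the recursive calls
   are on the derivatives of f *)
enough (H : forall f, (forall r z, -1 < r < 1 -> f r z = g r z - h r z) ->
  strip_smooth f) by now apply H.
revert g h Hg Hh; cofix IH; intros g h Hg Hh f E.
assert (E1 := D1_ext _ _ E); assert (E2 := D2_ext _ _ E); split.
- intros r z Hr; apply ex_derive_ext_loc with (fun s => g s z - h s z).
  + apply strip_locally; [exact Hr |]; intros; symmetry; auto.
  + apply @ex_derive_minus; now apply strip_ex1.
- intros r z Hr; apply ex_derive_ext with (fun s => g r s - h r s).
  + intros; symmetry; auto.
  + apply @ex_derive_minus; now apply strip_ex2.
- intros r z Hr; apply (continuous2_ext _ _ _ _ E Hr).
  apply @continuous_minus; now apply strip_cont.
- intros Z; destruct (strip_bounded g Hg Z) as [B HB].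
  destruct (strip_bounded h Hh Z) as [B' HB'].
  exists (B + B'); intros r z Hr Hz; rewrite E by exact Hr.
  specialize (HB r z Hr Hz); specialize (HB' r z Hr Hz).
  unfold Rabs in *; repeat destruct Rcase_abs; lra.
- apply (IH (D1 g) (D1 h) (strip_D1 g Hg) (strip_D1 h Hh)).
  intros r z Hr; rewrite E1 by exact Hr.
  apply Derive_minus; now apply strip_ex1.
- apply (IH (D2 g) (D2 h) (strip_D2 g Hg) (strip_D2 h Hh)).
  intros r z Hr; rewrite E2 by exact Hr.
  apply Derive_minus; now apply strip_ex2.
Qed.

Lemma strip_is_derive1 (g : R -> R -> R) (r z : R) : strip_smooth g ->
  -1 < r < 1 -> is_derive (fun s => g s z) r (D1 g r z).
Proof. intros Hg Hr; apply Derive_correct; now apply strip_ex1. Qed.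

Lemma strip_is_derive2 (g : R -> R -> R) (r z : R) : strip_smooth g ->
  -1 < r < 1 -> is_derive (fun s => g r s) z (D2 g r z).
Proof. intros Hg Hr; apply Derive_correct; now apply strip_ex2. Qed.

Lemma D_commute (g : R -> R -> R) (r z : R) : strip_smooth g -> -1 < r < 1 ->
  D1 (D2 g) r z = D2 (D1 g) r z.
Proof.
intros Hg Hr; unfold D1, D2; apply Schwarz.
- destruct (strip_locally (fun s => -1 < s < 1) r Hr) as [e He]; [auto |].
  exists e; intros u v Hu _.
  assert (-1 < u < 1) by now apply He.
  repeat split.
  + now apply (strip_ex1 g).
  + now apply (strip_ex2 g).
  + now apply (strip_ex1 (D2 g) (strip_D2 g Hg)).
  + now apply (strip_ex2 (D1 g) (strip_D1 g Hg)).
- apply continuous2_iff, (strip_cont (D1 (D2 g))); [| exact Hr].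
  now apply strip_D1, strip_D2.
- apply continuous2_iff, (strip_cont (D2 (D1 g))); [| exact Hr].
  now apply strip_D2, strip_D1.
Qed.

(** * Restriction to the meridional plane *)

Definition slice (f : R3 -> R) (r z : R) : R := f (r, 0, z).

Lemma Derive_shift (g : R -> R) (x : R) : Derive (fun t => g (x + t)) 0 = Derive g x.
Proof.
unfold Derive; f_equal; apply Lim_ext; intros h.
now replace (x + (0 + h)) with (x + h) by ring; rewrite Rplus_0_r.
Qed.

Lemma ex_derive_shift (g : R -> R) (x : R) :
  ex_derive (fun t => g (x + t)) 0 -> ex_derive g x.
Proof.
intros H; apply ex_derive_ext with (fun s => (fun t => g (x + t)) (s - x)).
{ intros s; f_equal; ring. }
apply (ex_derive_comp (fun t => g (x + t)) (fun s => s - x)).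
- now replace (x - x) with 0 by ring.
- auto_derive; auto.
Qed.

Lemma on_line_eq (f : R3 -> R) (x y z : R) :
  (forall t, on_line f (x, y, z) ax1 t = f (x + t, y, z)) /\
  (forall t, on_line f (x, y, z) ax2 t = f (x, y + t, z)) /\
  (forall t, on_line f (x, y, z) ax3 t = f (x, y, z + t)).
Proof.
repeat split; intros t; unfold on_line; f_equal;
  unfold plus, scal; simpl; unfold prod_plus, prod_scal, scal; simpl;
  unfold mult, plus; simpl; repeat f_equal; try ring;
  unfold prod_plus, prod_scal, scal, plus; simpl; unfold mult; simpl;
  repeat f_equal; ring.
Qed.

Lemma partial_ax1 (f : R3 -> R) (x y z : R) :
  partial ax1 f (x, y, z) = Derive (fun s => f (s, y, z)) x.
Proof.
unfold partial; rewrite <- (Derive_shift (fun s => f (s, y, z)) x).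
apply Derive_ext, on_line_eq.
Qed.

Lemma partial_ax2 (f : R3 -> R) (x y z : R) :
  partial ax2 f (x, y, z) = Derive (fun s => f (x, s, z)) y.
Proof.
unfold partial; rewrite <- (Derive_shift (fun s => f (x, s, z)) y).
apply Derive_ext, on_line_eq.
Qed.

Lemma partial_ax3 (f : R3 -> R) (x y z : R) :
  partial ax3 f (x, y, z) = Derive (fun s => f (x, y, s)) z.
Proof.
unfold partial; rewrite <- (Derive_shift (fun s => f (x, y, s)) z).
apply Derive_ext, on_line_eq.
Qed.

Lemma cylinder_slice (r z : R) : -1 < r < 1 -> cylinder (r, 0, z).
Proof. intros H; unfold cylinder; simpl; nra. Qed.

Lemma closed_cylinder_slice (r z : R) : -1 <= r <= 1 -> closed_cylinder (r, 0, z).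
Proof. intros H; unfold closed_cylinder; simpl; nra. Qed.

Lemma limit_on_slice (f : R3 -> R) (r z y : R) :
  filterlim f (within cylinder (locally (r, 0, z))) (locally y) ->
  forall e : posreal, exists d : posreal, forall s t, -1 < s < 1 ->
    Rabs (s - r) < d -> Rabs (t - z) < d -> Rabs (slice f s t - y) < e.
Proof.
intros H e.
destruct (proj1 (filterlim_locally _ _) H e) as [d Hd].
exists d; intros s t Hs H1 H2.
apply (Hd (s, 0, t)); [| now apply cylinder_slice].
split; [split |]; simpl; [exact H1 | | exact H2].
apply ball_center.
Qed.

(** Derivatives in the first and third variables commute with the restriction to
    the plane.  The limits that define smoothness up to the boundary are taken at
    all points of the closed cylinder: at interior points they give continuity,
    and at the wall, by compactness, bounds. *)
Lemma smooth_slice (f : R3 -> R) :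
  smooth_up_to_boundary f -> strip_smooth (slice f).
Proof.
intros [Hd [Hl _]].
enough (H : forall l g, (forall r z, -1 < r < 1 ->
  g r z = slice (partials l f) r z) -> strip_smooth g) by now apply (H nil).
cofix IH; intros l g E.
assert (D1E : forall r z, -1 < r < 1 ->
  D1 g r z = slice (partials (ax1 :: l) f) r z).
{ intros r z Hr; rewrite (D1_ext _ _ E) by exact Hr.
  unfold slice; simpl; now rewrite partial_ax1. }
assert (D2E : forall r z, -1 < r < 1 ->
  D2 g r z = slice (partials (ax3 :: l) f) r z).
{ intros r z Hr; rewrite (D2_ext _ _ E) by exact Hr.
  unfold slice; simpl; now rewrite partial_ax3. }
split.
- intros r z Hr; apply ex_derive_ext_loc with (fun s => slice (partials l f) s z).
  { apply strip_locally; [exact Hr |]; intros; symmetry; auto. }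
  apply ex_derive_shift.
  eapply ex_derive_ext; [| apply (Hd l ax1 (r, 0, z)), cylinder_slice, Hr].
  apply (on_line_eq (partials l f)).
- intros r z Hr; apply ex_derive_ext with (fun s => slice (partials l f) r s).
  { intros; symmetry; auto. }
  apply ex_derive_shift.
  eapply ex_derive_ext; [| apply (Hd l ax3 (r, 0, z)), cylinder_slice, Hr].
  apply (on_line_eq (partials l f)).
- intros r z Hr; apply (continuous2_ext _ _ _ _ E Hr), continuous2_iff.
  destruct (Hl l (r, 0, z)) as [y Hy]; [apply closed_cylinder_slice; lra |].
  assert (Lim := limit_on_slice _ _ _ _ Hy).
  (* the point itself is in the domain of the limit *)
  assert (Ey : slice (partials l f) r z = y).
  { apply Req_lt_aux; intros e; destruct (Lim e) as [d H]; apply H; [exact Hr | |];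
      rewrite Rminus_diag, Rabs_R0; apply cond_pos. }
  intros e; destruct (Lim e) as [d H].
  destruct (strip_locally (fun s => -1 < s < 1) r Hr) as [d' Hd']; [auto |].
  assert (0 < Rmin d d') as Hm by (apply Rmin_pos; apply cond_pos).
  exists (mkposreal _ Hm); simpl; intros s t H1 H2; rewrite Ey.
  assert (Hm1 := Rmin_l d d'); assert (Hm2 := Rmin_r d d').
  apply H; [apply Hd' | |]; try lra.
  change (Rabs (s - r) < d'); lra.
- intros Z.
  destruct (rectangle_bounded (fun r _ => -1 < r < 1) g (-1) 1 (-Z) Z) as [B HB].
  + intros s t Hs _.
    destruct (Hl l (s, 0, t)) as [y Hy]; [now apply closed_cylinder_slice |].
    destruct (limit_on_slice _ _ _ _ Hy (mkposreal 1 Rlt_0_1)) as [d H].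
    exists d, (Rabs y + 1); intros r z Hr H1 H2; rewrite E by exact Hr.
    specialize (H r z Hr H1 H2); simpl in H.
    unfold Rabs in *; repeat destruct Rcase_abs; lra.
  + exists B; intros r z Hr Hz; apply HB; [lra | | exact Hr].
    now apply Rabs_le_between in Hz.
- exact (IH (ax1 :: l) _ D1E).
- exact (IH (ax3 :: l) _ D2E).
Qed.

(** * Polar coordinates *)

Lemma polar_coordinates (x y : R) : 0 < sqrt (x ^ 2 + y ^ 2) ->
  exists theta, x = sqrt (x ^ 2 + y ^ 2) * cos theta /\
    y = sqrt (x ^ 2 + y ^ 2) * sin theta.
Proof.
set (r := sqrt (x ^ 2 + y ^ 2)); intros Hr.
assert (Hr2 : r * r = x ^ 2 + y ^ 2) by (apply sqrt_sqrt; nra).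
assert (Hx : x = r * (x / r)) by (field; lra).
assert (Hy : y = r * (y / r)) by (field; lra).
set (c := x / r) in *; set (s := y / r) in *.
assert (cs : s * s = 1 - c * c).
{ apply Rmult_eq_reg_l with (r * r); [| nra].
  replace (r * r * (s * s)) with ((r * s) * (r * s)) by ring.
  replace (r * r * (1 - c * c)) with (r * r - (r * c) * (r * c)) by ring.
  rewrite <- Hx, <- Hy, Hr2; ring. }
assert (Hc : -1 <= c <= 1) by nra.
destruct (Rle_dec 0 s) as [Hs | Hs].
- exists (acos c); rewrite cos_acos, sin_acos by lra; split; [exact Hx |].
  replace (1 - Rsqr c) with (s * s) by (unfold Rsqr; lra).
  rewrite sqrt_square by lra; exact Hy.
- exists (- acos c); rewrite cos_neg, sin_neg, cos_acos, sin_acos by lra.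
  split; [exact Hx |].
  replace (1 - Rsqr c) with ((- s) * (- s)) by (unfold Rsqr; lra).
  rewrite sqrt_square, Ropp_involutive by lra; exact Hy.
Qed.

Lemma radius_cyl (r theta z : R) : 0 <= r -> radius (cyl r theta z) = r.
Proof.
intros Hr; unfold radius, cyl; simpl.
replace (_ + _) with (r * r).
- now apply sqrt_square.
- assert (H := sin2_cos2 theta); unfold Rsqr in H; nra.
Qed.

Lemma cyl_zero (r z : R) : cyl r 0 z = (r, 0, z).
Proof. unfold cyl; rewrite cos_0, sin_0; repeat f_equal; ring. Qed.

Lemma axially_symmetric_components (u : R3 -> R3) (x y z : R) :
  axially_symmetric u ->
  let rho := sqrt (x ^ 2 + y ^ 2) in 0 < rho <= 1 ->
  component ax1 u (x, y, z) =
    (slice (component ax1 u) rho z * x - slice (component ax2 u) rho z * y) / rho /\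
  component ax2 u (x, y, z) =
    (slice (component ax2 u) rho z * x + slice (component ax1 u) rho z * y) / rho /\
  component ax3 u (x, y, z) = slice (component ax3 u) rho z.
Proof.
intros [Hr [Ht Hz]] rho [H0 H1].
destruct (polar_coordinates x y H0) as [theta [Ex Ey]]; fold rho in Ex, Ey.
specialize (Hr rho theta 0 z ltac:(lra)).
specialize (Ht rho theta 0 z ltac:(lra)).
specialize (Hz rho theta 0 z ltac:(lra)).
unfold dot, sum3, e_r, e_theta, e_z in Hr, Ht, Hz.
rewrite !radius_cyl in Hr, Ht by lra.
rewrite !cyl_zero in Hr, Ht, Hz.
replace (cyl rho theta z) with (x, y, z) in * by (unfold cyl; congruence).
unfold slice, component; simpl in *.
destruct (u (x, y, z)) as [[u1 u2] u3]; destruct (u (rho, 0, z)) as [[v1 v2] v3].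
simpl in *.
assert (Hxy : x * x + y * y = rho * rho).
{ unfold rho; rewrite sqrt_sqrt; nra. }
assert (N : rho <> 0) by lra.
assert (Er : u1 * x + u2 * y = v1 * rho).
{ match type of Hr with ?l = _ => transitivity (l * rho) end;
    [| rewrite Hr]; field; auto. }
assert (Et : - (u1 * y) + u2 * x = v2 * rho).
{ match type of Ht with ?l = _ => transitivity (l * rho) end;
    [| rewrite Ht]; field; auto. }
assert (rearrange : forall a b, a * rho = b -> a = b / rho).
{ intros a b <-; field; auto. }
repeat split; [| | lra]; apply rearrange, Rmult_eq_reg_r with rho; try exact N.
- transitivity (x * (v1 * rho) - y * (v2 * rho)); [| ring].
  rewrite <- Er, <- Et, Rmult_assoc, <- Hxy; ring.
- transitivity (x * (v2 * rho) + y * (v1 * rho)); [| ring].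
  rewrite <- Er, <- Et, Rmult_assoc, <- Hxy; ring.
Qed.

Lemma theta_independent_eq (f : R3 -> R) (x y z : R) :
  theta_independent f -> let rho := sqrt (x ^ 2 + y ^ 2) in 0 < rho <= 1 ->
  f (x, y, z) = slice f rho z.
Proof.
intros H rho [H0 H1].
destruct (polar_coordinates x y H0) as [theta [Ex Ey]]; fold rho in Ex, Ey.
specialize (H rho theta 0 z ltac:(lra)).
rewrite cyl_zero in H; unfold slice; rewrite <- H; unfold cyl; congruence.
Qed.

Lemma near_meridional_plane (r : R) : 0 < r < 1 ->
  locally 0 (fun t => 0 < sqrt (r ^ 2 + t ^ 2) < 1).
Proof.
intros Hr.
assert (H : 0 < 1 - r) by lra.
exists (mkposreal _ H); intros t Ht.
unfold ball in Ht; simpl in Ht; unfold AbsRing_ball, abs, minus, plus, opp in Ht.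
simpl in Ht; rewrite Ropp_0, Rplus_0_r in Ht; apply Rabs_lt_between in Ht.
split; [apply sqrt_lt_R0; nra |].
rewrite <- sqrt_1; apply sqrt_lt_1; nra.
Qed.

(** Every cylindrical component turns out, along the lines orthogonal to the
    meridional plane, into [alpha rho * r - beta rho * t] for suitable [alpha]
    and [beta]; this is what makes the derivatives across that plane
    expressible by derivatives within it. *)
Lemma transversal_derivatives (f : R3 -> R) (alpha beta dalpha dbeta : R -> R)
  (r z : R) : 0 < r < 1 ->
  (forall s, 0 < s < 1 -> is_derive alpha s (dalpha s)) ->
  (forall s, 0 < s < 1 -> is_derive beta s (dbeta s)) ->
  ex_derive dalpha r -> ex_derive dbeta r ->
  (forall t, 0 < sqrt (r ^ 2 + t ^ 2) < 1 ->
    f (r, t, z) = alpha (sqrt (r ^ 2 + t ^ 2)) * r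
                  - beta (sqrt (r ^ 2 + t ^ 2)) * t) ->
  partial ax2 f (r, 0, z) = - beta r /\
  partial ax2 (partial ax2 f) (r, 0, z) = dalpha r.
Proof.
intros Hr Ha Hb Hda Hdb Hf.
set (rho := fun t => sqrt (r ^ 2 + t ^ 2)).
assert (rho0 : rho 0 = r).
{ unfold rho; replace (r ^ 2 + 0 ^ 2) with (r * r) by ring; apply sqrt_square; lra. }
assert (near := near_meridional_plane r Hr); fold rho in near, Hf.
assert (Drho : forall t, 0 < rho t -> is_derive rho t (t / rho t)).
{ intros t Ht; unfold rho in *; auto_derive.
  - nra.
  - replace (r * (r * 1) + t * (t * 1)) with (r ^ 2 + t ^ 2) by ring.
    field; lra. }
set (dphi := fun t => (dalpha (rho t) * r - dbeta (rho t) * t) / rho t * t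
                      - beta (rho t)).
assert (first : forall t, 0 < rho t < 1 -> locally t (fun s => 0 < rho s < 1) ->
  partial ax2 f (r, t, z) = dphi t).
{ intros t Ht Hl; rewrite partial_ax2.
  rewrite (Derive_ext_loc _ (fun s => alpha (rho s) * r - beta (rho s) * s)).
  2:{ revert Hl; apply filter_imp; intros s Hs; now apply Hf. }
  apply is_derive_unique.
  assert (Da := is_derive_comp alpha rho t _ _ (Ha _ Ht) (Drho t (proj1 Ht))).
  assert (Db := is_derive_comp beta rho t _ _ (Hb _ Ht) (Drho t (proj1 Ht))).
  eapply is_derive_eq.
  - apply @is_derive_minus.
    + apply (is_derive_scal_l (fun s => alpha (rho s)) t _ r Da).
    + apply (is_derive_mult (fun s => beta (rho s)) (fun s => s) t _ _ Db
               (is_derive_id t) Rmult_comm).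
  - unfold dphi, minus, plus, opp, mult, scal, one; simpl; unfold mult; simpl.
    field; lra. }
split.
- rewrite first; [unfold dphi; rewrite rho0; ring | rewrite rho0; lra | exact near].
- rewrite partial_ax2.
  rewrite (Derive_ext_loc _ dphi).
  2:{ apply locally_locally in near.
      revert near; apply filter_imp; intros t Ht; apply first; [| exact Ht].
      now apply locally_singleton in Ht. }
  apply is_derive_unique; unfold dphi.
  assert (D0 : is_derive rho 0 0).
  { replace 0 with (0 / rho 0) at 2 by (rewrite rho0; field; lra).
    apply Drho; rewrite rho0; lra. }
  assert (Hr0 : 0 < rho 0 < 1) by (rewrite rho0; lra).
  assert (Db := is_derive_comp beta rho 0 _ _ (Hb _ Hr0) D0).
  assert (exk : ex_derive (fun t =>
    (dalpha (rho t) * r - dbeta (rho t) * t) / rho t) 0).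
  { assert (ex_derive (fun t => dalpha (rho t)) 0).
    { apply (ex_derive_comp dalpha rho); [now rewrite rho0 | exists 0; exact D0]. }
    assert (ex_derive (fun t => dbeta (rho t)) 0).
    { apply (ex_derive_comp dbeta rho); [now rewrite rho0 | exists 0; exact D0]. }
    assert (ex_derive rho 0) by (exists 0; exact D0).
    auto_derive; rewrite !rho0; repeat split; auto; lra. }
  destruct exk as [k Hk].
  eapply is_derive_eq.
  + apply @is_derive_minus; [| exact Db].
    apply (is_derive_mult _ (fun t => t) 0 _ _ Hk (is_derive_id 0) Rmult_comm).
  + rewrite rho0; unfold minus, plus, opp, mult, scal, one; simpl; unfold mult; simpl.
    field; lra.
Qed.

(** * The meridional equations *)

Definition vorticity (a c : R -> R -> R) (r z : R) : R := D2 a r z - D1 c r z.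

(** The axially symmetric equations for u_r, u_theta, u_z and p.  The letters
    [a], [b], [c], [q] are the restrictions of u_1, u_2, u_3, p to the plane
    x_2 = 0, so that negative [r] means the half-plane opposite to theta = 0. *)
Record meridional_flow (a b c q : R -> R -> R) : Prop := {
  smooth_a : strip_smooth a;
  smooth_b : strip_smooth b;
  smooth_c : strip_smooth c;
  smooth_q : strip_smooth q;
  continuity_eq : forall r z, 0 < r < 1 -> D1 a r z + a r z / r + D2 c r z = 0;
  radial_eq : forall r z, 0 < r < 1 ->
    a r z * D1 a r z - b r z ^ 2 / r + c r z * D2 a r z + D1 q r z
    = D1 (D1 a) r z + D1 a r z / r - a r z / r ^ 2 + D2 (D2 a) r z;
  angular_eq : forall r z, 0 < r < 1 ->
    a r z * D1 b r z + a r z * b r z / r + c r z * D2 b r z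
    = D1 (D1 b) r z + D1 b r z / r - b r z / r ^ 2 + D2 (D2 b) r z;
  axial_eq : forall r z, 0 < r < 1 ->
    a r z * D1 c r z + c r z * D2 c r z + D2 q r z
    = D1 (D1 c) r z + D1 c r z / r + D2 (D2 c) r z;
  axis_a : forall z, a 0 z = 0;
  axis_b : forall z, b 0 z = 0;
  axis_c : forall z, D1 c 0 z = 0;
  wall_a : forall z, filterlim (fun r => a r z) (at_left 1) (locally 0);
  wall_c : forall z, filterlim (fun r => D1 c r z) (at_left 1) (locally 0);
  wall_vorticity : forall z,
    filterlim (fun r => vorticity a c r z) (at_left 1) (locally 0) }.

Lemma D1_slice (f : R3 -> R) (r z : R) :
  D1 (slice f) r z = partial ax1 f (r, 0, z).
Proof. now rewrite partial_ax1. Qed.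

Lemma D2_slice (f : R3 -> R) (r z : R) :
  D2 (slice f) r z = partial ax3 f (r, 0, z).
Proof. now rewrite partial_ax3. Qed.

Lemma D11_slice (f : R3 -> R) (r z : R) :
  D1 (D1 (slice f)) r z = partial ax1 (partial ax1 f) (r, 0, z).
Proof. rewrite partial_ax1; apply Derive_ext; intros; apply D1_slice. Qed.

Lemma D22_slice (f : R3 -> R) (r z : R) :
  D2 (D2 (slice f)) r z = partial ax3 (partial ax3 f) (r, 0, z).
Proof. rewrite partial_ax3; apply Derive_ext; intros; apply D2_slice. Qed.

Lemma is_derive_over_r (g : R -> R -> R) (s z : R) :
  strip_smooth g -> 0 < s < 1 ->
  is_derive (fun s => g s z / s) s (D1 g s z / s - g s z / s ^ 2).
Proof.
intros Hg Hs.
assert (H := strip_ex1 g Hg s z ltac:(lra)).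
unfold D1; auto_derive; [repeat split; auto; lra | field; lra].
Qed.

Lemma ex_derive_over_r (g : R -> R -> R) (s z : R) :
  strip_smooth g -> 0 < s < 1 ->
  ex_derive (fun s => D1 g s z / s - g s z / s ^ 2) s.
Proof.
intros Hg Hs.
assert (H := strip_ex1 g Hg s z ltac:(lra)).
assert (H' := strip_ex1 _ (strip_D1 _ Hg) s z ltac:(lra)).
auto_derive; repeat split; auto; nra.
Qed.

Lemma transversal_derivatives_scalar (f : R3 -> R) (r z : R) :
  smooth_up_to_boundary f ->
  (forall t, 0 < sqrt (r ^ 2 + t ^ 2) < 1 ->
    f (r, t, z) = slice f (sqrt (r ^ 2 + t ^ 2)) z) ->
  0 < r < 1 ->
  partial ax2 f (r, 0, z) = 0 /\
  partial ax2 (partial ax2 f) (r, 0, z) = D1 (slice f) r z / r.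
Proof.
intros Hf E Hr.
enough (H : partial ax2 f (r, 0, z) = - 0 /\
  partial ax2 (partial ax2 f) (r, 0, z) = D1 (slice f) r z / r)
  by now rewrite Ropp_0 in H.
apply (transversal_derivatives _ (fun s => slice f s z / r) (fun s => 0)
  (fun s => D1 (slice f) s z / r) (fun s => 0)); auto.
- intros s Hs.
  assert (H := strip_ex1 _ (smooth_slice f Hf) s z ltac:(lra)).
  unfold D1; auto_derive; [now repeat split | field; lra].
- intros; apply @is_derive_const.
- assert (H := strip_ex1 _ (strip_D1 _ (smooth_slice f Hf)) r z ltac:(lra)).
  auto_derive; now repeat split.
- apply @ex_derive_const.
- intros t Ht; rewrite E by exact Ht; field; lra.
Qed.

Lemma odd_strip_zero (g : R -> R -> R) (z : R) : strip_smooth g ->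
  (forall r, 0 < r < 1 -> g (- r) z = - g r z) -> g 0 z = 0.
Proof.
intros Hg odd.
assert (C := strip_cont g Hg 0 z ltac:(lra)); apply continuous2_iff in C.
apply Req_lt_aux; intros e; rewrite Rminus_0_r.
destruct (C e) as [d Hd].
assert (Hm : 0 < Rmin d 1) by (apply Rmin_pos; [apply cond_pos | lra]).
set (r := Rmin d 1 / 2).
assert (H1 := Rmin_l d 1); assert (H2 := Rmin_r d 1).
assert (Hz : Rabs (z - z) < d) by (rewrite Rminus_diag, Rabs_R0; apply cond_pos).
assert (P := Hd r z ltac:(rewrite Rminus_0_r, Rabs_pos_eq; unfold r; lra) Hz).
assert (M := Hd (- r) z ltac:(rewrite Rminus_0_r, Rabs_Ropp, Rabs_pos_eq; unfold r; lra) Hz).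
rewrite odd in M by (unfold r; lra).
unfold Rabs in *; repeat destruct Rcase_abs; lra.
Qed.

Lemma even_strip_zero (g : R -> R -> R) (z : R) : strip_smooth g ->
  (forall r, 0 < r < 1 -> g (- r) z = g r z) -> D1 g 0 z = 0.
Proof.
intros Hg even.
assert (E : D1 g 0 z = - D1 g 0 z).
{ unfold D1 at 1.
  rewrite (Derive_ext_loc _ (fun s => g (- s) z)).
  - apply is_derive_unique.
    eapply is_derive_eq.
    + apply (is_derive_comp (fun s => g s z) (fun s => - s)).
      * rewrite Ropp_0; apply strip_is_derive1; [exact Hg | lra].
      * apply (is_derive_opp (fun s : R => s)), @is_derive_id.
    + unfold scal, opp, one; simpl; unfold mult; simpl; ring.
  - apply strip_locally; [lra |]; intros s Hs.
    destruct (Rtotal_order s 0) as [lt | [-> | gt]].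
    + rewrite <- (even (- s)) by lra; now rewrite Ropp_involutive.
    + now rewrite Ropp_0.
    + rewrite even by lra; reflexivity. }
lra.
Qed.

Lemma wall_limit (f : R3 -> R) (z y : R) :
  filterlim f (within cylinder (locally (1, 0, z))) (locally y) ->
  filterlim (fun r => slice f r z) (at_left 1) (locally y).
Proof.
intros H; apply filterlim_locally; intros e.
destruct (limit_on_slice f 1 z y H e) as [d Hd].
assert (Hm : 0 < Rmin d 1) by (apply Rmin_pos; [apply cond_pos | lra]).
assert (H1 := Rmin_l d 1); assert (H2 := Rmin_r d 1).
exists (mkposreal _ Hm); intros r Hr lt; simpl in Hr.
change (Rabs (r - 1) < Rmin d 1) in Hr.
apply Hd; [apply Rabs_lt_between in Hr; lra | lra |].
rewrite Rminus_diag, Rabs_R0; apply cond_pos.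
Qed.

Lemma wall_proper (z : R) : ProperFilter (within cylinder (locally ((1, 0, z) : R3))).
Proof.
constructor; [| apply within_filter, locally_filter].
intros P [d Hd].
assert (Hm : 0 < Rmin d 1) by (apply Rmin_pos; [apply cond_pos | lra]).
assert (H1 := Rmin_l d 1); assert (H2 := Rmin_r d 1).
exists (1 - Rmin d 1 / 2, 0, z); apply Hd; [| apply cylinder_slice; lra].
split; [split |]; [| apply ball_center | apply ball_center].
change (Rabs (1 - Rmin d 1 / 2 - 1) < d).
rewrite Rabs_left; lra.
Qed.

Lemma on_wall (z : R) : cylinder_boundary (1, 0, z).
Proof. unfold cylinder_boundary; simpl; ring. Qed.

Lemma closed_on_wall (z : R) : closed_cylinder (1, 0, z).
Proof. apply closed_cylinder_slice; lra. Qed.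

Lemma partial_bar_limit (i : axis) (f : R3 -> R) (z : R) :
  smooth_up_to_boundary f ->
  filterlim (partial i f) (within cylinder (locally (1, 0, z)))
    (locally (partial_bar i f (1, 0, z))).
Proof.
intros [_ [Hl _]].
destruct (Hl (i :: nil) (1, 0, z) (closed_on_wall z)) as [y Hy]; simpl in Hy.
unfold partial_bar, extend.
assert (E := @iota_filterlim_locally _ R_CompleteNormedModule _
  (within cylinder (locally ((1, 0, z) : R3)))
  (Proper_StrongProper _ (wall_proper z)) (partial i f) y Hy).
exact (eq_ind_r (fun l : R => filterlim (partial i f)
  (within cylinder (locally ((1, 0, z) : R3))) (locally l)) Hy E).
Qed.

Section Reduction.
Variables (u : R3 -> R3) (p : R3 -> R).
Hypothesis u_smooth : forall i : axis, smooth_up_to_boundary (component i u).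
Hypothesis p_smooth : smooth_up_to_boundary p.
Hypothesis u_axisym : axially_symmetric u.
Hypothesis p_axisym : theta_independent p.
Hypothesis u_p_NS : stationary_navier_stokes u p.
Hypothesis u_slip : total_navier_slip u.

Let a := slice (component ax1 u).
Let b := slice (component ax2 u).
Let c := slice (component ax3 u).
Let q := slice p.

Lemma transversal_derivatives_u1 (r z : R) : 0 < r < 1 ->
  partial ax2 (component ax1 u) (r, 0, z) = - (b r z / r) /\
  partial ax2 (partial ax2 (component ax1 u)) (r, 0, z)
    = D1 a r z / r - a r z / r ^ 2.
Proof.
intros Hr.
apply (transversal_derivatives _ (fun s => a s z / s) (fun s => b s z / s)
  (fun s => D1 a s z / s - a s z / s ^ 2) (fun s => D1 b s z / s - b s z / s ^ 2));
  auto using is_derive_over_r, ex_derive_over_r, smooth_slice.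
- intros; apply is_derive_over_r; [now apply smooth_slice | exact H].
- intros; apply is_derive_over_r; [now apply smooth_slice | exact H].
- apply ex_derive_over_r; [now apply smooth_slice | exact Hr].
- apply ex_derive_over_r; [now apply smooth_slice | exact Hr].
- intros t Ht.
  destruct (axially_symmetric_components u r t z u_axisym) as [-> _]; [lra |].
  fold a b; field; lra.
Qed.

Lemma transversal_derivatives_u2 (r z : R) : 0 < r < 1 ->
  partial ax2 (component ax2 u) (r, 0, z) = a r z / r /\
  partial ax2 (partial ax2 (component ax2 u)) (r, 0, z)
    = D1 b r z / r - b r z / r ^ 2.
Proof.
intros Hr.
rewrite <- (Ropp_involutive (a r z / r)).
apply (transversal_derivatives _ (fun s => b s z / s) (fun s => - (a s z / s))
  (fun s => D1 b s z / s - b s z / s ^ 2)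
  (fun s => - (D1 a s z / s - a s z / s ^ 2))); auto.
- intros; apply is_derive_over_r; [now apply smooth_slice | exact H].
- intros; apply @is_derive_opp, is_derive_over_r; [now apply smooth_slice | exact H].
- apply ex_derive_over_r; [now apply smooth_slice | exact Hr].
- apply @ex_derive_opp, ex_derive_over_r; [now apply smooth_slice | exact Hr].
- intros t Ht.
  destruct (axially_symmetric_components u r t z u_axisym) as [_ [-> _]]; [lra |].
  fold a b; field; lra.
Qed.

(** The point (-r, 0, z) is (r, 0, z) rotated by the angle pi. *)
Lemma component_reflection (r z : R) : 0 < r < 1 ->
  a (- r) z = - a r z /\ b (- r) z = - b r z /\ c (- r) z = c r z.
Proof.
intros Hr.
assert (Es : sqrt ((- r) ^ 2 + 0 ^ 2) = r).
{ replace ((- r) ^ 2 + 0 ^ 2) with (r * r) by ring; apply sqrt_square; lra. }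
destruct (axially_symmetric_components u (- r) 0 z u_axisym) as [H1 [H2 H3]];
  rewrite Es in *; [lra |].
unfold a, b, c in *; unfold slice at 1 3 5; rewrite H1, H2, H3.
repeat split; field; lra.
Qed.

Lemma radial_component_wall (z : R) :
  filterlim (fun r => a r z) (at_left 1) (locally 0).
Proof.
assert (E : component ax1 u (1, 0, z) = 0).
{ destruct (u_slip _ (on_wall z)) as [_ H].
  unfold dot, sum3, normal in H; unfold component; simpl in *; lra. }
rewrite <- E; apply wall_limit.
apply (u_smooth ax1), closed_on_wall.
Qed.

(** The radial velocity vanishes on the whole wall, hence so does the limit of
    its axial derivative. *)
Lemma axial_derivative_wall (z : R) :
  partial_bar ax3 (component ax1 u) (1, 0, z) = 0.
Proof.
assert (H := partial_bar_limit ax3 _ z (u_smooth ax1)).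
set (y := partial_bar ax3 (component ax1 u) (1, 0, z)) in *.
apply NNPP; intros Ny.
assert (Hy : 0 < Rabs y / 2) by (apply Rabs_pos_lt in Ny; lra).
destruct (limit_on_slice _ _ _ _ H (mkposreal _ Hy)) as [d Hd]; simpl in Hd.
assert (Dpos := cond_pos d).
set (h := d / 2).
assert (Hh : 0 < Rabs y / 8 * h) by (unfold h; nra).
assert (L : forall z, at_left 1 (fun r => Rabs (a r z) < Rabs y / 8 * h)).
{ intros z'.
  assert (W := proj1 (filterlim_locally _ _) (radial_component_wall z')
    (mkposreal _ Hh)); revert W; apply filter_imp; intros r Hr.
  change (Rabs (a r z' - 0) < Rabs y / 8 * h) in Hr.
  now rewrite Rminus_0_r in Hr. }
assert (N : at_left 1 (fun r => 1 - Rmin d 1 < r /\ r < 1)).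
{ assert (Hm : 0 < Rmin d 1) by (apply Rmin_pos; lra).
  exists (mkposreal _ Hm); intros r Hr lt.
  change (Rabs (r - 1) < Rmin d 1) in Hr; apply Rabs_lt_between in Hr; lra. }
destruct (filter_ex _ (filter_and _ _ N (filter_and _ _ (L z) (L (z + h)))))
  as [r [[Hr1 Hr2] [Lz Lh]]].
assert (H1 := Rmin_l d 1); assert (H2 := Rmin_r d 1).
assert (K := is_derive_increment_le (fun t => a r t - y * t)
  (fun t => D2 a r t - y) z (z + h) (Rabs y / 2)).
assert (K' : Rabs (a r (z + h) - y * (z + h) - (a r z - y * z))
  <= Rabs y / 2 * (z + h - z)).
{ apply K; [unfold h; lra | |].
  - intros t Ht; apply @is_derive_minus.
    + apply strip_is_derive2; [now apply smooth_slice | lra].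
    + auto_derive; [exact I | ring].
  - intros t Ht; apply Rlt_le; unfold a; rewrite D2_slice; apply Hd; [lra | |].
    + rewrite Rabs_left; lra.
    + rewrite Rabs_pos_eq; unfold h in Ht; lra. }
replace (a r (z + h) - y * (z + h) - (a r z - y * z))
  with (a r (z + h) - a r z - y * h) in K' by ring.
replace (z + h - z) with h in K' by ring.
assert (T : Rabs (y * h) <= Rabs (a r (z + h)) + Rabs (a r z)
            + Rabs (a r (z + h) - a r z - y * h)).
{ unfold Rabs; repeat destruct Rcase_abs; lra. }
rewrite Rabs_mult, (Rabs_pos_eq h) in T by (unfold h; lra).
nra.
Qed.

(** At (1, 0, z) the axial part of the slip condition is the sum of this derivative
    and of the one in [axial_derivative_wall]. *)
Lemma shear_wall (z : R) : partial_bar ax1 (component ax3 u) (1, 0, z) = 0.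
Proof.
destruct (u_slip _ (on_wall z)) as [H _].
apply (f_equal snd) in H.
unfold tangential, strain_normal, strain, vec, normal, dot, sum3 in H.
unfold minus, scal, plus, opp in H; simpl in H.
unfold prod_plus, prod_opp, prod_scal, scal, plus, opp in H; simpl in H.
unfold mult in H; simpl in H.
rewrite axial_derivative_wall in H; lra.
Qed.

Lemma meridional_flow_of_solution : meridional_flow a b c q.
Proof.
assert (Sa : strip_smooth a) by now apply smooth_slice.
assert (Sb : strip_smooth b) by now apply smooth_slice.
assert (Sc : strip_smooth c) by now apply smooth_slice.
assert (Sq : strip_smooth q) by now apply smooth_slice.
assert (T1 := transversal_derivatives_u1).
assert (T2 := transversal_derivatives_u2).
assert (T3 : forall r z, 0 < r < 1 ->
  partial ax2 (component ax3 u) (r, 0, z) = 0 /\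
  partial ax2 (partial ax2 (component ax3 u)) (r, 0, z) = D1 c r z / r).
{ intros r z Hr; apply transversal_derivatives_scalar; auto.
  intros t Ht; apply (axially_symmetric_components u r t z u_axisym); lra. }
assert (Tp : forall r z, 0 < r < 1 -> partial ax2 p (r, 0, z) = 0).
{ intros r z Hr; apply transversal_derivatives_scalar; auto.
  intros t Ht; apply theta_independent_eq; auto; lra. }
assert (NS : forall r z, 0 < r < 1 -> cylinder (r, 0, z)).
{ intros; apply cylinder_slice; lra. }
split; auto.
- intros r z Hr; destruct (u_p_NS _ (NS r z Hr)) as [_ H].
  unfold divergence, sum3 in H; rewrite (proj1 (T2 r z Hr)) in H.
  unfold a, c; rewrite D1_slice, D2_slice; exact H.
- intros r z Hr; destruct (u_p_NS _ (NS r z Hr)) as [H _]; specialize (H ax1).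
  unfold laplacian, sum3 in H.
  rewrite (proj1 (T1 r z Hr)), (proj2 (T1 r z Hr)) in H.
  rewrite <- D11_slice, <- D22_slice, <- !D1_slice, <- !D2_slice in H.
  fold a q in H.
  change (component ax1 u (r, 0, z)) with (a r z) in H.
  change (component ax2 u (r, 0, z)) with (b r z) in H.
  change (component ax3 u (r, 0, z)) with (c r z) in H.
  unfold Rdiv in *; nra.
- intros r z Hr; destruct (u_p_NS _ (NS r z Hr)) as [H _]; specialize (H ax2).
  unfold laplacian, sum3 in H.
  rewrite (proj1 (T2 r z Hr)), (proj2 (T2 r z Hr)), (Tp r z Hr) in H.
  rewrite <- D11_slice, <- D22_slice, <- !D1_slice, <- !D2_slice in H.
  fold b in H.
  change (component ax1 u (r, 0, z)) with (a r z) in H.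
  change (component ax2 u (r, 0, z)) with (b r z) in H.
  change (component ax3 u (r, 0, z)) with (c r z) in H.
  unfold Rdiv in *; nra.
- intros r z Hr; destruct (u_p_NS _ (NS r z Hr)) as [H _]; specialize (H ax3).
  unfold laplacian, sum3 in H.
  rewrite (proj1 (T3 r z Hr)), (proj2 (T3 r z Hr)) in H.
  rewrite <- D11_slice, <- D22_slice, <- !D1_slice, <- !D2_slice in H.
  fold c q in H.
  change (component ax1 u (r, 0, z)) with (a r z) in H.
  change (component ax2 u (r, 0, z)) with (b r z) in H.
  change (component ax3 u (r, 0, z)) with (c r z) in H.
  unfold Rdiv in *; nra.
- intros z; apply odd_strip_zero; auto; intros; now apply component_reflection.
- intros z; apply odd_strip_zero; auto; intros; now apply component_reflection.
- intros z; apply even_strip_zero; auto; intros; now apply component_reflection.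
- exact radial_component_wall.
- intros z; rewrite <- (shear_wall z).
  apply (filterlim_ext (fun r => slice (partial ax1 (component ax3 u)) r z)).
  { intros; symmetry; apply D1_slice. }
  now apply wall_limit, partial_bar_limit.
- intros z; unfold vorticity.
  replace 0 with (plus (partial_bar ax3 (component ax1 u) (1, 0, z))
                    (opp (partial_bar ax1 (component ax3 u) (1, 0, z)))).
  2:{ rewrite shear_wall, axial_derivative_wall; unfold plus, opp; simpl; ring. }
  apply (filterlim_ext (fun r => plus (slice (partial ax3 (component ax1 u)) r z)
     (opp (slice (partial ax1 (component ax3 u)) r z)))).
  { intros r; unfold a, c; now rewrite D1_slice, D2_slice. }
  eapply filterlim_comp_2; [| | apply @filterlim_plus].
  + now apply wall_limit, partial_bar_limit.
  + eapply filterlim_comp; [| apply @filterlim_opp].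
    now apply wall_limit, partial_bar_limit.
Qed.

End Reduction.

(** * Flows with constant axial velocity *)

Lemma locally_open_unit (P : R -> Prop) (r : R) : 0 < r < 1 ->
  (forall s, 0 < s < 1 -> P s) -> locally r P.
Proof.
intros Hr HP.
apply filter_imp with (fun s => 0 < s /\ s < 1); [intros s [? ?]; apply HP; lra |].
apply filter_and; [apply (open_gt 0) | apply (open_lt 1)]; tauto.
Qed.

Lemma D1_ext_half (f g : R -> R -> R) :
  (forall r z, 0 < r < 1 -> f r z = g r z) ->
  forall r z, 0 < r < 1 -> D1 f r z = D1 g r z.
Proof. intros E r z Hr; apply Derive_ext_loc, locally_open_unit; auto. Qed.

Lemma D2_ext_half (f g : R -> R -> R) :
  (forall r z, 0 < r < 1 -> f r z = g r z) ->
  forall r z, 0 < r < 1 -> D2 f r z = D2 g r z.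
Proof. intros E r z Hr; apply Derive_ext; auto. Qed.

Lemma D1_zero (f : R -> R -> R) :
  (forall r z, 0 < r < 1 -> f r z = 0) ->
  forall r z, 0 < r < 1 -> D1 f r z = 0.
Proof.
intros E r z Hr; rewrite (D1_ext_half f (fun _ _ => 0) E r z Hr); exact (Derive_const _ _).
Qed.

Lemma D2_z_independent (f : R -> R -> R) :
  (forall r z z', 0 < r < 1 -> f r z = f r z') ->
  forall r z, 0 < r < 1 -> D2 f r z = 0.
Proof.
intros E r z Hr; unfold D2; rewrite (Derive_ext _ (fun _ => f r 0)).
- apply Derive_const.
- intros t; now apply E.
Qed.

Lemma D1_z_independent (f : R -> R -> R) :
  (forall r z z', 0 < r < 1 -> f r z = f r z') ->
  forall r z z', 0 < r < 1 -> D1 f r z = D1 f r z'.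
Proof.
intros E r z z' Hr; unfold D1; apply Derive_ext_loc, locally_open_unit; auto.
Qed.

Lemma constant_of_D1_zero (g : R -> R -> R) (z : R) : strip_smooth g ->
  (forall r, 0 < r < 1 -> D1 g r z = 0) ->
  forall r s, 0 < r < 1 -> 0 < s < 1 -> g r z = g s z.
Proof.
intros Hg H.
assert (K : forall r s, 0 < r < 1 -> 0 < s < 1 -> r <= s -> g r z = g s z).
{ intros r s Hr Hs rs; apply (is_derive_zero_eq (fun t => g t z)); [exact rs |].
  intros t Ht; rewrite <- (H t) by lra; apply strip_is_derive1; [exact Hg | lra]. }
intros r s Hr Hs; destruct (Rle_dec r s); [now apply K |].
symmetry; apply K; lra.
Qed.

Lemma constant_of_D2_zero (g : R -> R -> R) (r : R) : strip_smooth g -> 0 < r < 1 ->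
  (forall z, D2 g r z = 0) -> forall z z', g r z = g r z'.
Proof.
intros Hg Hr H.
assert (K : forall z z', z <= z' -> g r z = g r z').
{ intros z z' zz; apply (is_derive_zero_eq (fun t => g r t)); [exact zz |].
  intros t Ht; rewrite <- (H t); apply strip_is_derive2; [exact Hg | lra]. }
intros z z'; destruct (Rle_dec z z'); [now apply K |].
symmetry; apply K; lra.
Qed.

(** The angular equation becomes r^2 b'' + r b' - b = 0, whose solutions are
    spanned by r and 1 / r; the value at the axis excludes the second one. *)
Lemma parallel_flow (a b c q : R -> R -> R) (C2 : R) :
  meridional_flow a b c q ->
  (forall r z, 0 < r < 1 -> a r z = 0) ->
  (forall r z z', 0 < r < 1 -> b r z = b r z') ->
  (forall r z, 0 < r < 1 -> c r z = C2) ->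
  exists C1 k, forall r z, 0 < r < 1 ->
    b r z = C1 * r /\ q r z = C1 ^ 2 * r ^ 2 / 2 + k.
Proof.
intros F a0 bz cC.
assert (Sb := smooth_b _ _ _ _ F); assert (Sq := smooth_q _ _ _ _ F).
assert (SDb := strip_D1 _ Sb).
assert (b2 := D2_z_independent b bz).
assert (b22 : forall r z, 0 < r < 1 -> D2 (D2 b) r z = 0).
{ apply D2_z_independent; intros r z z' Hr; now rewrite !b2. }
(* the angular equation says that (r (r b' - b))' = 0 *)
assert (N : forall r z, 0 < r < 1 -> r * D1 b r z - b r z = 0).
{ intros r z Hr.
  assert (E : 0 * (0 * D1 b 0 z - b 0 z) = r * (r * D1 b r z - b r z)).
  { apply (is_derive_zero_eq (fun s => s * (s * D1 b s z - b s z))); [lra |].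
    intros s Hs.
    assert (H1 := strip_ex1 _ Sb s z ltac:(lra)).
    assert (H2 := strip_ex1 _ SDb s z ltac:(lra)).
    auto_derive; [now repeat split |].
    change (Derive (fun x => b x z) s) with (D1 b s z).
    change (Derive (fun x => D1 b x z) s) with (D1 (D1 b) s z).
    destruct (Req_dec s 0) as [-> | Ns].
    - rewrite (axis_b _ _ _ _ F); ring.
    - assert (Hs' : 0 < s < 1) by lra.
      assert (A := angular_eq _ _ _ _ F s z Hs').
      rewrite a0, b2, b22 in A by exact Hs'.
      replace (D1 (D1 b) s z) with (b s z / s ^ 2 - D1 b s z / s) by lra.
      field; exact Ns. }
  apply Rmult_eq_reg_l with r; lra. }
assert (bl : forall r z, 0 < r < 1 -> b r z = 2 * b (1 / 2) 0 * r).
{ intros r z Hr; rewrite (bz r z 0 Hr).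
  assert (L : forall x y, 0 < x < 1 -> 0 < y < 1 -> x <= y ->
    b x 0 / x = b y 0 / y).
  { intros x y Hx Hy xy.
    apply (is_derive_zero_eq (fun s => b s 0 / s)); [exact xy |].
    intros s Hs.
    eapply is_derive_eq; [apply is_derive_over_r; [exact Sb | lra] |].
    replace (b s 0) with (s * D1 b s 0) by (specialize (N s 0 ltac:(lra)); lra).
    field; lra. }
  assert (E : b r 0 / r = b (1 / 2) 0 / (1 / 2)).
  { destruct (Rle_dec r (1 / 2)); [apply L; lra | symmetry; apply L; lra]. }
  replace (b r 0) with (b r 0 / r * r) by (field; lra); rewrite E; field. }
set (C1 := 2 * b (1 / 2) 0) in *.
exists C1, (q (1 / 2) 0 - C1 ^ 2 * (1 / 2) ^ 2 / 2).
assert (a1 := D1_zero a a0).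
assert (a11 := D1_zero (D1 a) a1).
assert (az : forall r z z', 0 < r < 1 -> a r z = a r z')
  by (intros; now rewrite !a0).
assert (a2 := D2_z_independent a az).
assert (a22 : forall r z, 0 < r < 1 -> D2 (D2 a) r z = 0).
{ apply D2_z_independent; intros; now rewrite !a2. }
assert (c1 : forall r z, 0 < r < 1 -> D1 c r z = 0).
{ intros r z Hr; rewrite (D1_ext_half c (fun _ _ => C2) cC r z Hr).
  exact (Derive_const _ _). }
assert (c11 := D1_zero (D1 c) c1).
assert (c2 : forall r z, 0 < r < 1 -> D2 c r z = 0).
{ apply D2_z_independent; intros; now rewrite !cC. }
assert (c22 : forall r z, 0 < r < 1 -> D2 (D2 c) r z = 0).
{ apply D2_z_independent; intros; now rewrite !c2. }
assert (q2 : forall r z, 0 < r < 1 -> D2 q r z = 0).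
{ intros r z Hr; assert (A := axial_eq _ _ _ _ F r z Hr).
  rewrite a0, c1, c11, c2, c22 in A by exact Hr; lra. }
assert (q1 : forall r z, 0 < r < 1 -> D1 q r z = C1 ^ 2 * r).
{ intros r z Hr; assert (A := radial_eq _ _ _ _ F r z Hr).
  rewrite a0, a1, a11, a2, a22, bl in A by exact Hr.
  replace ((C1 * r) ^ 2 / r) with (C1 ^ 2 * r) in A by (field; lra); lra. }
intros r z Hr; split; [now apply bl |].
rewrite (constant_of_D2_zero q r Sq Hr (fun z => q2 r z Hr) z 0).
assert (L : forall x y, 0 < x < 1 -> 0 < y < 1 -> x <= y ->
    q x 0 - C1 ^ 2 * x ^ 2 / 2 = q y 0 - C1 ^ 2 * y ^ 2 / 2).
{ intros x y Hx Hy xy.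
  apply (is_derive_zero_eq (fun s => q s 0 - C1 ^ 2 * s ^ 2 / 2)); [exact xy |].
  intros s Hs.
  eapply is_derive_eq.
  - apply @is_derive_minus; [apply strip_is_derive1; [exact Sq | lra] |].
    auto_derive; [exact I | reflexivity].
  - rewrite q1 by lra; unfold minus, plus, opp; simpl; field. }
assert (E : q r 0 - C1 ^ 2 * r ^ 2 / 2
            = q (1 / 2) 0 - C1 ^ 2 * (1 / 2) ^ 2 / 2).
{ destruct (Rle_dec r (1 / 2)); [apply L; lra | symmetry; apply L; lra]. }
lra.
Qed.

(** * Axial velocity independent of z *)

(** The decisive step is that b^2, by the equality of the mixed derivatives of
    the pressure, is affine in z on a whole line. *)
Lemma parallel_of_axial_z_independent (a b c q : R -> R -> R) :
  meridional_flow a b c q ->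
  (forall r z z', 0 < r < 1 -> c r z = c r z') ->
  (forall r z, 0 < r < 1 -> a r z = 0) /\
  (forall r z z', 0 < r < 1 -> b r z = b r z') /\
  (forall r z, 0 < r < 1 -> c r z = c (1 / 2) 0).
Proof.
intros F cz.
assert (Sa := smooth_a _ _ _ _ F); assert (Sb := smooth_b _ _ _ _ F).
assert (Sc := smooth_c _ _ _ _ F); assert (Sq := smooth_q _ _ _ _ F).
assert (c2 := D2_z_independent c cz).
assert (c22 : forall r z, 0 < r < 1 -> D2 (D2 c) r z = 0).
{ apply D2_z_independent; intros; now rewrite !c2. }
assert (a0 : forall r z, 0 < r < 1 -> a r z = 0).
{ intros r z Hr.
  assert (E : 0 * a 0 z = r * a r z).
  { apply (is_derive_zero_eq (fun s => s * a s z)); [lra |].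
    intros s Hs.
    assert (H1 := strip_ex1 _ Sa s z ltac:(lra)).
    auto_derive; [exact H1 |].
    change (Derive (fun x => a x z) s) with (D1 a s z).
    destruct (Req_dec s 0) as [-> | Ns].
    - rewrite (axis_a _ _ _ _ F); ring.
    - assert (A := continuity_eq _ _ _ _ F s z ltac:(lra)).
      rewrite c2 in A by lra.
      replace (D1 a s z) with (- (a s z / s)) by lra; field; exact Ns. }
  apply Rmult_eq_reg_l with r; lra. }
assert (a1 := D1_zero a a0).
assert (a11 := D1_zero (D1 a) a1).
assert (az : forall r z z', 0 < r < 1 -> a r z = a r z')
  by (intros; now rewrite !a0).
assert (a2 := D2_z_independent a az).
assert (a22 : forall r z, 0 < r < 1 -> D2 (D2 a) r z = 0).
{ apply D2_z_independent; intros; now rewrite !a2. }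
assert (c1z := D1_z_independent c cz).
assert (c11z := D1_z_independent (D1 c) c1z).
assert (q1 : forall r z, 0 < r < 1 -> D1 q r z = b r z ^ 2 / r).
{ intros r z Hr; assert (A := radial_eq _ _ _ _ F r z Hr).
  rewrite a0, a1, a11, a2, a22 in A by exact Hr; lra. }
assert (q2 : forall r z, 0 < r < 1 -> D2 q r z = D1 (D1 c) r z + D1 c r z / r).
{ intros r z Hr; assert (A := axial_eq _ _ _ _ F r z Hr).
  rewrite a0, c2, c22 in A by exact Hr; lra. }
assert (q2z : forall r z z', 0 < r < 1 -> D2 q r z = D2 q r z').
{ intros r z z' Hr; rewrite !q2 by exact Hr.
  now rewrite (c1z r z z' Hr), (c11z r z z' Hr). }
assert (q12z := D1_z_independent (D2 q) q2z).
assert (bsq : forall r z, 0 < r < 1 ->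
  is_derive (fun t => b r t ^ 2) z (r * D1 (D2 q) r 0)).
{ intros r z Hr.
  rewrite (q12z r 0 z Hr), (D_commute q r z Sq) by lra.
  apply (is_derive_ext (fun t => r * D1 q r t)).
  - intros t; rewrite q1 by exact Hr; match goal with |- ?x = ?y => change (@eq R x y) end; field; lra.
  - apply (is_derive_scal (fun t => D1 q r t)).
    apply strip_is_derive2; [now apply strip_D1 | lra]. }
(* a square is nonnegative on the whole line, so it cannot have a nonzero
   constant slope *)
assert (q12 : forall r z, 0 < r < 1 -> D1 (D2 q) r z = 0).
{ intros r z Hr; rewrite (q12z r z 0 Hr).
  set (m := D1 (D2 q) r 0) in *.
  assert (lin : forall t, b r t ^ 2 = b r 0 ^ 2 + r * m * t).
  { intros t.
    assert (G : forall x y, x <= y -> b r x ^ 2 - r * m * x = b r y ^ 2 - r * m * y).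
    { intros x y xy.
      apply (is_derive_zero_eq (fun t => b r t ^ 2 - r * m * t)); [exact xy |].
      intros s _; eapply is_derive_eq.
      - apply @is_derive_minus; [now apply bsq |].
        auto_derive; [exact I | reflexivity].
      - unfold m, minus, plus, opp; simpl; ring. }
    destruct (Rle_dec 0 t) as [H | H]; [assert (E := G 0 t H) |
      assert (E := G t 0 ltac:(lra))]; lra. }
  apply NNPP; intros Nm.
  assert (Nrm : r * m <> 0) by (apply Rmult_integral_contrapositive; split; [lra | exact Nm]).
  assert (L := lin (- (b r 0 ^ 2 + 1) / (r * m))).
  replace (r * m * (- (b r 0 ^ 2 + 1) / (r * m))) with (- (b r 0 ^ 2 + 1)) in L
    by (field; split; [exact Nm | lra]).
  assert (P := pow2_ge_0 (b r (- (b r 0 ^ 2 + 1) / (r * m)))); lra. }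
assert (bsq0 : forall r z, 0 < r < 1 -> b r z ^ 2 = b r 0 ^ 2).
{ intros r z Hr.
  assert (G : forall x y, x <= y -> b r x ^ 2 = b r y ^ 2).
  { intros x y xy; apply (is_derive_zero_eq (fun t => b r t ^ 2)); [exact xy |].
    intros t _; eapply is_derive_eq; [now apply bsq |].
    rewrite q12 by exact Hr; ring. }
  destruct (Rle_dec z 0) as [H | H]; [now apply G | symmetry; apply G; lra]. }
assert (bz : forall r z z', 0 < r < 1 -> b r z = b r z').
{ intros r z z' Hr; apply constant_of_D2_zero; [exact Sb | exact Hr |]; clear z z'.
  assert (E : forall z, b r z * D2 b r z = 0).
  { intros z.
    assert (D : is_derive (fun t => b r t ^ 2) z (2 * (b r z * D2 b r z))).
    { assert (H := strip_ex2 _ Sb r z ltac:(lra)).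
      auto_derive; [exact H |].
      change (Derive (fun x => b r x) z) with (D2 b r z); ring. }
    apply is_derive_unique in D; rewrite (is_derive_unique _ _ _ (bsq r z Hr)) in D.
    rewrite q12 in D by exact Hr; lra. }
  intros z; destruct (Req_dec (b r 0) 0) as [Z | NZ].
  - assert (B : forall t, b r t = 0).
    { intros t; specialize (bsq0 r t Hr); rewrite Z in bsq0; nra. }
    unfold D2; rewrite (Derive_ext _ (fun _ => 0)); [apply Derive_const | exact B].
  - destruct (Rmult_integral _ _ (E z)) as [B | B]; [| exact B].
    specialize (bsq0 r z Hr); rewrite B in bsq0; nra. }
repeat split; [exact a0 | exact bz |].
set (k := D2 q (1 / 2) 0).
assert (qk : forall r z, 0 < r < 1 -> D2 q r z = k).
{ intros r z Hr; rewrite (q2z r z 0 Hr).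
  apply (constant_of_D1_zero (D2 q) 0 (strip_D2 _ Sq)); [auto | exact Hr | lra]. }
assert (c1k : forall r z, 0 < r < 1 -> D1 c r z = k * r / 2).
{ intros r z Hr.
  assert (E : 0 * D1 c 0 z - k * 0 ^ 2 / 2 = r * D1 c r z - k * r ^ 2 / 2).
  { apply (is_derive_zero_eq (fun s => s * D1 c s z - k * s ^ 2 / 2)); [lra |].
    intros s Hs.
    assert (H1 := strip_ex1 _ (strip_D1 _ Sc) s z ltac:(lra)).
    auto_derive; [exact H1 |].
    change (Derive (fun x => D1 c x z) s) with (D1 (D1 c) s z).
    destruct (Req_dec s 0) as [-> | Ns].
    - rewrite (axis_c _ _ _ _ F); field.
    - rewrite <- (qk s z), q2 by lra; field; exact Ns. }
  apply Rmult_eq_reg_l with r; lra. }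
assert (k0 : k = 0).
{ assert (W := wall_c _ _ _ _ F 0).
  assert (W' : filterlim (fun r => D1 c r 0) (at_left 1) (locally (k * 1 / 2))).
  { apply filterlim_ext_loc with (fun r => k * r / 2).
    - exists (mkposreal 1 Rlt_0_1); intros r Hr lt.
      change (Rabs (r - 1) < 1) in Hr; apply Rabs_lt_between in Hr.
      symmetry; apply c1k; lra.
    - eapply filterlim_filter_le_1; [apply filter_le_within |].
      apply (@ex_derive_continuous _ _ (fun r : R => k * r / 2) 1); auto_derive; exact I. }
  assert (E := filterlim_locally_unique _ _ _ W W'); lra. }
intros r z Hr; rewrite (cz r z 0 Hr).
apply (constant_of_D1_zero c 0 Sc); [| exact Hr | lra].
intros s Hs; rewrite c1k, k0 by exact Hs; field.
Qed.

(** * Linear decay at the wall and at the axis *)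

Lemma wall_linear_bound (g : R -> R -> R) (Z : R) : strip_smooth g ->
  (forall z, filterlim (fun r => g r z) (at_left 1) (locally 0)) ->
  exists B, forall r z, 0 < r < 1 -> Rabs z <= Z -> Rabs (g r z) <= B * (1 - r).
Proof.
intros Hg W.
destruct (strip_bounded _ (strip_D1 _ Hg) Z) as [B HB].
exists B; intros r z Hr Hz; apply le_epsilon; intros e He.
assert (L := proj1 (filterlim_locally _ _) (W z) (mkposreal e He)).
assert (N : at_left 1 (fun s => r < s /\ s < 1)).
{ assert (Hm : 0 < 1 - r) by lra.
  exists (mkposreal _ Hm); intros s Hs lt.
  change (Rabs (s - 1) < 1 - r) in Hs; apply Rabs_lt_between in Hs; lra. }
destruct (filter_ex _ (filter_and _ _ L N)) as [s [Hs [rs s1]]].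
change (Rabs (g s z - 0) < e) in Hs; rewrite Rminus_0_r in Hs.
assert (I := is_derive_increment_le (fun t => g t z) (fun t => D1 g t z) r s B).
assert (I' : Rabs (g s z - g r z) <= B * (s - r)).
{ apply I; [lra | |].
  - intros t Ht; apply strip_is_derive1; [exact Hg | lra].
  - intros t Ht; apply HB; [lra | exact Hz]. }
assert (B0 : 0 <= B).
{ apply Rle_trans with (1 := Rabs_pos (D1 g r z)); apply HB; [lra | exact Hz]. }
assert (B * (s - r) <= B * (1 - r)) by (apply Rmult_le_compat_l; lra).
unfold Rabs in *; repeat destruct Rcase_abs; lra.
Qed.

Lemma axis_linear_bound (g : R -> R -> R) (Z : R) : strip_smooth g ->
  (forall z, g 0 z = 0) ->
  exists B, forall r z, 0 < r < 1 -> Rabs z <= Z -> Rabs (g r z) <= B * r.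
Proof.
intros Hg A.
destruct (strip_bounded _ (strip_D1 _ Hg) Z) as [B HB].
exists B; intros r z Hr Hz.
replace (g r z) with (g r z - g 0 z) by (rewrite A; ring).
replace (B * r) with (B * (r - 0)) by ring.
apply (is_derive_increment_le (fun t => g t z) (fun t => D1 g t z)); [lra | |].
- intros t Ht; apply strip_is_derive1; [exact Hg | lra].
- intros t Ht; apply HB; [lra | exact Hz].
Qed.

(** * The Bessel function *)

Definition bessel_coeff (n : nat) : R :=
  (-1) ^ n / (INR (fact n) * INR (fact (n + 1))).

(** J_1(s) = (s / 2) * bessel_series ((s / 2) ^ 2). *)
Definition bessel_series : R -> R := PSeries bessel_coeff.
Definition bessel_series' : R -> R := PSeries (PS_derive bessel_coeff).
Definition bessel_series'' : R -> R := PSeries (PS_derive (PS_derive bessel_coeff)).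

Lemma bessel_coeff_S (n : nat) :
  bessel_coeff (S n) = - bessel_coeff n / (INR (n + 1) * INR (n + 2)).
Proof.
unfold bessel_coeff.
replace (S n + 1)%nat with (S (n + 1)) by lia.
rewrite (fact_simpl n), (fact_simpl (n + 1)), !mult_INR.
replace (S (n + 1)) with (n + 2)%nat by lia.
replace (S n) with (n + 1)%nat at 2 by lia.
assert (H := INR_fact_neq_0 n); assert (H' := INR_fact_neq_0 (n + 1)).
assert (H1 : INR (n + 1) <> 0) by (apply not_0_INR; lia).
assert (H2 : INR (n + 2) <> 0) by (apply not_0_INR; lia).
simpl pow; field; auto.
Qed.

Lemma bessel_coeff_neq_0 (n : nat) : bessel_coeff n <> 0.
Proof.
unfold bessel_coeff, Rdiv; apply Rmult_integral_contrapositive; split.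
- apply pow_nonzero; lra.
- apply Rinv_neq_0_compat, Rmult_integral_contrapositive; split;
    apply INR_fact_neq_0.
Qed.

Lemma bessel_radius : CV_radius bessel_coeff = p_infty.
Proof.
apply CV_radius_infinite_DAlembert; [exact bessel_coeff_neq_0 |].
apply is_lim_seq_le_le with (fun _ => 0) (fun n => / INR (n + 1)).
- intros n; split; [apply Rabs_pos |].
  rewrite bessel_coeff_S.
  assert (H := bessel_coeff_neq_0 n).
  assert (H1 : 1 <= INR (n + 1)) by (rewrite plus_INR; assert (P := pos_INR n); simpl; lra).
  assert (H2 : 1 <= INR (n + 2)) by (rewrite plus_INR; assert (P := pos_INR n); simpl; lra).
  replace (- bessel_coeff n / (INR (n + 1) * INR (n + 2)) / bessel_coeff n)
    with (- (/ INR (n + 1) * / INR (n + 2))) by (field; repeat split; lra).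
  rewrite Rabs_Ropp, Rabs_pos_eq.
  + rewrite <- (Rmult_1_r (/ INR (n + 1))) at 2.
    apply Rmult_le_compat_l; [apply Rlt_le, Rinv_0_lt_compat; lra |].
    rewrite <- Rinv_1; apply Rinv_le_contravar; lra.
  + apply Rmult_le_pos; apply Rlt_le, Rinv_0_lt_compat; lra.
- apply is_lim_seq_const.
- apply (is_lim_seq_incr_n (fun n => / INR n) 1).
  replace (Finite 0) with (Rbar_inv p_infty) by reflexivity.
  apply is_lim_seq_inv; [apply is_lim_seq_INR | discriminate].
Qed.

Lemma bessel_series_derive (y : R) : is_derive bessel_series y (bessel_series' y).
Proof. apply is_derive_PSeries; rewrite bessel_radius; exact I. Qed.

Lemma bessel_series'_derive (y : R) : is_derive bessel_series' y (bessel_series'' y).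
Proof.
apply is_derive_PSeries; rewrite CV_radius_derive, bessel_radius; exact I.
Qed.

(** Bessel's equation for (s / 2) * g ((s / 2) ^ 2) in the variable
    y = (s / 2) ^ 2; on coefficients it is the recursion [bessel_coeff_S]. *)
Lemma bessel_series_ode (y : R) :
  y * bessel_series'' y + 2 * bessel_series' y + bessel_series y = 0.
Proof.
set (a := bessel_coeff).
assert (rad : forall x, Rbar_lt (Rabs x) (CV_radius a))
  by (intros; unfold a; rewrite bessel_radius; exact I).
assert (ex0 : ex_pseries a y) by (apply CV_radius_inside, rad).
assert (ex1 : ex_pseries (PS_derive a) y) by (apply ex_pseries_derive, rad).
assert (ex2 : ex_pseries (PS_derive (PS_derive a)) y).
{ apply ex_pseries_derive; rewrite CV_radius_derive; apply rad. }
unfold bessel_series'', bessel_series', bessel_series; fold a.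
rewrite <- PSeries_incr_1, <- PSeries_scal, <- !PSeries_plus.
- rewrite (PSeries_ext _ (fun _ => 0)); [apply PSeries_const_0 |].
  intros n; unfold PS_plus, PS_scal, PS_incr_1, PS_derive, plus, scal, mult, zero.
  destruct n as [| n]; cbn -[INR bessel_coeff]; unfold mult, a;
    cbn -[INR bessel_coeff]; rewrite ?bessel_coeff_S.
  + simpl; field.
  + assert (P := pos_INR n).
    repeat rewrite ?plus_INR, ?S_INR; simpl INR; field; repeat split; lra.
- apply @ex_pseries_plus; [apply @ex_pseries_incr_1, ex2 |].
  apply @ex_pseries_scal; [apply Rmult_comm | exact ex1].
- exact ex0.
- apply @ex_pseries_incr_1, ex2.
- apply @ex_pseries_scal; [apply Rmult_comm | exact ex1].
Qed.

Lemma BesselJ1_eq (s : R) : BesselJ1 s = s / 2 * bessel_series ((s / 2) ^ 2).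
Proof.
unfold BesselJ1, bessel_series, PSeries.
rewrite <- Series_scal_l; apply Series_ext; intros n.
rewrite <- pow_mult, pow_add; unfold bessel_coeff; simpl; ring.
Qed.

Lemma bessel_series_0 : bessel_series 0 = 1.
Proof.
unfold bessel_series; rewrite PSeries_0; unfold bessel_coeff; simpl; field.
Qed.

Lemma bessel_series_continuity (y : R) : continuity_pt bessel_series y.
Proof.
apply continuity_pt_filterlim, @ex_derive_continuous.
exists (bessel_series' y); apply bessel_series_derive.
Qed.

(** The series is 1 at 0, and a zero below (alpha / 2) ^ 2 would be a positive
    root of J_1 below [alpha]. *)
Lemma bessel_series_pos (alpha y : R) : smallest_positive_root BesselJ1 alpha ->
  0 <= y < (alpha / 2) ^ 2 -> 0 < bessel_series y.
Proof.
intros [apos [_ amin]] Hy.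
destruct (Rlt_le_dec 0 (bessel_series y)) as [H | H]; [exact H | exfalso].
assert (y0 : y <> 0) by (intros ->; rewrite bessel_series_0 in H; lra).
destruct (IVT_gen bessel_series 0 y 0) as [x [Hx Ex]].
- intros t; apply bessel_series_continuity.
- rewrite bessel_series_0, Rmin_right, Rmax_left by lra; lra.
- rewrite Rmin_left, Rmax_right in Hx by lra.
  assert (x0 : x <> 0) by (intros ->; rewrite bessel_series_0 in Ex; lra).
  assert (sx : 0 < sqrt x) by (apply sqrt_lt_R0; lra).
  assert (le : alpha <= 2 * sqrt x).
  { apply amin; [lra |]; rewrite BesselJ1_eq.
    replace ((2 * sqrt x / 2) ^ 2) with (sqrt x * sqrt x) by field.
    rewrite sqrt_sqrt, Ex by lra; ring. }
  assert (sqrt x * sqrt x = x) by (apply sqrt_sqrt; lra); nra.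
Qed.

Lemma bessel_series_lower_bound (alpha gamma : R) :
  smallest_positive_root BesselJ1 alpha -> 0 < gamma < alpha ->
  exists m, 0 < m /\ forall r, 0 <= r <= 1 -> m <= bessel_series ((gamma * r / 2) ^ 2).
Proof.
intros Ha Hg.
destruct (continuity_ab_min bessel_series 0 ((gamma / 2) ^ 2)) as [x [Hx Rx]].
- nra.
- intros; apply bessel_series_continuity.
- exists (bessel_series x); split.
  + assert ((gamma / 2) ^ 2 < (alpha / 2) ^ 2) by nra.
    apply (bessel_series_pos alpha); [exact Ha | lra].
  + intros r Hr; apply Hx; split; [nra |].
    replace ((gamma * r / 2) ^ 2) with ((gamma / 2) ^ 2 * r ^ 2) by field.
    assert (0 <= (gamma / 2) ^ 2) by apply pow2_ge_0.
    assert (r ^ 2 <= 1) by nra; nra.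
Qed.

(** * The comparison function *)

(** This is 4 / gamma * J_1 (gamma * r) * cosh (gamma * z), a solution of the
    equation of the radial velocity when the vorticity vanishes. *)
Definition barrier (gamma r z : R) : R :=
  r * bessel_series ((gamma * r / 2) ^ 2) * (exp (gamma * z) + exp (- (gamma * z))).

Definition barrier1 (gamma r z : R) : R :=
  (bessel_series ((gamma * r / 2) ^ 2)
   + 2 * (gamma * r / 2) ^ 2 * bessel_series' ((gamma * r / 2) ^ 2))
  * (exp (gamma * z) + exp (- (gamma * z))).

Definition barrier11 (gamma r z : R) : R :=
  gamma ^ 2 * r / 2 * (3 * bessel_series' ((gamma * r / 2) ^ 2)
   + 2 * (gamma * r / 2) ^ 2 * bessel_series'' ((gamma * r / 2) ^ 2))
  * (exp (gamma * z) + exp (- (gamma * z))).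

Definition barrier2 (gamma r z : R) : R :=
  r * bessel_series ((gamma * r / 2) ^ 2)
  * (gamma * (exp (gamma * z) - exp (- (gamma * z)))).

Lemma barrier_derive1 (gamma r z : R) :
  is_derive (fun s => barrier gamma s z) r (barrier1 gamma r z).
Proof.
assert (H : ex_derive bessel_series ((gamma * r / 2) ^ 2))
  by (eexists; apply bessel_series_derive).
assert (E : Derive (fun y => bessel_series y) ((gamma * r / 2) ^ 2)
  = bessel_series' ((gamma * r / 2) ^ 2))
  by apply is_derive_unique, bessel_series_derive.
unfold barrier, barrier1; auto_derive.
- replace (gamma * r * / 2 * (gamma * r * / 2 * 1)) with ((gamma * r / 2) ^ 2) by field.
  exact H.
- replace (gamma * r * / 2 * (gamma * r * / 2 * 1)) with ((gamma * r / 2) ^ 2) by field.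
  rewrite E; field.
Qed.

Lemma barrier_derive11 (gamma r z : R) :
  is_derive (fun s => barrier1 gamma s z) r (barrier11 gamma r z).
Proof.
assert (H : ex_derive bessel_series ((gamma * r / 2) ^ 2))
  by (eexists; apply bessel_series_derive).
assert (H' : ex_derive bessel_series' ((gamma * r / 2) ^ 2))
  by (eexists; apply bessel_series'_derive).
assert (E : Derive (fun y => bessel_series y) ((gamma * r / 2) ^ 2)
  = bessel_series' ((gamma * r / 2) ^ 2))
  by apply is_derive_unique, bessel_series_derive.
assert (E' : Derive (fun y => bessel_series' y) ((gamma * r / 2) ^ 2)
  = bessel_series'' ((gamma * r / 2) ^ 2))
  by apply is_derive_unique, bessel_series'_derive.
unfold barrier1, barrier11; auto_derive.
- replace (gamma * r * / 2 * (gamma * r * / 2 * 1)) with ((gamma * r / 2) ^ 2) by field.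
  repeat split; auto.
- replace (gamma * r * / 2 * (gamma * r * / 2 * 1)) with ((gamma * r / 2) ^ 2) by field.
  rewrite E, E'; field.
Qed.

Lemma barrier_derive2 (gamma r z : R) :
  is_derive (fun s => barrier gamma r s) z (barrier2 gamma r z).
Proof.
unfold barrier, barrier2.
generalize (r * bessel_series ((gamma * r / 2) ^ 2)); intros k.
auto_derive; [exact I | ring].
Qed.

Lemma barrier_derive22 (gamma r z : R) :
  is_derive (fun s => barrier2 gamma r s) z (gamma ^ 2 * barrier gamma r z).
Proof.
unfold barrier, barrier2.
generalize (r * bessel_series ((gamma * r / 2) ^ 2)); intros k.
auto_derive; [exact I | ring].
Qed.

Lemma barrier_equation (gamma r z : R) : r <> 0 ->
  barrier11 gamma r z + barrier1 gamma r z / r - barrier gamma r z / r ^ 2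
  + gamma ^ 2 * barrier gamma r z = 0.
Proof.
intros Nr; unfold barrier, barrier1, barrier11.
assert (O := bessel_series_ode ((gamma * r / 2) ^ 2)).
set (y := (gamma * r / 2) ^ 2) in *.
replace (bessel_series y) with
  (- (y * bessel_series'' y + 2 * bessel_series' y)) by lra.
unfold y; field; exact Nr.
Qed.

Lemma barrier_continuous (gamma r z : R) : continuous2 (barrier gamma) r z.
Proof.
unfold continuous2, barrier.
assert (F : forall y : R, continuous bessel_series y).
{ intros y; apply continuity_pt_filterlim, bessel_series_continuity. }
apply @continuous_mult.
- apply @continuous_mult; [apply continuous_fst |].
  apply (continuous_comp (fun p : R * R => fst p)
    (fun r => bessel_series ((gamma * r / 2) ^ 2))); [apply continuous_fst |].
  apply (continuous_comp (fun r => (gamma * r / 2) ^ 2) bessel_series); [| apply F].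
  apply @ex_derive_continuous; auto_derive; exact I.
- apply (continuous_comp (fun p : R * R => snd p)
    (fun z => exp (gamma * z) + exp (- (gamma * z)))); [apply continuous_snd |].
  apply @ex_derive_continuous; auto_derive; exact I.
Qed.

(** * The maximum principle *)

Lemma is_derive_pos_nearby (f : R -> R) (x l : R) : is_derive f x l -> 0 < l ->
  exists d, 0 < d /\ forall h, 0 < h < d -> f x < f (x + h) /\ f (x - h) < f x.
Proof.
intros D Hl; apply is_derive_Reals in D.
destruct (D l Hl) as [d Hd]; exists d; split; [apply cond_pos |].
intros h Hh; split.
- assert (K := Hd h ltac:(lra) ltac:(rewrite Rabs_pos_eq; lra)).
  apply Rabs_lt_between in K.
  assert (P : 0 < (f (x + h) - f x) / h) by lra.
  apply Rmult_lt_compat_r with (r := h) in P; [| lra].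
  replace ((f (x + h) - f x) / h * h) with (f (x + h) - f x) in P by (field; lra); lra.
- assert (K := Hd (- h) ltac:(lra) ltac:(rewrite Rabs_Ropp, Rabs_pos_eq; lra)).
  apply Rabs_lt_between in K; unfold Rminus at 1.
  assert (P : 0 < (f (x + - h) - f x) / - h) by lra.
  apply Rmult_lt_compat_r with (r := h) in P; [| lra].
  replace ((f (x + - h) - f x) / - h * h) with (f x - f (x + - h)) in P by (field; lra); lra.
Qed.

Lemma derivatives_at_maximum (f df : R -> R) (x lo hi l : R) : lo < x < hi ->
  (forall y, lo < y < hi -> is_derive f y (df y)) -> is_derive df x l ->
  (forall y, lo < y < hi -> f y <= f x) -> df x = 0 /\ l <= 0.
Proof.
intros Hx Df Ddf M.
assert (Hm : 0 < Rmin (x - lo) (hi - x)) by (apply Rmin_pos; lra).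
assert (m1 := Rmin_l (x - lo) (hi - x)); assert (m2 := Rmin_r (x - lo) (hi - x)).
assert (Z : df x = 0).
{ destruct (Rtotal_order (df x) 0) as [lt | [E | gt]]; [exfalso | exact E | exfalso].
  - destruct (is_derive_pos_nearby (fun y => - f y) x (- df x)) as [d [dpos Hd]].
    { apply (is_derive_opp f), Df, Hx. }
    { lra. }
    set (h := Rmin d (Rmin (x - lo) (hi - x)) / 2).
    assert (n1 := Rmin_l d (Rmin (x - lo) (hi - x))).
    assert (n2 := Rmin_r d (Rmin (x - lo) (hi - x))).
    assert (n3 : 0 < Rmin d (Rmin (x - lo) (hi - x))) by (apply Rmin_pos; lra).
    destruct (Hd h) as [_ K]; [unfold h; lra |].
    specialize (M (x - h) ltac:(unfold h; lra)); lra.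
  - destruct (is_derive_pos_nearby f x (df x)) as [d [dpos Hd]];
      [apply Df, Hx | lra |].
    set (h := Rmin d (Rmin (x - lo) (hi - x)) / 2).
    assert (n1 := Rmin_l d (Rmin (x - lo) (hi - x))).
    assert (n2 := Rmin_r d (Rmin (x - lo) (hi - x))).
    assert (n3 : 0 < Rmin d (Rmin (x - lo) (hi - x))) by (apply Rmin_pos; lra).
    destruct (Hd h) as [K _]; [unfold h; lra |].
    specialize (M (x + h) ltac:(unfold h; lra)); lra. }
split; [exact Z |].
apply Rnot_lt_le; intros lpos.
destruct (is_derive_pos_nearby df x l Ddf lpos) as [d [dpos Hd]].
set (h := Rmin d (Rmin (x - lo) (hi - x)) / 2).
assert (n1 := Rmin_l d (Rmin (x - lo) (hi - x))).
assert (n2 := Rmin_r d (Rmin (x - lo) (hi - x))).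
assert (n3 : 0 < Rmin d (Rmin (x - lo) (hi - x))) by (apply Rmin_pos; lra).
destruct (MVT_cor2 f df x (x + h)) as [c [E Hc]]; [unfold h; lra | |].
- intros c Hc; apply is_derive_Reals, Df; unfold h in Hc; lra.
- destruct (Hd (c - x)) as [K _]; [unfold h in Hc; lra |].
  replace (x + (c - x)) with c in K by ring; rewrite Z in K.
  specialize (M (x + h) ltac:(unfold h; lra)).
  assert (0 < h) by (unfold h; lra); nra.
Qed.

(** The comparison function controls [a] at infinity because [gamma0 < gamma],
    and is positive because [gamma < alpha].  At a positive interior maximum of
    [sigma * a - eps * barrier] the zero order term - w / r ^ 2 of the equation is
    negative and the other terms are nonpositive. *)
Lemma radial_phragmen_lindelof (a : R -> R -> R) (sigma alpha C gamma0 : R) :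
  strip_smooth a -> Rabs sigma = 1 ->
  (forall z, a 0 z = 0) ->
  (forall z, filterlim (fun r => a r z) (at_left 1) (locally 0)) ->
  (forall r z, 0 < r < 1 ->
    D1 (D1 a) r z + D1 a r z / r - a r z / r ^ 2 + D2 (D2 a) r z = 0) ->
  smallest_positive_root BesselJ1 alpha -> gamma0 < alpha ->
  (forall r z, 0 < r < 1 -> Rabs (a r z) <= C * r * exp (gamma0 * Rabs z)) ->
  forall r z, 0 < r < 1 -> sigma * a r z <= 0.
Proof.
intros Sa sg axis wall eq Ha lt bound r0 z0 Hr0.
apply Rnot_lt_le; intros pos.
assert (apos : 0 < alpha) by apply Ha.
set (gamma := (Rmax gamma0 0 + alpha) / 2).
assert (Hgamma : 0 < gamma < alpha /\ gamma0 < gamma).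
{ unfold gamma; assert (M1 := Rmax_l gamma0 0); assert (M2 := Rmax_r gamma0 0).
  assert (Rmax gamma0 0 < alpha) by (apply Rmax_lub_lt; lra); lra. }
destruct (bessel_series_lower_bound alpha gamma Ha) as [m [mpos Hm]]; [lra |].
assert (W0 : forall r z, 0 < r < 1 ->
  r * m * (exp (gamma * z) + exp (- (gamma * z))) <= barrier gamma r z).
{ intros r z Hr; unfold barrier; apply Rmult_le_compat_r.
  - assert (P := exp_pos (gamma * z)); assert (P' := exp_pos (- (gamma * z))); lra.
  - apply Rmult_le_compat_l; [lra |]; apply Hm; lra. }
assert (Wpos : forall r z, 0 < r < 1 -> 0 < barrier gamma r z).
{ intros r z Hr; apply Rlt_le_trans with (2 := W0 r z Hr).
  assert (P := exp_pos (gamma * z)); assert (P' := exp_pos (- (gamma * z))).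
  apply Rmult_lt_0_compat; [apply Rmult_lt_0_compat |]; lra. }
assert (Cpos : 0 < C).
{ assert (B := bound r0 z0 Hr0); assert (E := exp_pos (gamma0 * Rabs z0)).
  assert (sigma * a r0 z0 <= Rabs (a r0 z0)).
  { apply Rle_trans with (1 := Rle_abs _); rewrite Rabs_mult, sg; lra. }
  apply Rnot_le_lt; intros Cn.
  assert (0 < r0 * exp (gamma0 * Rabs z0)) by (apply Rmult_lt_0_compat; lra); nra. }
set (eps := sigma * a r0 z0 / (2 * barrier gamma r0 z0)).
assert (epos : 0 < eps).
{ apply Rdiv_lt_0_compat; [exact pos | specialize (Wpos r0 z0 Hr0); lra]. }
set (w := fun r z => sigma * a r z - eps * barrier gamma r z).
assert (w0 : w r0 z0 = sigma * a r0 z0 / 2).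
{ unfold w, eps; field; specialize (Wpos r0 z0 Hr0); lra. }
assert (sa : forall r z, sigma * a r z <= Rabs (a r z)).
{ intros r z; apply Rle_trans with (1 := Rle_abs _); rewrite Rabs_mult, sg; lra. }
set (Z := Rmax (Rabs z0 + 1) (C / (eps * m * (gamma - gamma0)))).
assert (HZ0 : Rabs z0 + 1 <= Z) by apply Rmax_l.
assert (HZ1 : C / (eps * m * (gamma - gamma0)) <= Z) by apply Rmax_r.
assert (Zpos : 0 < Z) by (assert (P := Rabs_pos z0); lra).
assert (ends : forall r z, 0 < r < 1 -> Rabs z = Z -> w r z < 0).
{ intros r z Hr Hz; unfold w.
  assert (S1 : C * exp (gamma0 * Z) < eps * m * exp (gamma * Z)).
  { replace (gamma * Z) with (gamma0 * Z + (gamma - gamma0) * Z) by ring.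
    rewrite exp_plus.
    assert (E := exp_pos (gamma0 * Z)).
    assert (X : C < eps * m * exp ((gamma - gamma0) * Z)).
    { assert (K := exp_ineq1 ((gamma - gamma0) * Z)).
      assert (C <= eps * m * ((gamma - gamma0) * Z)).
      { apply Rmult_le_compat_l with (r := eps * m * (gamma - gamma0)) in HZ1.
        - replace (eps * m * (gamma - gamma0) * (C / (eps * m * (gamma - gamma0))))
            with C in HZ1 by (field; repeat split; lra); lra.
        - apply Rmult_le_pos; [apply Rmult_le_pos |]; lra. }
      assert (0 < eps * m) by now apply Rmult_lt_0_compat.
      assert ((gamma - gamma0) * Z <> 0) by (apply Rmult_integral_contrapositive; lra).
      specialize (K H1); nra. }
    nra. }
  assert (B := bound r z Hr); rewrite Hz in B.
  assert (L := W0 r z Hr); specialize (sa r z).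
  assert (G : exp (gamma * Z) <= exp (gamma * z) + exp (- (gamma * z))).
  { assert (P := exp_pos (gamma * z)); assert (P' := exp_pos (- (gamma * z))).
    unfold Rabs in Hz; destruct (Rcase_abs z); subst Z.
    - rewrite <- Hz; replace (gamma * - z) with (- (gamma * z)) by ring; lra.
    - rewrite <- Hz; lra. }
  assert (L' : eps * (r * m * exp (gamma * Z)) <= eps * barrier gamma r z).
  { apply Rmult_le_compat_l; [lra |]; apply Rle_trans with (2 := L).
    apply Rmult_le_compat_l; [apply Rmult_le_pos; lra | exact G]. }
  assert (r * (C * exp (gamma0 * Z)) < r * (eps * m * exp (gamma * Z)))
    by (apply Rmult_lt_compat_l; lra).
  lra. }
destruct (wall_linear_bound a Z Sa wall) as [B HB].
destruct (axis_linear_bound a Z Sa axis) as [B' HB'].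
(* width of the margins along the axis and the wall in which w < w r0 z0 *)
set (K := Rmax 1 (Rmax B B')).
assert (K1 : 1 <= K) by apply Rmax_l.
assert (KB : B <= K) by (apply Rle_trans with (2 := Rmax_r _ _), Rmax_l).
assert (KB' : B' <= K) by (apply Rle_trans with (2 := Rmax_r _ _), Rmax_r).
set (mu := sigma * a r0 z0 / (4 * K)).
assert (mupos : 0 < mu) by (apply Rdiv_lt_0_compat; lra).
assert (muK : K * mu < w r0 z0).
{ rewrite w0; unfold mu.
  replace (K * (sigma * a r0 z0 / (4 * K))) with (sigma * a r0 z0 / 4)
    by (field; lra); lra. }
assert (Hz0 : Rabs z0 <= Z) by lra.
assert (margin : forall r z, 0 < r < 1 -> Rabs z <= Z ->
  r <= mu \/ 1 - mu <= r -> w r z < w r0 z0).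
{ intros r z Hr Hz side; apply Rle_lt_trans with (2 := muK).
  assert (E : 0 < eps * barrier gamma r z) by (apply Rmult_lt_0_compat; auto).
  unfold w; specialize (sa r z).
  specialize (HB r z Hr Hz); specialize (HB' r z Hr Hz).
  destruct side; [assert (B' * r <= K * mu) by nra | assert (B * (1 - r) <= K * mu) by nra];
    lra. }
assert (Hr0' : mu < r0 < 1 - mu).
{ split; apply Rnot_le_lt; intros H;
    apply (Rlt_irrefl (w r0 z0)), margin; auto. }
destruct (rectangle_max w mu (1 - mu) (- Z) Z) as [r1 [z1 [Hr1 [Hz1 M]]]];
  [lra | lra | |].
{ intros r z Hr _; unfold continuous2, w.
  apply @continuous_minus.
  - apply (continuous_scal_r sigma (fun p : R * R => a (fst p) (snd p))).
    apply strip_cont; [exact Sa | lra].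
  - apply (continuous_scal_r eps (fun p : R * R => barrier gamma (fst p) (snd p))).
    apply barrier_continuous. }
assert (top : w r0 z0 <= w r1 z1).
{ apply M; [lra |]; now apply Rabs_le_between. }
assert (w0pos : 0 < w r0 z0) by (rewrite w0; lra).
assert (Hz1' : Rabs z1 <= Z) by now apply Rabs_le_between.
assert (Ir : mu < r1 < 1 - mu).
{ split; apply Rnot_le_lt; intros H; apply (Rlt_irrefl (w r0 z0));
    apply Rle_lt_trans with (1 := top), margin; auto; lra. }
assert (Iz : - Z < z1 < Z).
{ assert (Rabs z1 <> Z).
  { intros E; assert (N := ends r1 z1 ltac:(lra) E); lra. }
  apply Rabs_lt_between; lra. }
destruct (derivatives_at_maximum (fun s => w s z1)
  (fun s => sigma * D1 a s z1 - eps * barrier1 gamma s z1) r1 mu (1 - mu)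
  (sigma * D1 (D1 a) r1 z1 - eps * barrier11 gamma r1 z1) Ir) as [E1 E11].
{ intros s Hs; apply @is_derive_minus.
  - apply (is_derive_scal (fun t => a t z1)), strip_is_derive1; [exact Sa | lra].
  - apply (is_derive_scal (fun t => barrier gamma t z1)), barrier_derive1. }
{ apply @is_derive_minus.
  - apply (is_derive_scal (fun t => D1 a t z1)), strip_is_derive1;
      [now apply strip_D1 | lra].
  - apply (is_derive_scal (fun t => barrier1 gamma t z1)), barrier_derive11. }
{ intros s Hs; apply M; lra. }
destruct (derivatives_at_maximum (fun s => w r1 s)
  (fun s => sigma * D2 a r1 s - eps * barrier2 gamma r1 s) z1 (- Z) Z
  (sigma * D2 (D2 a) r1 z1 - eps * (gamma ^ 2 * barrier gamma r1 z1)) Iz) as [_ E22].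
{ intros s Hs; apply @is_derive_minus.
  - apply (is_derive_scal (fun t => a r1 t)), strip_is_derive2; [exact Sa | lra].
  - apply (is_derive_scal (fun t => barrier gamma r1 t)), barrier_derive2. }
{ apply @is_derive_minus.
  - apply (is_derive_scal (fun t => D2 a r1 t)), strip_is_derive2;
      [now apply strip_D2 | lra].
  - apply (is_derive_scal (fun t => barrier2 gamma r1 t)), barrier_derive22. }
{ intros s Hs; apply M; lra. }
assert (Q := eq r1 z1 ltac:(lra)).
assert (Q' := barrier_equation gamma r1 z1 ltac:(lra)).
assert (Q'' : (sigma * D1 (D1 a) r1 z1 - eps * barrier11 gamma r1 z1)
  + (sigma * D1 a r1 z1 - eps * barrier1 gamma r1 z1) / r1 - w r1 z1 / r1 ^ 2
  + (sigma * D2 (D2 a) r1 z1 - eps * (gamma ^ 2 * barrier gamma r1 z1)) = 0).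
{ transitivity (sigma * 0 - eps * 0); [| ring].
  rewrite <- Q at 1; rewrite <- Q' ; unfold w, Rdiv; ring. }
rewrite E1 in Q''.
assert (0 < w r1 z1 / r1 ^ 2) by (apply Rdiv_lt_0_compat; nra).
unfold Rdiv in Q'' at 1; lra.
Qed.

(** * The vorticity equation *)

Lemma vorticity_smooth (a c : R -> R -> R) :
  strip_smooth a -> strip_smooth c -> strip_smooth (vorticity a c).
Proof.
intros Sa Sc; apply (strip_smooth_minus (D2 a) (D1 c));
  [now apply strip_D2 | now apply strip_D1].
Qed.

Lemma D1_vorticity (a c : R -> R -> R) (r z : R) :
  strip_smooth a -> strip_smooth c -> -1 < r < 1 ->
  D1 (vorticity a c) r z = D1 (D2 a) r z - D1 (D1 c) r z.
Proof.
intros Sa Sc Hr; apply (Derive_minus (fun s => D2 a s z) (fun s => D1 c s z)).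
- apply strip_ex1; [now apply strip_D2 | exact Hr].
- apply strip_ex1; [now apply strip_D1 | exact Hr].
Qed.

Lemma D2_vorticity (a c : R -> R -> R) (r z : R) :
  strip_smooth a -> strip_smooth c -> -1 < r < 1 ->
  D2 (vorticity a c) r z = D2 (D2 a) r z - D2 (D1 c) r z.
Proof.
intros Sa Sc Hr; apply (Derive_minus (fun s => D2 a r s) (fun s => D1 c r s)).
- apply strip_ex2; [now apply strip_D2 | exact Hr].
- apply strip_ex2; [now apply strip_D1 | exact Hr].
Qed.

(** The axial derivative of the radial equation minus the radial derivative of the
    axial one.  The pressure cancels, the swirl b^2 / r has no axial derivative,
    and the stretching terms (D1 a + D2 c) w are - (a / r) w by
    incompressibility. *)
Lemma vorticity_equation (a b c q : R -> R -> R) : meridional_flow a b c q ->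
  (forall r z z', 0 < r < 1 -> b r z = b r z') ->
  forall r z, 0 < r < 1 ->
  let w := vorticity a c in
  a r z * D1 w r z + c r z * D2 w r z - a r z / r * w r z
  = D1 (D1 w) r z + D1 w r z / r - w r z / r ^ 2 + D2 (D2 w) r z.
Proof.
intros F bz r z Hr w.
assert (Sa := smooth_a _ _ _ _ F); assert (Sc := smooth_c _ _ _ _ F).
assert (Sq := smooth_q _ _ _ _ F).
assert (Hr' : -1 < r < 1) by lra.
assert (E1 : D2 a r z * D1 a r z + a r z * D2 (D1 a) r z
  + (D2 c r z * D2 a r z + c r z * D2 (D2 a) r z) + D2 (D1 q) r z
  = D2 (D1 (D1 a)) r z + D2 (D1 a) r z / r - D2 a r z / r ^ 2 + D2 (D2 (D2 a)) r z).
{ assert (L : is_derive (fun t => a r t * D1 a r t - b r 0 ^ 2 / r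
      + c r t * D2 a r t + D1 q r t) z
    (D2 a r z * D1 a r z + a r z * D2 (D1 a) r z
     + (D2 c r z * D2 a r z + c r z * D2 (D2 a) r z) + D2 (D1 q) r z)).
  { assert (H1 := strip_ex2 _ Sa r z Hr').
    assert (H2 := strip_ex2 _ (strip_D1 _ Sa) r z Hr').
    assert (H3 := strip_ex2 _ Sc r z Hr').
    assert (H4 := strip_ex2 _ (strip_D2 _ Sa) r z Hr').
    assert (H5 := strip_ex2 _ (strip_D1 _ Sq) r z Hr').
    auto_derive; [now repeat split | unfold D2; ring]. }
  assert (M : is_derive (fun t => D1 (D1 a) r t + D1 a r t / r - a r t / r ^ 2
      + D2 (D2 a) r t) z
    (D2 (D1 (D1 a)) r z + D2 (D1 a) r z / r - D2 a r z / r ^ 2 + D2 (D2 (D2 a)) r z)).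
  { assert (H1 := strip_ex2 _ Sa r z Hr').
    assert (H2 := strip_ex2 _ (strip_D1 _ Sa) r z Hr').
    assert (H3 := strip_ex2 _ (strip_D1 _ (strip_D1 _ Sa)) r z Hr').
    assert (H4 := strip_ex2 _ (strip_D2 _ (strip_D2 _ Sa)) r z Hr').
    auto_derive; [now repeat split | unfold D2; field; lra]. }
  apply is_derive_unique in L; apply is_derive_unique in M.
  rewrite <- L, <- M; apply Derive_ext; intros t.
  rewrite <- (radial_eq _ _ _ _ F r t Hr), (bz r t 0 Hr); reflexivity. }
assert (E2 : D1 a r z * D1 c r z + a r z * D1 (D1 c) r z
  + (D1 c r z * D2 c r z + c r z * D1 (D2 c) r z) + D1 (D2 q) r z
  = D1 (D1 (D1 c)) r z + (D1 (D1 c) r z / r - D1 c r z / r ^ 2) + D1 (D2 (D2 c)) r z).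
{ assert (L : is_derive (fun s => a s z * D1 c s z + c s z * D2 c s z + D2 q s z) r
    (D1 a r z * D1 c r z + a r z * D1 (D1 c) r z
     + (D1 c r z * D2 c r z + c r z * D1 (D2 c) r z) + D1 (D2 q) r z)).
  { assert (H1 := strip_ex1 _ Sa r z Hr').
    assert (H2 := strip_ex1 _ Sc r z Hr').
    assert (H3 := strip_ex1 _ (strip_D1 _ Sc) r z Hr').
    assert (H4 := strip_ex1 _ (strip_D2 _ Sc) r z Hr').
    assert (H5 := strip_ex1 _ (strip_D2 _ Sq) r z Hr').
    auto_derive; [now repeat split | unfold D1; ring]. }
  assert (M : is_derive (fun s => D1 (D1 c) s z + D1 c s z / s + D2 (D2 c) s z) r
    (D1 (D1 (D1 c)) r z + (D1 (D1 c) r z / r - D1 c r z / r ^ 2) + D1 (D2 (D2 c)) r z)).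
  { assert (H1 := strip_ex1 _ (strip_D1 _ Sc) r z Hr').
    assert (H2 := strip_ex1 _ (strip_D1 _ (strip_D1 _ Sc)) r z Hr').
    assert (H3 := strip_ex1 _ (strip_D2 _ (strip_D2 _ Sc)) r z Hr').
    auto_derive; [repeat split; auto; lra | unfold D1; field; lra]. }
  apply is_derive_unique in L; apply is_derive_unique in M.
  rewrite <- L, <- M; apply Derive_ext_loc, locally_open_unit; [exact Hr |].
  intros s Hs; now apply (axial_eq _ _ _ _ F). }
assert (w1 := fun r z => D1_vorticity a c r z Sa Sc).
assert (w2 := fun r z => D2_vorticity a c r z Sa Sc).
assert (w11 : D1 (D1 w) r z = D1 (D1 (D2 a)) r z - D1 (D1 (D1 c)) r z).
{ unfold w; rewrite (D1_ext _ _ w1 r z Hr').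
  apply (Derive_minus (fun s => D1 (D2 a) s z) (fun s => D1 (D1 c) s z));
    apply strip_ex1; auto using strip_D1, strip_D2. }
assert (w22 : D2 (D2 w) r z = D2 (D2 (D2 a)) r z - D2 (D2 (D1 c)) r z).
{ unfold w; rewrite (D2_ext _ _ w2 r z Hr').
  apply (Derive_minus (fun s => D2 (D2 a) r s) (fun s => D2 (D1 c) r s));
    apply strip_ex2; auto using strip_D1, strip_D2. }
assert (C1 : D1 (D2 a) r z = D2 (D1 a) r z) by now apply D_commute.
assert (C2 : D1 (D1 (D2 a)) r z = D2 (D1 (D1 a)) r z).
{ rewrite (D1_ext _ (D2 (D1 a))); [| intros; now apply D_commute | exact Hr'].
  apply D_commute; [now apply strip_D1 | exact Hr']. }
assert (C3 : D1 (D2 c) r z = D2 (D1 c) r z) by now apply D_commute.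
assert (C4 : D1 (D2 (D2 c)) r z = D2 (D2 (D1 c)) r z).
{ rewrite D_commute; [| now apply strip_D2 | exact Hr'].
  apply D2_ext; [intros; now apply D_commute | exact Hr']. }
assert (C5 : D1 (D2 q) r z = D2 (D1 q) r z) by now apply D_commute.
assert (dv := continuity_eq _ _ _ _ F r z Hr).
rewrite w11, w22; unfold w; rewrite w1, w2 by exact Hr'.
rewrite C3, C4, C5 in E2; rewrite C1, C2.
assert (dv' : a r z / r = - (D1 a r z + D2 c r z)) by lra.
rewrite dv'; unfold vorticity, Rdiv in *.
set (i := / r) in *; set (j := / r ^ 2) in *.
nra.
Qed.

(** * A convex function of growth 3/2 *)

(** (1 + s ^ 2) ^ (1 / 4); the convex function is (1 + s ^ 2) ^ (3 / 4) - 1. *)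
Definition quartic_root (s : R) : R := sqrt (sqrt (1 + s ^ 2)).
Definition entropy (s : R) : R := quartic_root s ^ 3 - 1.
Definition entropy' (s : R) : R := 3 / 2 * (s / quartic_root s).
Definition entropy'' (s : R) : R := 3 / 4 * (2 + s ^ 2) / quartic_root s ^ 5.

Lemma quartic_root_spec (s : R) :
  1 <= quartic_root s /\ quartic_root s ^ 4 = 1 + s ^ 2 /\
  quartic_root s * quartic_root s = sqrt (1 + s ^ 2).
Proof.
assert (H : 1 <= 1 + s ^ 2) by nra.
assert (H1 : 1 <= sqrt (1 + s ^ 2)) by (rewrite <- sqrt_1 at 1; now apply sqrt_le_1_alt).
assert (Q : quartic_root s * quartic_root s = sqrt (1 + s ^ 2)).
{ apply sqrt_sqrt; lra. }
repeat split.
- unfold quartic_root; rewrite <- sqrt_1 at 1; now apply sqrt_le_1_alt.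
- replace (quartic_root s ^ 4)
    with ((quartic_root s * quartic_root s) * (quartic_root s * quartic_root s)) by ring.
  rewrite Q; apply sqrt_sqrt; lra.
- exact Q.
Qed.

Lemma quartic_root_derive (s : R) :
  is_derive quartic_root s (s / (2 * quartic_root s ^ 3)).
Proof.
destruct (quartic_root_spec s) as [H1 [_ H2]].
assert (P : 1 <= 1 + s ^ 2) by nra.
assert (P' : 0 < sqrt (1 + s ^ 2)) by (apply sqrt_lt_R0; lra).
assert (E : quartic_root s = sqrt (sqrt (1 + s * (s * 1)))) by reflexivity.
unfold quartic_root at 1; auto_derive.
- repeat split; simpl in *; lra.
- rewrite <- E; replace (1 + s * (s * 1)) with (1 + s ^ 2) by ring.
  rewrite <- H2; field; lra.
Qed.

Lemma entropy_derive (s : R) : is_derive entropy s (entropy' s).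
Proof.
destruct (quartic_root_spec s) as [H1 _].
unfold entropy.
assert (D := quartic_root_derive s).
assert (X : ex_derive quartic_root s) by (eexists; exact D).
auto_derive; [exact X |].
replace (Derive (fun x => quartic_root x) s) with (s / (2 * quartic_root s ^ 3))
  by (symmetry; apply is_derive_unique, D).
unfold entropy'; field; lra.
Qed.

Lemma entropy'_derive (s : R) : is_derive entropy' s (entropy'' s).
Proof.
destruct (quartic_root_spec s) as [H1 [H4 _]].
unfold entropy'.
assert (D := quartic_root_derive s).
assert (X : ex_derive quartic_root s) by (eexists; exact D).
auto_derive; [repeat split; [exact X | lra] |].
replace (Derive (fun x => quartic_root x) s) with (s / (2 * quartic_root s ^ 3))
  by (symmetry; apply is_derive_unique, D).
unfold entropy''.
replace (2 + s ^ 2) with (2 * quartic_root s ^ 4 - s ^ 2) by lra.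
field; lra.
Qed.

Lemma entropy_nonneg (s : R) : 0 <= entropy s.
Proof. destruct (quartic_root_spec s) as [H1 _]; unfold entropy; nra. Qed.

Lemma entropy_le_sqr (s : R) : entropy s <= s ^ 2.
Proof.
destruct (quartic_root_spec s) as [H1 [H4 _]]; unfold entropy.
assert (1 <= quartic_root s ^ 3) by (simpl; nra).
replace (s ^ 2) with (quartic_root s * quartic_root s ^ 3 - 1)
  by (replace (quartic_root s * quartic_root s ^ 3) with (quartic_root s ^ 4) by ring; lra).
nra.
Qed.

Lemma entropy_eq_0 (s : R) : entropy s = 0 -> s = 0.
Proof.
destruct (quartic_root_spec s) as [H1 [H4 _]]; unfold entropy; intros E.
assert (Y : quartic_root s = 1) by (simpl in E; nra).
rewrite Y in H4; nra.
Qed.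

Lemma entropy'_bound (s : R) : Rabs (entropy' s) <= 2 * Rabs s.
Proof.
destruct (quartic_root_spec s) as [H1 _]; unfold entropy', Rdiv.
rewrite !Rabs_mult, (Rabs_pos_eq (/ 2)), (Rabs_pos_eq 3) by lra.
rewrite (Rabs_pos_eq (/ quartic_root s)) by (apply Rlt_le, Rinv_0_lt_compat; lra).
assert (I : / quartic_root s <= 1) by (rewrite <- Rinv_1; apply Rinv_le_contravar; lra).
assert (P := Rabs_pos s); nra.
Qed.

Lemma entropy''_nonneg (s : R) : 0 <= entropy'' s.
Proof.
destruct (quartic_root_spec s) as [H1 _]; unfold entropy''.
apply Rlt_le, Rdiv_lt_0_compat; [nra | apply pow_lt; lra].
Qed.

(** This relation lets the dissipation entropy'' * |Omega'|^2 control the entropy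
    itself: it bounds entropy' * Omega' in the Poincare inequality of
    [energy_pointwise].  In y = (1 + s ^ 2) ^ (1 / 4) it is polynomial. *)
Lemma entropy'_sqr (s : R) : entropy' s ^ 2 <= 4 * entropy s * entropy'' s.
Proof.
destruct (quartic_root_spec s) as [H1 [H4 _]].
unfold entropy', entropy, entropy''; set (y := quartic_root s) in *.
replace (2 + s ^ 2) with (1 + y ^ 4) by lra.
assert (E : (3 / 2 * (s / y)) ^ 2 = 9 / 4 * (y ^ 4 - 1) / y ^ 2).
{ replace (y ^ 4 - 1) with (s ^ 2) by lra; field; lra. }
rewrite E; clear E.
assert (P : 0 < / y ^ 5) by (apply Rinv_0_lt_compat, pow_lt; lra).
replace (9 / 4 * (y ^ 4 - 1) / y ^ 2) with (3 * (3 / 4 * (y ^ 4 - 1) * y ^ 3) * / y ^ 5)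
  by (field; lra).
replace (4 * (y ^ 3 - 1) * (3 / 4 * (1 + y ^ 4) / y ^ 5))
  with (3 * ((y ^ 3 - 1) * (1 + y ^ 4)) * / y ^ 5) by (field; lra).
apply Rmult_le_compat_r; [lra |].
apply Rmult_le_compat_l; [lra |].
apply Rminus_le_0.
replace ((y ^ 3 - 1) * (1 + y ^ 4) - 3 / 4 * (y ^ 4 - 1) * y ^ 3) with
  ((y - 1) / 4 * (y ^ 6 + y ^ 5 + y ^ 4 - 3 * y ^ 3 + 4 * y ^ 2 + 4 * y + 4)) by field.
apply Rmult_le_pos; [lra |].
assert (1 <= y ^ 2) by nra.
replace (y ^ 6 + y ^ 5 + y ^ 4 - 3 * y ^ 3 + 4 * y ^ 2 + 4 * y + 4) with
  (y ^ 3 * (y ^ 2 * y + y ^ 2 + y - 3) + 4 * y ^ 2 + 4 * y + 4) by ring.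
assert (0 <= y ^ 3) by (apply pow_le; lra).
assert (0 <= y ^ 2 * y + y ^ 2 + y - 3) by nra.
assert (0 <= y ^ 3 * (y ^ 2 * y + y ^ 2 + y - 3)) by now apply Rmult_le_pos.
nra.
Qed.

(** The growth 3/2 < 2 is what makes the right-hand side integrable at the
    axis for a vorticity that is merely bounded. *)
Lemma entropy_over_r_bound (w M r : R) : 1 <= M -> Rabs w <= M -> 0 < r < 1 ->
  r * entropy (w / r) <= 3 * M ^ 2 / sqrt r.
Proof.
intros HM Hw Hr.
destruct (quartic_root_spec (w / r)) as [H1 [H4 _]].
unfold entropy; set (y := quartic_root (w / r)) in *.
assert (s0 : 0 < sqrt r) by (apply sqrt_lt_R0; lra).
assert (s2 : sqrt r * sqrt r = r) by (apply sqrt_sqrt; lra).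
apply Rmult_le_reg_r with (sqrt r); [exact s0 |].
replace (3 * M ^ 2 / sqrt r * sqrt r) with (3 * M ^ 2) by (field; lra).
set (t := y * sqrt r).
assert (t0 : 0 < t) by (apply Rmult_lt_0_compat; lra).
assert (t4 : t ^ 4 <= 2 * M ^ 2).
{ replace (t ^ 4) with (y ^ 4 * (sqrt r * sqrt r) ^ 2) by (unfold t; ring).
  rewrite s2, H4.
  replace ((1 + (w / r) ^ 2) * r ^ 2) with (r ^ 2 + w ^ 2) by (field; lra).
  assert (w ^ 2 <= M ^ 2).
  { rewrite <- (pow2_abs w); apply pow_incr; split; [apply Rabs_pos | exact Hw]. }
  nra. }
assert (t3 : t ^ 3 <= 1 + t ^ 4).
{ destruct (Rle_dec t 1).
  - assert (t ^ 3 <= 1) by (rewrite <- (pow1 3); apply pow_incr; lra).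
    assert (0 <= t ^ 4) by (apply pow_le; lra); lra.
  - assert (0 < t ^ 3) by (apply pow_lt; lra).
    replace (t ^ 4) with (t * t ^ 3) by ring; nra. }
replace (r * (y ^ 3 - 1) * sqrt r) with (t ^ 3 - r * sqrt r)
  by (unfold t; rewrite <- s2 at 2; ring_simplify;
      replace (sqrt r ^ 3) with (sqrt r * sqrt r * sqrt r) by ring; rewrite s2; ring).
assert (0 <= r * sqrt r) by (apply Rmult_le_pos; lra).
nra.
Qed.

Lemma entropy_continuous (s : R) :
  continuous entropy s /\ continuous entropy' s /\ continuous entropy'' s.
Proof.
destruct (quartic_root_spec s) as [H1 _].
repeat split.
- apply @ex_derive_continuous; eexists; apply entropy_derive.
- apply @ex_derive_continuous; eexists; apply entropy'_derive.
- apply @ex_derive_continuous; unfold entropy''.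
  assert (X : ex_derive quartic_root s) by (eexists; apply quartic_root_derive).
  auto_derive; repeat split; auto.
  apply Rgt_not_eq, (pow_lt (quartic_root s) 5); lra.
Qed.

(** * The energy inequality on radial sections *)

Section Energy.

Variables a c w : R -> R -> R.
Hypothesis Sa : strip_smooth a.
Hypothesis Sc : strip_smooth c.
Hypothesis Sw : strip_smooth w.
Hypothesis divergence_free : forall r z, 0 < r < 1 ->
  D1 a r z + a r z / r + D2 c r z = 0.
Hypothesis transport : forall r z, 0 < r < 1 ->
  a r z * D1 w r z + c r z * D2 w r z - a r z / r * w r z
  = D1 (D1 w) r z + D1 w r z / r - w r z / r ^ 2 + D2 (D2 w) r z.
Hypothesis axis_w0 : forall z, w 0 z = 0.
Hypothesis wall_a0 : forall z, filterlim (fun r => a r z) (at_left 1) (locally 0).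
Hypothesis wall_w0 : forall z, filterlim (fun r => w r z) (at_left 1) (locally 0).

Definition energy_density (r z : R) : R := r * entropy (w r z / r).
Definition energy_density2 (r z : R) : R := entropy' (w r z / r) * D2 w r z.
Definition energy_density22 (r z : R) : R :=
  entropy'' (w r z / r) * D2 w r z ^ 2 / r + entropy' (w r z / r) * D2 (D2 w) r z.
Definition flux_density (r z : R) : R := c r z * (r * entropy (w r z / r)).
Definition flux_density2 (r z : R) : R :=
  D2 c r z * (r * entropy (w r z / r)) + c r z * (entropy' (w r z / r) * D2 w r z).

(** With h = entropy, Omega = w / r and r D1 Omega = D1 w - w / r, the terms
    r a h - r D1 (h (Omega)) - 2 h come from the transport and from the
    five-dimensional Laplacian, and - r ^ 2 h from the Poincare inequality. *)
Definition radial_flux (r z : R) : R :=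
  r * a r z * entropy (w r z / r)
  - entropy' (w r z / r) * (D1 w r z - w r z / r)
  - (2 + r ^ 2) * entropy (w r z / r).

Definition radial_flux1 (r z : R) : R :=
  let d := D1 w r z / r - w r z / r ^ 2 in
  (a r z + r * D1 a r z) * entropy (w r z / r)
  + r * a r z * (entropy' (w r z / r) * d)
  - (entropy'' (w r z / r) * d * (D1 w r z - w r z / r)
     + entropy' (w r z / r) * (D1 (D1 w) r z - d))
  - (2 * r * entropy (w r z / r) + (2 + r ^ 2) * (entropy' (w r z / r) * d)).

Lemma entropy_comp_derive (f : R -> R) (x l : R) : is_derive f x l ->
  is_derive (fun t => entropy (f t)) x (entropy' (f x) * l) /\
  is_derive (fun t => entropy' (f t)) x (entropy'' (f x) * l).
Proof.
intros H; split; (eapply is_derive_eq; [| apply Rmult_comm]).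
- apply (is_derive_comp entropy f x _ _ (entropy_derive _) H).
- apply (is_derive_comp entropy' f x _ _ (entropy'_derive _) H).
Qed.

Lemma energy_density_derive2 (r z : R) : 0 < r < 1 ->
  is_derive (energy_density r) z (energy_density2 r z).
Proof.
intros Hr; unfold energy_density, energy_density2.
assert (D : is_derive (fun t => w r t / r) z (D2 w r z / r)).
{ assert (H := strip_ex2 _ Sw r z ltac:(lra)).
  auto_derive; [exact H | unfold D2; field; lra]. }
destruct (entropy_comp_derive _ _ _ D) as [D' _].
eapply is_derive_eq; [apply (is_derive_scal _ _ r _ D') |].
field; lra.
Qed.

Lemma energy_density2_derive2 (r z : R) : 0 < r < 1 ->
  is_derive (energy_density2 r) z (energy_density22 r z).
Proof.
intros Hr; unfold energy_density2, energy_density22.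
assert (D : is_derive (fun t => w r t / r) z (D2 w r z / r)).
{ assert (H := strip_ex2 _ Sw r z ltac:(lra)).
  auto_derive; [exact H | unfold D2; field; lra]. }
destruct (entropy_comp_derive _ _ _ D) as [_ D'].
eapply is_derive_eq.
- apply (is_derive_mult _ (D2 w r) z _ _ D'
    (strip_is_derive2 _ r z (strip_D2 _ Sw) ltac:(lra)) Rmult_comm).
- unfold plus, mult; simpl; field; lra.
Qed.

Lemma flux_density_derive2 (r z : R) : 0 < r < 1 ->
  is_derive (flux_density r) z (flux_density2 r z).
Proof.
intros Hr; unfold flux_density, flux_density2.
eapply is_derive_eq.
- apply (is_derive_mult (c r) (energy_density r) z _ _
    (strip_is_derive2 _ r z Sc ltac:(lra)) (energy_density_derive2 r z Hr) Rmult_comm).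
- unfold plus, mult; simpl; unfold energy_density, energy_density2; ring.
Qed.

Lemma radial_flux_derive1 (r z : R) : 0 < r < 1 ->
  is_derive (fun s => radial_flux s z) r (radial_flux1 r z).
Proof.
intros Hr; unfold radial_flux.
assert (D := is_derive_over_r w r z Sw Hr).
destruct (entropy_comp_derive _ _ _ D) as [D0 D1']; cbv beta in D0, D1'.
assert (Da := strip_is_derive1 a r z Sa ltac:(lra)).
assert (Dw := strip_is_derive1 _ r z (strip_D1 _ Sw) ltac:(lra)).
eapply is_derive_eq.
- apply @is_derive_minus; [apply @is_derive_minus |].
  + eapply (is_derive_mult (fun s => s * a s z) (fun s => entropy (w s z / s)) r
             (plus (mult 1 (a r z)) (mult r (D1 a r z))) _); [| exact D0 | apply Rmult_comm].
    apply (is_derive_mult (fun s : R => s) (fun s => a s z) r _ _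
             (is_derive_id r) Da Rmult_comm).
  + apply (is_derive_mult (fun s => entropy' (w s z / s))
             (fun s => D1 w s z - w s z / s) r _ _ D1'
             (is_derive_minus (fun s => D1 w s z) (fun s => w s z / s) r _ _ Dw D)
             Rmult_comm).
  + eapply (is_derive_mult (fun s => 2 + s ^ 2) (fun s => entropy (w s z / s)) r
             (2 * r) _); [| exact D0 | apply Rmult_comm].
    auto_derive; [exact I | ring].
- unfold radial_flux1, minus, plus, opp, mult, one; simpl; ring.
Qed.

(** The transport equation times entropy'(w / r) expresses the axial derivatives
    as the radial derivative of the flux plus a dissipation.  The derivative of
    r ^ 2 h is 2 r h + r ^ 2 h' D1 Omega, and Young's inequality bounds the second
    term by r h plus the dissipation: this is the Poincare inequality. *)
Lemma energy_pointwise (r z : R) : 0 < r < 1 ->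
  radial_flux1 r z
  <= energy_density22 r z - flux_density2 r z - energy_density r z.
Proof.
intros Hr.
unfold radial_flux1, energy_density22, flux_density2, energy_density.
assert (T := transport r z Hr); assert (Dv := divergence_free r z Hr).
set (h := entropy (w r z / r)); set (h1 := entropy' (w r z / r)).
set (h2 := entropy'' (w r z / r)).
set (d := D1 w r z / r - w r z / r ^ 2).
assert (Ed : D1 w r z - w r z / r = r * d) by (unfold d; field; lra).
assert (E22 : D2 (D2 w) r z = a r z * r * d + c r z * D2 w r z - D1 (D1 w) r z - d).
{ unfold d in *.
  replace (a r z * r * (D1 w r z / r - w r z / r ^ 2)) with
    (a r z * D1 w r z - a r z / r * w r z) by (field; lra).
  lra. }
assert (Ec : D2 c r z = - D1 a r z - a r z / r) by lra.
rewrite E22, Ec, Ed.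
assert (h2pos : 0 <= h2) by apply entropy''_nonneg.
assert (hpos : 0 <= h) by apply entropy_nonneg.
assert (dis : 0 <= h2 * D2 w r z ^ 2 / r).
{ apply Rmult_le_pos; [| apply Rlt_le, Rinv_0_lt_compat; lra].
  apply Rmult_le_pos; [exact h2pos | apply pow2_ge_0]. }
(* Young's inequality, from h1 ^ 2 <= 4 h h2 *)
assert (young : - (r * h1 * d) <= h + h2 * d ^ 2).
{ apply Rle_trans with (Rabs (h1 * d)).
  - rewrite <- Rabs_Ropp.
    apply Rle_trans with (Rabs (- (r * (h1 * d)))).
    + replace (- (r * h1 * d)) with (- (r * (h1 * d))) by ring; apply Rle_abs.
    + rewrite !Rabs_Ropp, Rabs_mult, (Rabs_pos_eq r) by lra.
      assert (P := Rabs_pos (h1 * d)); nra.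
  - assert (K : 0 <= h + h2 * d ^ 2).
    { assert (0 <= h2 * d ^ 2) by (apply Rmult_le_pos; [exact h2pos | apply pow2_ge_0]).
      lra. }
    apply Rsqr_incr_0_var; [| exact K].
    rewrite <- Rsqr_abs; unfold Rsqr.
    assert (B : h1 ^ 2 <= 4 * h * h2) by apply entropy'_sqr.
    assert (0 <= d ^ 2) by apply pow2_ge_0.
    assert (h1 ^ 2 * d ^ 2 <= 4 * h * h2 * d ^ 2) by now apply Rmult_le_compat_r.
    assert (Q := pow2_ge_0 (h - h2 * d ^ 2)); nra. }
apply Rminus_le_0.
match goal with |- 0 <= ?x =>
  replace x with (h2 * D2 w r z ^ 2 / r + r * ((h + h2 * d ^ 2) + r * h1 * d))
    by (field; lra) end.
assert (0 <= r * ((h + h2 * d ^ 2) + r * h1 * d)) by (apply Rmult_le_pos; lra).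
lra.
Qed.

(** At the wall [a] and [w] are of order eps.  At the axis w / r is bounded and
    D1 w - w / r is of order eps, while the remaining term
    - (2 + r ^ 2) h is negative. *)
Lemma radial_flux_margin (Z : R) : exists K, forall eps z, 0 < eps < 1 / 2 ->
  Rabs z <= Z -> - K * eps <= radial_flux (1 - eps) z - radial_flux eps z.
Proof.
destruct (strip_bounded a Sa Z) as [B1 HB1].
destruct (axis_linear_bound w Z Sw axis_w0) as [B3 HB3].
destruct (wall_linear_bound a Z Sa wall_a0) as [B4 HB4].
destruct (wall_linear_bound w Z Sw wall_w0) as [B5 HB5].
destruct (strip_bounded _ (strip_D1 _ (strip_D1 _ Sw)) Z) as [B6 HB6].
set (B := Rmax (Rmax (Rmax B1 B3) (Rmax B4 B5)) (Rmax B6 1)).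
assert (L1 : B1 <= B) by
  (unfold B; apply Rle_trans with (2 := Rmax_l _ _), Rle_trans with (2 := Rmax_l _ _), Rmax_l).
assert (L3 : B3 <= B) by
  (unfold B; apply Rle_trans with (2 := Rmax_l _ _), Rle_trans with (2 := Rmax_l _ _), Rmax_r).
assert (L4 : B4 <= B) by
  (unfold B; apply Rle_trans with (2 := Rmax_l _ _), Rle_trans with (2 := Rmax_r _ _), Rmax_l).
assert (L5 : B5 <= B) by
  (unfold B; apply Rle_trans with (2 := Rmax_l _ _), Rle_trans with (2 := Rmax_r _ _), Rmax_r).
assert (L6 : B6 <= B) by (unfold B; apply Rle_trans with (2 := Rmax_r _ _), Rmax_l).
assert (L7 : 1 <= B) by (unfold B; apply Rle_trans with (2 := Rmax_r _ _), Rmax_r).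
clearbody B.
(* r D1 w - w vanishes at r = 0 and has derivative r D1 D1 w *)
assert (cone : forall r z, 0 < r < 1 -> Rabs z <= Z ->
  Rabs (D1 w r z - w r z / r) <= B * r).
{ intros r z Hr Hz.
  assert (I : Rabs (r * D1 w r z - w r z - (0 * D1 w 0 z - w 0 z)) <= B * r * (r - 0)).
  { apply (is_derive_increment_le (fun s => s * D1 w s z - w s z)
             (fun s => s * D1 (D1 w) s z)); [lra | |].
    - intros s Hs.
      assert (H1 := strip_ex1 _ Sw s z ltac:(lra)).
      assert (H2 := strip_ex1 _ (strip_D1 _ Sw) s z ltac:(lra)).
      auto_derive; [now repeat split | unfold D1; ring].
    - intros s Hs; rewrite Rabs_mult, (Rabs_pos_eq s) by lra.
      assert (X := HB6 s z ltac:(lra) Hz).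
      assert (P := Rabs_pos (D1 (D1 w) s z)); nra. }
  rewrite axis_w0 in I.
  replace (r * D1 w r z - w r z - (0 * D1 w 0 z - 0))
    with (r * (D1 w r z - w r z / r)) in I by (field; lra).
  rewrite Rabs_mult, (Rabs_pos_eq r) in I by lra.
  apply Rmult_le_reg_l with r; lra. }
exists (40 * B ^ 3); intros eps z He Hz.
assert (B2 : B <= B ^ 2) by nra.
assert (B3' : B ^ 2 <= B ^ 3) by (simpl; nra).
assert (Hq : forall r s, 0 < r < 1 -> Rabs (w r z) <= s * r -> Rabs (w r z / r) <= s).
{ intros r s Hr H; unfold Rdiv; rewrite Rabs_mult, (Rabs_pos_eq (/ r)).
  - apply Rmult_le_reg_r with r; [lra |]; rewrite Rmult_assoc, Rinv_l; lra.
  - apply Rlt_le, Rinv_0_lt_compat; lra. }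
assert (sqr : forall x s, Rabs x <= s -> x ^ 2 <= s ^ 2).
{ intros x s H; rewrite <- (pow2_abs x); apply pow_incr; split; [apply Rabs_pos | exact H]. }
assert (up : - (30 * B ^ 3) * eps <= radial_flux (1 - eps) z).
{ unfold radial_flux; set (r := 1 - eps) in *.
  assert (Hr : 0 < r < 1) by (unfold r; lra).
  assert (Qw : Rabs (w r z / r) <= 2 * B * eps).
  { apply Hq; [exact Hr |]; apply Rle_trans with (1 := HB5 r z Hr Hz).
    replace (1 - r) with eps by (unfold r; ring).
    assert (1 <= 2 * r) by (unfold r; lra).
    replace (2 * B * eps * r) with (B * eps * (2 * r)) by ring.
    assert (0 < B * eps) by (apply Rmult_lt_0_compat; lra). nra. }
  assert (h0 := entropy_nonneg (w r z / r)); assert (h1 := entropy_le_sqr (w r z / r)).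
  assert (h2 := entropy'_bound (w r z / r)); assert (h3 := sqr _ _ Qw).
  assert (Ca := HB1 r z ltac:(lra) Hz); assert (Cc := cone r z Hr Hz).
  set (h := entropy (w r z / r)) in *; set (h' := entropy' (w r z / r)) in *.
  set (k := D1 w r z - w r z / r) in *.
  assert (hb : h <= 4 * B ^ 2 * eps ^ 2) by (apply Rle_trans with (1 := h1); nra).
  assert (hb' : h <= 2 * B ^ 2 * eps).
  { apply Rle_trans with (1 := hb).
    assert (0 < B ^ 2 * eps) by (apply Rmult_lt_0_compat; nra). nra. }
  assert (P1 : Rabs (r * a r z * h) <= B * (2 * B ^ 2 * eps)).
  { rewrite !Rabs_mult, (Rabs_pos_eq r), (Rabs_pos_eq h) by lra.
    apply Rmult_le_compat; [| exact h0 | | exact hb'].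
    - apply Rmult_le_pos; [lra | apply Rabs_pos].
    - assert (P := Rabs_pos (a r z)); nra. }
  assert (P2 : Rabs (h' * k) <= (4 * B * eps) * B).
  { rewrite Rabs_mult; apply Rmult_le_compat; try apply Rabs_pos; [lra |].
    apply Rle_trans with (1 := Cc); nra. }
  assert (P3 : (2 + r ^ 2) * h <= 3 * (2 * B ^ 2 * eps)).
  { apply Rmult_le_compat; [nra | exact h0 | nra | exact hb']. }
  assert (eps * B ^ 2 <= eps * B ^ 3) by (apply Rmult_le_compat_l; lra).
  replace (B * (2 * B ^ 2 * eps)) with (2 * (eps * B ^ 3)) in P1 by ring.
  replace (4 * B * eps * B) with (4 * (eps * B ^ 2)) in P2 by ring.
  replace (3 * (2 * B ^ 2 * eps)) with (6 * (eps * B ^ 2)) in P3 by ring.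
  replace (- (30 * B ^ 3) * eps) with (- 30 * (eps * B ^ 3)) by ring.
  assert (0 <= eps * B ^ 3) by (apply Rmult_le_pos; nra).
  apply Rabs_le_between in P1; apply Rabs_le_between in P2; lra. }
(* at the axis the entropy term has a favourable sign *)
assert (lo : radial_flux eps z <= 10 * B ^ 3 * eps).
{ unfold radial_flux; set (r := eps) in *.
  assert (Hr : 0 < r < 1) by lra.
  assert (Qw : Rabs (w r z / r) <= B).
  { apply Hq; [exact Hr |]; apply Rle_trans with (1 := HB3 r z Hr Hz); nra. }
  assert (h0 := entropy_nonneg (w r z / r)); assert (h1 := entropy_le_sqr (w r z / r)).
  assert (h2 := entropy'_bound (w r z / r)); assert (h3 := sqr _ _ Qw).
  assert (Ca := HB1 r z ltac:(lra) Hz); assert (Cc := cone r z Hr Hz).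
  set (h := entropy (w r z / r)) in *; set (h' := entropy' (w r z / r)) in *.
  set (k := D1 w r z - w r z / r) in *.
  assert (P1 : Rabs (r * a r z * h) <= (r * B) * B ^ 2).
  { rewrite !Rabs_mult, (Rabs_pos_eq r), (Rabs_pos_eq h) by lra.
    apply Rmult_le_compat; [| exact h0 | | lra].
    - apply Rmult_le_pos; [lra | apply Rabs_pos].
    - apply Rmult_le_compat_l; lra. }
  assert (P2 : Rabs (h' * k) <= (2 * B) * (B * r)).
  { rewrite Rabs_mult; apply Rmult_le_compat; try apply Rabs_pos; lra. }
  assert (P3 : 0 <= (2 + r ^ 2) * h) by (apply Rmult_le_pos; nra).
  assert (r * B ^ 2 <= r * B ^ 3) by (apply Rmult_le_compat_l; lra).
  replace (r * B * B ^ 2) with (r * B ^ 3) in P1 by ring.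
  replace (2 * B * (B * r)) with (2 * (r * B ^ 2)) in P2 by ring.
  replace (10 * B ^ 3 * r) with (10 * (r * B ^ 3)) by ring.
  assert (0 <= r * B ^ 3) by (apply Rmult_le_pos; nra).
  apply Rabs_le_between in P1; apply Rabs_le_between in P2; lra. }
lra.
Qed.

Lemma vorticity_over_r_continuous (r z : R) : 0 < r < 1 ->
  continuous2 (fun r z => w r z / r) r z.
Proof.
intros Hr; unfold continuous2, Rdiv.
apply (continuous_mult (fun p : R * R => w (fst p) (snd p)) (fun p => / fst p)).
- apply (strip_cont w Sw); lra.
- apply (continuous_comp fst Rinv); [apply continuous_fst |].
  apply continuity_pt_filterlim, continuity_pt_inv;
    [apply derivable_continuous_pt, derivable_pt_id | simpl; lra].
Qed.

Lemma densities_continuous (r z : R) : 0 < r < 1 ->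
  continuous2 energy_density r z /\ continuous2 energy_density2 r z /\
  continuous2 energy_density22 r z /\ continuous2 flux_density r z /\
  continuous2 flux_density2 r z.
Proof.
intros Hr.
assert (Hr' : -1 < r < 1) by lra.
assert (Q := vorticity_over_r_continuous r z Hr); unfold continuous2 in *.
destruct (entropy_continuous (w r z / r)) as [c0 [c1 c2]].
assert (Q0 : continuous (fun p : R * R => entropy (w (fst p) (snd p) / fst p)) (r, z))
  by now apply (continuous_comp (fun p : R * R => w (fst p) (snd p) / fst p) entropy).
assert (Q1 : continuous (fun p : R * R => entropy' (w (fst p) (snd p) / fst p)) (r, z))
  by now apply (continuous_comp (fun p : R * R => w (fst p) (snd p) / fst p) entropy').
assert (Q2 : continuous (fun p : R * R => entropy'' (w (fst p) (snd p) / fst p)) (r, z))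
  by now apply (continuous_comp (fun p : R * R => w (fst p) (snd p) / fst p) entropy'').
assert (C := strip_cont c Sc r z Hr').
assert (C2 := strip_cont _ (strip_D2 _ Sc) r z Hr').
assert (W2 := strip_cont _ (strip_D2 _ Sw) r z Hr').
assert (W22 := strip_cont _ (strip_D2 _ (strip_D2 _ Sw)) r z Hr').
assert (F : continuous (fun p : R * R => fst p) (r, z)) by apply continuous_fst.
assert (Fi : continuous (fun p : R * R => / fst p) (r, z)).
{ apply (continuous_comp fst Rinv); [exact F |].
  apply continuity_pt_filterlim, continuity_pt_inv;
    [apply derivable_continuous_pt, derivable_pt_id | simpl; lra]. }
unfold continuous2 in *.
assert (E0 : continuous (fun p : R * R => energy_density (fst p) (snd p)) (r, z))
  by apply (continuous_mult _ _ _ F Q0).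
assert (E2 : continuous (fun p : R * R => energy_density2 (fst p) (snd p)) (r, z))
  by apply (continuous_mult _ _ _ Q1 W2).
repeat split; [exact E0 | exact E2 | | |].
- apply @continuous_plus; [| apply (continuous_mult _ _ _ Q1 W22)].
  apply (continuous_mult
    (fun p : R * R => entropy'' (w (fst p) (snd p) / fst p) * D2 w (fst p) (snd p) ^ 2)
    (fun p : R * R => / fst p)); [| exact Fi].
  apply (continuous_mult (fun p : R * R => entropy'' (w (fst p) (snd p) / fst p))
    (fun p : R * R => D2 w (fst p) (snd p) ^ 2)); [exact Q2 |].
  apply (continuous_ext (fun p : R * R => mult (D2 w (fst p) (snd p)) (D2 w (fst p) (snd p)))).
  + intros p; unfold mult; simpl; ring.
  + apply (continuous_mult _ _ _ W2 W2).
- apply (continuous_mult _ _ _ C E0).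
- apply @continuous_plus; [apply (continuous_mult _ _ _ C2 E0) |].
  apply (continuous_mult _ _ _ C E2).
Qed.

Lemma energy_density_continuous (r z : R) : 0 < r < 1 ->
  continuous2 energy_density r z.
Proof. intros Hr; exact (proj1 (densities_continuous r z Hr)). Qed.

Lemma energy_density2_continuous (r z : R) : 0 < r < 1 ->
  continuous2 energy_density2 r z.
Proof. intros Hr; exact (proj1 (proj2 (densities_continuous r z Hr))). Qed.

Lemma energy_density22_continuous (r z : R) : 0 < r < 1 ->
  continuous2 energy_density22 r z.
Proof. intros Hr; exact (proj1 (proj2 (proj2 (densities_continuous r z Hr)))). Qed.

Lemma flux_density_continuous (r z : R) : 0 < r < 1 ->
  continuous2 flux_density r z.
Proof. intros Hr; exact (proj1 (proj2 (proj2 (proj2 (densities_continuous r z Hr))))). Qed.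

Lemma flux_density2_continuous (r z : R) : 0 < r < 1 ->
  continuous2 flux_density2 r z.
Proof. intros Hr; exact (proj2 (proj2 (proj2 (proj2 (densities_continuous r z Hr))))). Qed.

Lemma section_continuous (f : R -> R -> R) (r z : R) : continuous2 f r z ->
  continuous (fun s => f s z) r.
Proof.
intros H; apply (continuous_comp_2 (fun s => s) (fun _ => z) f);
  [apply continuous_id | apply continuous_const | exact H].
Qed.

Definition energy (eps z : R) : R := RInt (fun r => energy_density r z) eps (1 - eps).
Definition energy2 (eps z : R) : R := RInt (fun r => energy_density2 r z) eps (1 - eps).
Definition energy22 (eps z : R) : R := RInt (fun r => energy_density22 r z) eps (1 - eps).
Definition flux (eps z : R) : R := RInt (fun r => flux_density r z) eps (1 - eps).
Definition flux2 (eps z : R) : R := RInt (fun r => flux_density2 r z) eps (1 - eps).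

Lemma energy_derive (eps z : R) : 0 < eps < 1 / 2 ->
  is_derive (energy eps) z (energy2 eps z).
Proof.
intros He.
apply (is_derive_integral energy_density energy_density2 0 eps (1 - eps) 1); try lra;
  intros; [now apply energy_density_derive2 | now apply energy_density_continuous
    | now apply energy_density2_continuous].
Qed.

Lemma energy2_derive (eps z : R) : 0 < eps < 1 / 2 ->
  is_derive (energy2 eps) z (energy22 eps z).
Proof.
intros He.
apply (is_derive_integral energy_density2 energy_density22 0 eps (1 - eps) 1); try lra;
  intros; [now apply energy_density2_derive2 | now apply energy_density2_continuous
    | now apply energy_density22_continuous].
Qed.

Lemma flux_derive (eps z : R) : 0 < eps < 1 / 2 ->
  is_derive (flux eps) z (flux2 eps z).
Proof.
intros He.
apply (is_derive_integral flux_density flux_density2 0 eps (1 - eps) 1); try lra;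
  intros; [now apply flux_density_derive2 | now apply flux_density_continuous
    | now apply flux_density2_continuous].
Qed.

Lemma ex_RInt_section (f : R -> R -> R) (x y z : R) : 0 < x -> x <= y -> y < 1 ->
  (forall r, 0 < r < 1 -> continuous2 f r z) -> ex_RInt (fun r => f r z) x y.
Proof.
intros Hx xy Hy H; apply @ex_RInt_continuous; rewrite Rmin_left, Rmax_right by lra.
intros r Hr; apply section_continuous, H; lra.
Qed.

Lemma energy_inequality (Z : R) : exists K, 0 <= K /\ forall eps z,
  0 < eps < 1 / 2 -> Rabs z <= Z ->
  energy eps z - K * eps <= energy22 eps z - flux2 eps z.
Proof.
destruct (radial_flux_margin Z) as [K HK].
exists (Rabs K); split; [apply Rabs_pos |]; intros eps z He Hz.
assert (I := increment_le_RInt (fun r => radial_flux r z) (fun r => radial_flux1 r z)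
  (fun r => energy_density22 r z - flux_density2 r z - energy_density r z)
  eps (1 - eps)).
assert (I' : radial_flux (1 - eps) z - radial_flux eps z
  <= RInt (fun r => energy_density22 r z - flux_density2 r z - energy_density r z)
       eps (1 - eps)).
{ apply I; [lra | | |].
  - intros r Hr; apply radial_flux_derive1; lra.
  - intros r Hr.
    destruct (densities_continuous r z ltac:(lra)) as [C0 [_ [C22 [_ CF]]]].
    apply @continuous_minus; [apply @continuous_minus |];
      now apply section_continuous.
  - intros r Hr; apply energy_pointwise; lra. }
assert (X0 : ex_RInt (fun r => energy_density r z) eps (1 - eps)).
{ apply ex_RInt_section; try lra; exact (fun r => energy_density_continuous r z). }
assert (X22 : ex_RInt (fun r => energy_density22 r z) eps (1 - eps)).
{ apply ex_RInt_section; try lra; exact (fun r => energy_density22_continuous r z). }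
assert (XF : ex_RInt (fun r => flux_density2 r z) eps (1 - eps)).
{ apply ex_RInt_section; try lra; exact (fun r => flux_density2_continuous r z). }
assert (E : RInt (fun r => energy_density22 r z - flux_density2 r z - energy_density r z)
    eps (1 - eps) = energy22 eps z - flux2 eps z - energy eps z).
{ transitivity (RInt (fun r => energy_density22 r z - flux_density2 r z) eps (1 - eps)
                - energy eps z).
  - apply (RInt_minus (fun r => energy_density22 r z - flux_density2 r z)
             (fun r => energy_density r z)); [now apply @ex_RInt_minus | exact X0].
  - apply (f_equal (fun x => x - energy eps z)).
    now apply (RInt_minus (fun r => energy_density22 r z) (fun r => flux_density2 r z)). }
specialize (HK eps z He Hz).
assert (K * eps <= Rabs K * eps) by (apply Rmult_le_compat_r; [lra | apply Rle_abs]).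
lra.
Qed.

Lemma energy_density_nonneg (r z : R) : 0 < r -> 0 <= energy_density r z.
Proof. intros; apply Rmult_le_pos; [lra | apply entropy_nonneg]. Qed.

Lemma energy_monotone (eps eps0 z : R) : 0 < eps <= eps0 -> eps0 < 1 / 2 ->
  0 <= energy eps0 z <= energy eps z.
Proof.
intros He H0.
assert (X : forall x y, 0 < x -> x <= y -> y < 1 ->
  ex_RInt (fun r => energy_density r z) x y).
{ intros; apply ex_RInt_section; auto; intros; now apply energy_density_continuous. }
assert (N : forall x y, 0 < x -> x <= y -> y < 1 ->
  0 <= RInt (fun r => energy_density r z) x y).
{ intros x y Hx xy Hy; apply RInt_ge_0; [exact xy | now apply X |].
  intros; apply energy_density_nonneg; lra. }
split; [apply N; lra |]; unfold energy.
rewrite <- (RInt_Chasles _ eps eps0 (1 - eps)) by (apply X; lra).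
rewrite <- (RInt_Chasles _ eps0 (1 - eps0) (1 - eps)) by (apply X; lra).
assert (N1 := N eps eps0); assert (N2 := N (1 - eps0) (1 - eps)).
unfold plus; simpl; lra.
Qed.

Lemma energy_bound (eps z M : R) : 0 < eps < 1 / 2 -> 1 <= M ->
  (forall r, 0 < r < 1 -> Rabs (w r z) <= M) -> energy eps z <= 6 * M ^ 2.
Proof.
intros He HM Hw; unfold energy.
apply Rle_trans with (6 * M ^ 2 * sqrt (1 - eps) - 6 * M ^ 2 * sqrt eps).
- apply (RInt_le_increment (fun r => 6 * M ^ 2 * sqrt r) (fun r => 3 * M ^ 2 / sqrt r));
    [lra | | |].
  + intros r Hr; assert (P : 0 < sqrt r) by (apply sqrt_lt_R0; lra).
    auto_derive; [lra | field; lra].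
  + intros r Hr; apply section_continuous, energy_density_continuous; lra.
  + intros r Hr; apply entropy_over_r_bound; [exact HM | apply Hw; lra | lra].
- assert (P : 0 <= sqrt eps) by apply sqrt_pos.
  assert (P' : sqrt (1 - eps) <= 1) by (rewrite <- sqrt_1 at 2; apply sqrt_le_1_alt; lra).
  assert (P2 : 0 <= 6 * M ^ 2) by nra.
  assert (P3 := Rmult_le_pos _ _ P2 P).
  assert (P4 := Rmult_le_compat_l _ _ _ P2 P'); lra.
Qed.

Lemma flux_bound (eps z A : R) : 0 < eps < 1 / 2 ->
  (forall r, 0 < r < 1 -> Rabs (c r z) <= A) ->
  Rabs (flux eps z) <= A * energy eps z.
Proof.
intros He Hc; unfold flux, energy.
assert (X : ex_RInt (fun r => energy_density r z) eps (1 - eps)).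
{ apply ex_RInt_section; try lra; intros; now apply energy_density_continuous. }
assert (Y : ex_RInt (fun r => flux_density r z) eps (1 - eps)).
{ apply ex_RInt_section; try lra; intros; now apply flux_density_continuous. }
assert (XA : ex_RInt (fun r => scal A (energy_density r z)) eps (1 - eps))
  by now apply @ex_RInt_scal.
assert (E : A * RInt (fun r => energy_density r z) eps (1 - eps)
  = RInt (fun r => scal A (energy_density r z)) eps (1 - eps)).
{ symmetry; now apply (@RInt_scal R_CompleteNormedModule). }
rewrite E.
apply Rle_trans with (RInt (fun r => Rabs (flux_density r z)) eps (1 - eps)).
- apply abs_RInt_le; [lra | exact Y].
- apply RInt_le; [lra | now apply @ex_RInt_norm | exact XA |].
  intros r Hr; change (Rabs (flux_density r z) <= A * energy_density r z).
  unfold flux_density; fold (energy_density r z).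
  rewrite Rabs_mult, (Rabs_pos_eq (energy_density r z)) by (apply energy_density_nonneg; lra).
  apply Rmult_le_compat_r; [apply energy_density_nonneg; lra | apply Hc; lra].
Qed.

Lemma vorticity_zero_of_energy (r z : R) : 0 < r < 1 ->
  (forall eps, 0 < eps < 1 / 2 -> energy eps z = 0) -> w r z = 0.
Proof.
intros Hr H.
assert (C : continuous (fun s => energy_density s z) r)
  by apply section_continuous, energy_density_continuous, Hr.
apply NNPP; intros Nw.
assert (Hp : 0 < energy_density r z).
{ destruct (energy_density_nonneg r z ltac:(lra)) as [P | E]; [exact P | exfalso].
  symmetry in E; apply Rmult_integral in E; destruct E as [E | E]; [lra |].
  apply entropy_eq_0 in E; apply Nw.
  replace (w r z) with (w r z / r * r) by (field; lra); rewrite E; ring. }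
set (p := energy_density r z) in *.
assert (Hp2 : 0 < p / 2) by lra.
destruct (proj1 (filterlim_locally _ _) C (mkposreal _ Hp2)) as [d Hd].
set (e := Rmin d (Rmin r (1 - r)) / 2).
assert (m1 := Rmin_l d (Rmin r (1 - r))); assert (m2 := Rmin_r d (Rmin r (1 - r))).
assert (m3 := Rmin_l r (1 - r)); assert (m4 := Rmin_r r (1 - r)).
assert (m5 : 0 < Rmin d (Rmin r (1 - r))).
{ apply Rmin_pos; [apply cond_pos | apply Rmin_pos; lra]. }
assert (X : forall x y, 0 < x -> x <= y -> y < 1 ->
  ex_RInt (fun r => energy_density r z) x y).
{ intros; apply ex_RInt_section; auto; intros; now apply energy_density_continuous. }
assert (N : forall x y, 0 < x -> x <= y -> y < 1 ->
  0 <= RInt (fun r => energy_density r z) x y).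
{ intros x y Hx xy Hy; apply RInt_ge_0; [exact xy | now apply X |].
  intros; apply energy_density_nonneg; lra. }
set (eps := Rmin (1 / 4) (Rmin ((r - e)) ((1 - (r + e))))).
assert (k1 := Rmin_l (1 / 4) (Rmin ((r - e)) ((1 - (r + e))))).
assert (k2 := Rmin_r (1 / 4) (Rmin ((r - e)) ((1 - (r + e))))).
assert (k3 := Rmin_l ((r - e)) ((1 - (r + e)))).
assert (k4 := Rmin_r ((r - e)) ((1 - (r + e)))).
assert (k5 : 0 < eps).
{ unfold eps; apply Rmin_pos; [lra | apply Rmin_pos; unfold e; lra]. }
fold eps in k1, k2.
assert (E := H eps ltac:(lra)); unfold energy in E.
assert (He : 0 < e) by (unfold e; lra).
rewrite <- (RInt_Chasles _ eps (r - e) (1 - eps)) in E by (apply X; lra).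
rewrite <- (RInt_Chasles _ (r - e) (r + e) (1 - eps)) in E by (apply X; lra).
assert (N1 := N eps (r - e) k5 ltac:(lra) ltac:(lra)).
assert (N2 := N (r + e) (1 - eps) ltac:(lra) ltac:(lra) ltac:(lra)).
assert (I : p / 2 * (r + e) - p / 2 * (r - e)
  <= RInt (fun r => energy_density r z) (r - e) (r + e)).
{ apply (increment_le_RInt (fun s => p / 2 * s) (fun _ => p / 2)); [lra | | |].
  - intros s Hs; auto_derive; [exact I | ring].
  - intros s Hs; apply section_continuous, energy_density_continuous; lra.
  - intros s Hs.
    assert (B : ball r d s).
    { change (Rabs (s - r) < d); apply Rabs_lt_between; unfold e in Hs; lra. }
    specialize (Hd s B); change (Rabs (energy_density s z - p) < p / 2) in Hd.
    apply Rabs_lt_between in Hd; lra. }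
unfold plus in E; simpl in E.
assert (0 < p * e) by now apply Rmult_lt_0_compat.
lra.
Qed.

End Energy.

(** * The axial weight *)

(** (1 + z ^ 2) ^ e *)
Definition bracket_pow (e z : R) : R := exp (e * ln (1 + z ^ 2)).

Definition bracket_pow1 (e z : R) : R :=
  bracket_pow e z * (2 * e * z / (1 + z ^ 2)).
Definition bracket_pow2 (e z : R) : R :=
  bracket_pow e z * (4 * e ^ 2 * z ^ 2 / (1 + z ^ 2) ^ 2
    + 2 * e / (1 + z ^ 2) - 4 * e * z ^ 2 / (1 + z ^ 2) ^ 2).

Lemma bracket_pos (z : R) : 1 <= 1 + z ^ 2.
Proof. assert (H := pow2_ge_0 z); lra. Qed.

Lemma ln_bracket_nonneg (z : R) : 0 <= ln (1 + z ^ 2).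
Proof. rewrite <- ln_1; apply ln_le; [lra | apply bracket_pos]. Qed.

Lemma bracket_pow_derive (e z : R) :
  is_derive (bracket_pow e) z (bracket_pow1 e z).
Proof.
assert (H := bracket_pos z); unfold bracket_pow1, bracket_pow; auto_derive.
- simpl in H; lra.
- replace (z * (z * 1)) with (z ^ 2) by ring; field; lra.
Qed.

Lemma bracket_pow1_derive (e z : R) :
  is_derive (bracket_pow1 e) z (bracket_pow2 e z).
Proof.
assert (H := bracket_pos z); unfold bracket_pow1.
eapply is_derive_eq.
- eapply (is_derive_mult (bracket_pow e) (fun z => 2 * e * z / (1 + z ^ 2)) z);
    [apply bracket_pow_derive | | apply Rmult_comm].
  auto_derive; [simpl in H; lra | reflexivity].
- unfold bracket_pow1, bracket_pow2, plus, mult; simpl; field; simpl in H; lra.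
Qed.

Lemma bracket_pow_ge_1 (e z : R) : 0 <= e -> 1 <= bracket_pow e z.
Proof.
intros He; unfold bracket_pow; rewrite <- exp_0 at 1.
assert (H := ln_bracket_nonneg z).
destruct (Rle_lt_or_eq_dec 0 (e * ln (1 + z ^ 2))) as [lt | <-];
  [now apply Rmult_le_pos | now apply Rlt_le, exp_increasing | lra].
Qed.

Lemma bracket_pow_bounds (e z : R) : 0 < e <= 1 / 2 ->
  Rabs (bracket_pow1 e z) * bracket_pow (1 / 2 - e) z <= 1 /\
  Rabs (bracket_pow1 e z) <= 1 /\ - 2 <= bracket_pow2 e z.
Proof.
intros He.
assert (y1 := bracket_pos z).
set (g := bracket_pow e z); set (q := bracket_pow (1 / 2 - e) z).
assert (g1 : 1 <= g) by (apply bracket_pow_ge_1; lra).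
assert (q1 : 1 <= q) by (apply bracket_pow_ge_1; lra).
set (s := g * q).
assert (s2 : s * s = 1 + z ^ 2).
{ unfold s, g, q, bracket_pow; rewrite <- !exp_plus.
  replace (_ + _) with (ln (1 + z ^ 2)) by field; apply exp_ln; lra. }
assert (s1 : 1 <= s) by (unfold s; nra).
assert (zs : Rabs z <= s).
{ apply Rsqr_incr_0_var; [| lra]; rewrite <- Rsqr_abs; unfold Rsqr; lra. }
assert (gs : g <= s) by (unfold s; nra).
assert (B : Rabs (bracket_pow1 e z) * q <= 1).
{ unfold bracket_pow1; fold g; rewrite Rabs_mult, (Rabs_pos_eq g) by lra.
  replace (g * Rabs (2 * e * z / (1 + z ^ 2)) * q)
    with (s * Rabs (2 * e * z / (1 + z ^ 2))) by (unfold s; ring).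
  unfold Rdiv; rewrite !Rabs_mult, (Rabs_pos_eq 2), (Rabs_pos_eq e) by lra.
  rewrite (Rabs_pos_eq (/ (1 + z ^ 2))) by (apply Rlt_le, Rinv_0_lt_compat; lra).
  rewrite <- s2.
  replace (s * (2 * e * Rabs z * / (s * s))) with (2 * e * Rabs z / s) by (field; lra).
  apply Rmult_le_reg_r with s; [lra |].
  replace (2 * e * Rabs z / s * s) with (2 * e * Rabs z) by (field; lra).
  assert (P := Rabs_pos z); nra. }
repeat split; [exact B | |].
- assert (P := Rabs_pos (bracket_pow1 e z)); nra.
- unfold bracket_pow2; fold g; rewrite <- s2.
  set (x := 4 * e ^ 2 * z ^ 2 / (s * s) ^ 2 + 2 * e / (s * s)).
  assert (x0 : 0 <= x).
  { apply Rplus_le_le_0_compat; apply Rmult_le_pos;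
      try (apply Rlt_le, Rinv_0_lt_compat; nra); nra. }
  assert (v : 4 * e * z ^ 2 / (s * s) ^ 2 * s <= 2).
  { replace (4 * e * z ^ 2 / (s * s) ^ 2 * s) with (4 * e * z ^ 2 / (s * s * s))
      by (field; lra).
    apply Rmult_le_reg_r with (s * s * s); [nra |].
    replace (4 * e * z ^ 2 / (s * s * s) * (s * s * s)) with (4 * e * z ^ 2)
      by (field; lra).
    assert (0 <= z ^ 2) by apply pow2_ge_0.
    assert (s * s <= s * s * s) by nra. nra. }
  assert (v0 : 0 <= 4 * e * z ^ 2 / (s * s) ^ 2).
  { apply Rmult_le_pos; [assert (0 <= z ^ 2) by apply pow2_ge_0; nra |].
    apply Rlt_le, Rinv_0_lt_compat; nra. }
  fold x.
  assert (g * (4 * e * z ^ 2 / (s * s) ^ 2) <= s * (4 * e * z ^ 2 / (s * s) ^ 2))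
    by (apply Rmult_le_compat_r; lra).
  assert (0 <= g * x) by (apply Rmult_le_pos; lra).
  lra.
Qed.

(** The exponent [e] is such that the drift (1 + z ^ 2) ^ (1 / 2 - e) times the
    derivative of (1 + z ^ 2) ^ e is bounded: so for small [kappa] this weight
    absorbs the drift, and still it decays faster than any power. *)
Definition weight (kappa e z : R) : R := exp (- kappa * bracket_pow e z).
Definition weight1 (kappa e z : R) : R := - kappa * bracket_pow1 e z * weight kappa e z.
Definition weight2 (kappa e z : R) : R :=
  (kappa ^ 2 * bracket_pow1 e z ^ 2 - kappa * bracket_pow2 e z) * weight kappa e z.

Lemma weight_derive (kappa e z : R) :
  is_derive (weight kappa e) z (weight1 kappa e z).
Proof.
assert (D := bracket_pow_derive e z).
assert (X : ex_derive (bracket_pow e) z) by (eexists; exact D).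
unfold weight1, weight; auto_derive; [exact X |].
replace (Derive (fun x => bracket_pow e x) z) with (bracket_pow1 e z)
  by (symmetry; apply is_derive_unique, D); ring.
Qed.

Lemma weight1_derive (kappa e z : R) :
  is_derive (weight1 kappa e) z (weight2 kappa e z).
Proof.
unfold weight1.
eapply is_derive_eq.
- apply (is_derive_mult (fun z => - kappa * bracket_pow1 e z) (weight kappa e) z
    (- kappa * bracket_pow2 e z) (weight1 kappa e z)); [| | apply Rmult_comm].
  + apply (is_derive_scal (bracket_pow1 e)), bracket_pow1_derive.
  + apply weight_derive.
- unfold weight2, weight1, plus, mult; simpl; ring.
Qed.

Lemma weight_inequalities (A e z : R) : 0 <= A -> 0 < e <= 1 / 2 ->
  let kappa := / (2 * (A + 3)) in
  Rabs (weight1 kappa e z) <= weight kappa e z /\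
  weight2 kappa e z + A * bracket_pow (1 / 2 - e) z * Rabs (weight1 kappa e z)
  <= weight kappa e z / 2.
Proof.
intros HA He kappa.
assert (k0 : 0 < kappa) by (apply Rinv_0_lt_compat; lra).
assert (kA : kappa * (A + 3) = 1 / 2) by (unfold kappa; field; lra).
assert (k1 : kappa <= 1) by nra.
destruct (bracket_pow_bounds e z He) as [B1 [B2 B3]].
assert (W : 0 < weight kappa e z) by apply exp_pos.
assert (E : Rabs (weight1 kappa e z)
  = kappa * Rabs (bracket_pow1 e z) * weight kappa e z).
{ unfold weight1; rewrite !Rabs_mult, Rabs_Ropp, (Rabs_pos_eq kappa),
    (Rabs_pos_eq (weight kappa e z)) by lra; reflexivity. }
assert (P := Rabs_pos (bracket_pow1 e z)).
rewrite E; split.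
- rewrite <- (Rmult_1_l (weight kappa e z)) at 2.
  apply Rmult_le_compat_r; [lra | nra].
- unfold weight2.
  replace (A * bracket_pow (1 / 2 - e) z *
    (kappa * Rabs (bracket_pow1 e z) * weight kappa e z)) with
    (A * kappa * (Rabs (bracket_pow1 e z) * bracket_pow (1 / 2 - e) z)
     * weight kappa e z) by ring.
  rewrite <- Rmult_plus_distr_r.
  replace (weight kappa e z / 2) with (1 / 2 * weight kappa e z) by field.
  apply Rmult_le_compat_r; [lra |].
  assert (Sq : bracket_pow1 e z ^ 2 <= 1).
  { rewrite <- (pow2_abs (bracket_pow1 e z)); simpl; nra. }
  assert (A * kappa * (Rabs (bracket_pow1 e z) * bracket_pow (1 / 2 - e) z) <= A * kappa * 1).
  { apply Rmult_le_compat_l; [apply Rmult_le_pos; lra | exact B1]. }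
  assert (kappa ^ 2 * bracket_pow1 e z ^ 2 <= kappa * 1).
  { apply Rmult_le_compat; [nra | nra | nra | exact Sq]. }
  nra.
Qed.

Lemma bracket_pow_le (e x y : R) : 0 <= e -> Rabs x <= Rabs y ->
  bracket_pow e x <= bracket_pow e y.
Proof.
intros He H.
assert (S : x ^ 2 <= y ^ 2).
{ rewrite <- (pow2_abs x), <- (pow2_abs y); apply pow_incr; split;
    [apply Rabs_pos | exact H]. }
assert (L : e * ln (1 + x ^ 2) <= e * ln (1 + y ^ 2)).
{ apply Rmult_le_compat_l; [exact He |]; apply ln_le; [| lra].
  assert (B := bracket_pos x); lra. }
unfold bracket_pow; destruct L as [L | L]; [now apply Rlt_le, exp_increasing |].
rewrite L; lra.
Qed.

Lemma weight_le (kappa e x y : R) : 0 <= kappa -> 0 <= e -> Rabs x <= Rabs y ->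
  weight kappa e y <= weight kappa e x <= 1.
Proof.
intros Hk He H; assert (B := bracket_pow_le e x y He H).
assert (X : forall a b, a <= b -> exp a <= exp b).
{ intros a b [L | ->]; [now apply Rlt_le, exp_increasing | lra]. }
unfold weight; split.
- apply X; nra.
- rewrite <- exp_0; apply X.
  assert (P := bracket_pow_ge_1 e x He); nra.
Qed.

Lemma weight_lt (kappa e x y : R) : 0 < kappa -> 0 < e -> Rabs x < Rabs y ->
  weight kappa e y < weight kappa e x.
Proof.
intros Hk He H.
assert (P := Rabs_pos x).
assert (S : x ^ 2 < y ^ 2).
{ rewrite <- (pow2_abs x), <- (pow2_abs y); nra. }
unfold weight; apply exp_increasing.
assert (bracket_pow e x < bracket_pow e y); [| nra].
apply exp_increasing, Rmult_lt_compat_l; [exact He |].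
apply ln_increasing; [assert (B := bracket_pos x) |]; lra.
Qed.

Lemma weight_decay (kappa e tau C Z0 : R) (n : nat) :
  0 < kappa -> 0 < e -> 0 < tau -> 0 < C ->
  exists Z, Z0 <= Z /\ C * (1 + Z ^ 2) ^ n * weight kappa e Z < tau.
Proof.
intros Hk He Ht HC.
(* in terms of t = e * ln (1 + Z ^ 2) the left-hand side is
   C * exp (n t / e - kappa * exp t) <= C * exp (- t) *)
set (T := 4 * (INR n / e + 1) / kappa + C / tau + 1 + e * (Z0 ^ 2 + 1)).
assert (n0 := pos_INR n).
assert (T1 : 0 <= 4 * (INR n / e + 1) / kappa).
{ apply Rmult_le_pos; [| apply Rlt_le, Rinv_0_lt_compat, Hk].
  assert (0 <= INR n / e) by (apply Rmult_le_pos; [lra | apply Rlt_le, Rinv_0_lt_compat, He]).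
  lra. }
assert (T2 : 0 < C / tau) by now apply Rdiv_lt_0_compat.
assert (T3 : 0 < e * (Z0 ^ 2 + 1)) by (apply Rmult_lt_0_compat; nra).
assert (T0 : 0 < T) by (unfold T; lra).
set (y := exp (T / e)).
assert (Te : 0 < T / e) by now apply Rdiv_lt_0_compat.
assert (y1 : 1 + T / e < y) by (apply exp_ineq1; lra).
assert (yZ : Z0 ^ 2 + 1 < T / e).
{ apply Rmult_lt_reg_r with e; [exact He |].
  replace (T / e * e) with T by (field; lra); unfold T; lra. }
set (Z := sqrt (y - 1)).
assert (Z2 : 1 + Z ^ 2 = y).
{ unfold Z; replace (sqrt (y - 1) ^ 2) with (sqrt (y - 1) * sqrt (y - 1)) by ring.
  rewrite sqrt_sqrt; lra. }
exists Z; split.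
- assert (ZZ : 0 <= Z) by apply sqrt_pos.
  apply Rnot_lt_le; intros lt; nra.
- unfold weight, bracket_pow; rewrite Z2.
  assert (Ly : ln y = T / e) by apply ln_exp.
  rewrite Ly; replace (e * (T / e)) with T by (field; lra).
  assert (Py : y ^ n = exp (INR n * (T / e))).
  { rewrite <- Ly, <- Rpower_pow; [reflexivity | lra]. }
  rewrite Py, Rmult_assoc, <- exp_plus.
  assert (ET : T ^ 2 / 4 <= exp T).
  { replace T with (T / 2 + T / 2) at 2 by field; rewrite exp_plus.
    assert (H := exp_ineq1 (T / 2) ltac:(lra)); nra. }
  assert (K : INR n / e + 1 <= kappa * T / 4).
  { apply Rmult_le_reg_r with (4 / kappa); [apply Rdiv_lt_0_compat; lra |].
    replace (kappa * T / 4 * (4 / kappa)) with T by (field; lra).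
    replace ((INR n / e + 1) * (4 / kappa)) with (4 * (INR n / e + 1) / kappa)
      by (field; lra).
    unfold T; lra. }
  assert (Ex : INR n * (T / e) + - kappa * exp T <= - T).
  { replace (INR n * (T / e)) with (INR n / e * T) by (field; lra).
    assert (kappa * (T ^ 2 / 4) <= kappa * exp T) by (apply Rmult_le_compat_l; lra).
    assert ((INR n / e + 1) * T <= kappa * T / 4 * T) by (apply Rmult_le_compat_r; lra).
    nra. }
  apply Rle_lt_trans with (C * exp (- T)).
  + apply Rmult_le_compat_l; [lra |].
    destruct Ex as [Ex | Ex]; [now apply Rlt_le, exp_increasing | rewrite Ex; lra].
  + rewrite exp_Ropp.
    assert (E1 := exp_ineq1 T ltac:(lra)).
    apply Rmult_lt_reg_r with (exp T); [lra |].
    rewrite Rmult_assoc, Rinv_l, Rmult_1_r by lra.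
    assert (C / tau < exp T) by (unfold T in *; lra).
    apply Rmult_lt_compat_l with (r := tau) in H; [| exact Ht].
    replace (tau * (C / tau)) with C in H by (field; lra); exact H.
Qed.

(** * Vanishing of the vorticity *)

Lemma weighted_continuous (psi F : R -> R) (k z : R) :
  ex_derive psi z -> ex_derive F z -> continuous (fun t => (psi t - k) * F t) z.
Proof.
intros Hpsi HF; apply @ex_derive_continuous; auto_derive; now repeat split.
Qed.

(** Integration by parts against [psi - psi Z], which vanishes at both ends,
    so that neither [F1] nor [Q] contributes there. *)
Lemma weighted_integral_bound (psi psi1 psi2 F F1 F2 Q Q1 q : R -> R)
  (A Z P eta : R) :
  0 < Z -> 0 <= eta ->
  (forall z, is_derive psi z (psi1 z)) -> (forall z, is_derive psi1 z (psi2 z)) ->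
  (forall z, is_derive F z (F1 z)) -> (forall z, is_derive F1 z (F2 z)) ->
  (forall z, is_derive Q z (Q1 z)) ->
  psi (- Z) = psi Z ->
  (forall z, Rabs z <= Z -> psi Z <= psi z <= 1) ->
  (forall z, Rabs (psi1 z) <= psi z) ->
  (forall z, psi2 z + A * q z * Rabs (psi1 z) <= psi z / 2) ->
  (forall z, Rabs z <= Z -> 0 <= F z <= P) ->
  (forall z, Rabs z <= Z -> Rabs (Q z) <= A * q z * F z) ->
  (forall z, Rabs z <= Z -> F z - eta <= F2 z - Q1 z) ->
  RInt (fun z => (psi z - psi Z) * F z) (- Z) Z
  <= (4 + 2 * Z) * P * psi Z + 4 * Z * eta.
Proof.
intros HZ He Dpsi Dpsi1 DF DF1 DQ even mono b1 b2 bF bQ ineq.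
set (c0 := eta + psi Z * P / 2).
assert (psiZ : 0 <= psi Z).
{ apply Rle_trans with (2 := b1 Z), Rabs_pos. }
assert (I := RInt_le_increment
  (fun z => 2 * ((psi z - psi Z) * F1 z - psi1 z * F z - (psi z - psi Z) * Q z + c0 * z))
  (fun z => 2 * ((psi z - psi Z) * (F2 z - Q1 z) - psi2 z * F z - psi1 z * Q z + c0))
  (fun z => (psi z - psi Z) * F z) (- Z) Z).
assert (I' : RInt (fun z => (psi z - psi Z) * F z) (- Z) Z <=
  2 * ((psi Z - psi Z) * F1 Z - psi1 Z * F Z - (psi Z - psi Z) * Q Z + c0 * Z)
  - 2 * ((psi (- Z) - psi Z) * F1 (- Z) - psi1 (- Z) * F (- Z)
         - (psi (- Z) - psi Z) * Q (- Z) + c0 * (- Z))).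
{ apply I; [lra | | |].
  - intros z _.
    assert (X0 : ex_derive psi z) by (eexists; apply Dpsi).
    assert (X1 : ex_derive psi1 z) by (eexists; apply Dpsi1).
    assert (X2 : ex_derive F z) by (eexists; apply DF).
    assert (X3 : ex_derive F1 z) by (eexists; apply DF1).
    assert (X4 : ex_derive Q z) by (eexists; apply DQ).
    auto_derive; [now repeat split |].
    replace (Derive (fun x => psi x) z) with (psi1 z)
      by (symmetry; apply is_derive_unique, Dpsi).
    replace (Derive (fun x => psi1 x) z) with (psi2 z)
      by (symmetry; apply is_derive_unique, Dpsi1).
    replace (Derive (fun x => F x) z) with (F1 z)
      by (symmetry; apply is_derive_unique, DF).
    replace (Derive (fun x => F1 x) z) with (F2 z)
      by (symmetry; apply is_derive_unique, DF1).
    replace (Derive (fun x => Q x) z) with (Q1 z)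
      by (symmetry; apply is_derive_unique, DQ).
    ring.
  - intros z _; apply weighted_continuous; eexists; [apply Dpsi | apply DF].
  - intros z Hz.
    assert (Hz' : Rabs z <= Z) by now apply Rabs_le_between.
    destruct (mono z Hz') as [m1 m2]; destruct (bF z Hz') as [f0 fP].
    assert (K1 : (psi z - psi Z) * (F z - eta) <= (psi z - psi Z) * (F2 z - Q1 z))
      by (apply Rmult_le_compat_l; [lra | now apply ineq]).
    assert (K2 : psi2 z * F z + psi1 z * Q z <= psi z / 2 * F z).
    { apply Rle_trans with ((psi2 z + A * q z * Rabs (psi1 z)) * F z);
        [| now apply Rmult_le_compat_r].
      assert (psi1 z * Q z <= Rabs (psi1 z) * (A * q z * F z)).
      { apply Rle_trans with (1 := Rle_abs _); rewrite Rabs_mult.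
        apply Rmult_le_compat_l; [apply Rabs_pos | now apply bQ]. }
      lra. }
    assert (K3 : (psi z - psi Z) * eta <= 1 * eta) by (apply Rmult_le_compat_r; lra).
    assert (K4 : psi Z * F z <= psi Z * P) by (apply Rmult_le_compat_l; lra).
    unfold c0; lra. }
rewrite even in I'.
assert (Zabs : Rabs Z <= Z) by (rewrite Rabs_pos_eq; lra).
assert (Zabs' : Rabs (- Z) <= Z) by (rewrite Rabs_Ropp; exact Zabs).
destruct (bF Z Zabs) as [f0 fP]; destruct (bF (- Z) Zabs') as [f0' fP'].
assert (E1 : - psi1 Z * F Z <= psi Z * P).
{ apply Rle_trans with (psi Z * F Z); [| apply Rmult_le_compat_l; lra].
  apply Rmult_le_compat_r; [exact f0 |].
  apply Rle_trans with (2 := b1 Z); rewrite <- Rabs_Ropp; apply Rle_abs. }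
assert (E2 : psi1 (- Z) * F (- Z) <= psi Z * P).
{ apply Rle_trans with (psi Z * F (- Z)); [| apply Rmult_le_compat_l; lra].
  apply Rmult_le_compat_r; [exact f0' |].
  rewrite <- even; apply Rle_trans with (2 := b1 (- Z)), Rle_abs. }
unfold c0 in I'; lra.
Qed.

(** First eps tends to 0 for a fixed [Z], which removes the margins; then [Z]
    tends to infinity, and the weight beats the polynomial bound on the
    energy. *)
Lemma vorticity_vanishes (a c w : R -> R -> R) (A e K : R) (N : nat) :
  strip_smooth a -> strip_smooth c -> strip_smooth w ->
  (forall r z, 0 < r < 1 -> D1 a r z + a r z / r + D2 c r z = 0) ->
  (forall r z, 0 < r < 1 ->
    a r z * D1 w r z + c r z * D2 w r z - a r z / r * w r z
    = D1 (D1 w) r z + D1 w r z / r - w r z / r ^ 2 + D2 (D2 w) r z) ->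
  (forall z, w 0 z = 0) ->
  (forall z, filterlim (fun r => a r z) (at_left 1) (locally 0)) ->
  (forall z, filterlim (fun r => w r z) (at_left 1) (locally 0)) ->
  0 <= A -> 0 < e <= 1 / 2 -> 1 <= K ->
  (forall r z, 0 < r < 1 -> Rabs (c r z) <= A * bracket_pow (1 / 2 - e) z) ->
  (forall r z, 0 < r < 1 -> Rabs (w r z) <= K * (1 + z ^ 2) ^ N) ->
  forall r z, 0 < r < 1 -> w r z = 0.
Proof.
intros Sa Sc Sw dv tr axw wa ww HA He HK bc bw r z Hr.
set (kappa := / (2 * (A + 3))).
assert (k0 : 0 < kappa) by (apply Rinv_0_lt_compat; lra).
set (psi := weight kappa e).
assert (small : forall eps Z, 0 < eps < 1 / 2 -> 0 < Z ->
  RInt (fun z => (psi z - psi Z) * energy w eps z) (- Z) Z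
  <= (4 + 2 * Z) * (6 * (K * (1 + Z ^ 2) ^ N) ^ 2) * psi Z).
{ intros eps0 Z He0 HZ.
  destruct (energy_inequality a c w Sa Sc Sw dv tr axw wa ww Z) as [k [kpos Hk]].
  apply le_epsilon; intros eta Heta.
  (* shrinking the margin only increases the energy *)
  set (eps := Rmin eps0 (eta / (4 * Z * (k + 1)))).
  assert (den : 0 < 4 * Z * (k + 1)) by (apply Rmult_lt_0_compat; lra).
  assert (eps1 : eps <= eps0) by apply Rmin_l.
  assert (eps2 : eps <= eta / (4 * Z * (k + 1))) by apply Rmin_r.
  assert (eps3 : 0 < eps).
  { apply Rmin_pos; [lra | now apply Rdiv_lt_0_compat]. }
  assert (Heps : 0 < eps < 1 / 2) by lra.
  assert (DE : forall t, ex_derive (energy w eps) t).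
  { intros t; eexists; now apply (energy_derive c). }
  assert (DE0 : forall t, ex_derive (energy w eps0) t).
  { intros t; eexists; now apply (energy_derive c). }
  assert (Dpsi : forall t, ex_derive psi t) by (intros; eexists; apply weight_derive).
  apply Rle_trans with (RInt (fun z => (psi z - psi Z) * energy w eps z) (- Z) Z).
  - apply RInt_le; [lra | | |].
    + apply @ex_RInt_continuous; intros t _.
      apply weighted_continuous; [apply Dpsi | apply DE0].
    + apply @ex_RInt_continuous; intros t _.
      apply weighted_continuous; [apply Dpsi | apply DE].
    + intros t Ht; apply Rmult_le_compat_l.
      * assert (Rabs t <= Rabs Z).
        { rewrite (Rabs_pos_eq Z) by lra; apply Rabs_le_between; lra. }
        destruct (weight_le kappa e t Z ltac:(lra) ltac:(lra) H) as [m _].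
        unfold psi; lra.
      * apply (energy_monotone c w Sc Sw); lra.
  - apply Rle_trans with ((4 + 2 * Z) * (6 * (K * (1 + Z ^ 2) ^ N) ^ 2) * psi Z
      + 4 * Z * (k * eps)).
    + apply (weighted_integral_bound psi (weight1 kappa e) (weight2 kappa e)
        (energy w eps) (energy2 w eps) (energy22 w eps) (flux c w eps) (flux2 c w eps)
        (bracket_pow (1 / 2 - e)) A Z _ (k * eps)); try exact HZ.
      * apply Rmult_le_pos; lra.
      * intros; apply weight_derive.
      * intros; apply weight1_derive.
      * intros; now apply (energy_derive c).
      * intros; now apply (energy2_derive c).
      * intros; now apply flux_derive.
      * unfold psi, weight, bracket_pow; now replace ((- Z) ^ 2) with (Z ^ 2) by ring.
      * intros t Ht; apply weight_le; [lra | lra |].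
        now rewrite (Rabs_pos_eq Z) by lra.
      * intros t; now apply weight_inequalities.
      * intros t; now apply weight_inequalities.
      * intros t Ht; split.
        -- apply (energy_monotone c w Sc Sw eps eps t); lra.
        -- apply (energy_bound c w Sc Sw); [lra | |].
           ++ assert (1 <= (1 + Z ^ 2) ^ N) by (apply pow_R1_Rle, bracket_pos); nra.
           ++ intros s Hs; apply Rle_trans with (1 := bw s t Hs).
              apply Rmult_le_compat_l; [lra |]; apply pow_incr.
              assert (B := bracket_pos t); split; [lra |].
              apply Rplus_le_compat_l; rewrite <- (pow2_abs t); apply pow_incr.
              split; [apply Rabs_pos | exact Ht].
      * intros t Ht; apply (flux_bound c w Sc Sw); [lra |].
        intros s Hs; now apply bc.
      * intros t Ht; apply Hk; [lra | exact Ht].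
    + apply Rplus_le_compat_l.
      apply Rmult_le_compat_l with (r := 4 * Z * (k + 1)) in eps2; [| lra].
      replace (4 * Z * (k + 1) * (eta / (4 * Z * (k + 1)))) with eta in eps2
        by (field; lra).
      assert (0 < Z * eps) by now apply Rmult_lt_0_compat.
      lra. }
apply (vorticity_zero_of_energy c w Sc Sw r z Hr).
intros eps Heps.
destruct (energy_monotone c w Sc Sw eps eps z ltac:(lra) ltac:(lra)) as [E0 _].
destruct E0 as [E0 | E0]; [exfalso | now symmetry].
(* a positive energy at z bounds the left-hand side of [small] from below
   uniformly in Z *)
set (m := energy w eps z / 2).
assert (mpos : 0 < m) by (unfold m; lra).
assert (DE : forall t, ex_derive (energy w eps) t).
{ intros t; eexists; now apply (energy_derive c). }
assert (C : continuous (energy w eps) z) by (apply @ex_derive_continuous, DE).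
destruct (proj1 (filterlim_locally _ _) C (mkposreal _ mpos)) as [d0 Hd0].
set (d := Rmin d0 1 / 2).
assert (d1 := Rmin_l d0 1); assert (d2 := Rmin_r d0 1).
assert (d3 : 0 < Rmin d0 1) by (apply Rmin_pos; [apply cond_pos | lra]).
set (nu := weight kappa e (Rabs z + 1) - weight kappa e (Rabs z + 2)).
assert (zp := Rabs_pos z).
assert (nupos : 0 < nu).
{ unfold nu; apply Rlt_0_minus, weight_lt; [lra | lra |].
  rewrite (Rabs_pos_eq (Rabs z + 1)), (Rabs_pos_eq (Rabs z + 2)); lra. }
assert (lower : forall Z, Rabs z + 2 <= Z ->
  nu * m * (2 * d) <= RInt (fun z => (psi z - psi Z) * energy w eps z) (- Z) Z).
{ intros Z HZ.
  assert (X : forall x y, ex_RInt (fun z => (psi z - psi Z) * energy w eps z) x y).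
  { intros x y; apply @ex_RInt_continuous; intros t _.
    apply weighted_continuous; [eexists; apply weight_derive | apply DE]. }
  assert (Nn : forall t, Rabs t <= Z -> 0 <= (psi t - psi Z) * energy w eps t).
  { intros t Ht; apply Rmult_le_pos.
    - assert (Ht' : Rabs t <= Rabs Z) by (rewrite (Rabs_pos_eq Z); lra).
      destruct (weight_le kappa e t Z ltac:(lra) ltac:(lra) Ht') as [l _].
      unfold psi; lra.
    - apply (energy_monotone c w Sc Sw eps eps t); lra. }
  assert (zz : - Rabs z <= z <= Rabs z) by (apply Rabs_le_between; lra).
  rewrite <- (RInt_Chasles _ (- Z) (z - d) Z) by apply X.
  rewrite <- (RInt_Chasles _ (z - d) (z + d) Z) by apply X.
  assert (I1 : 0 <= RInt (fun z => (psi z - psi Z) * energy w eps z) (- Z) (z - d)).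
  { apply RInt_ge_0; [unfold d; lra | apply X |].
    intros t Ht; apply Nn, Rabs_le_between; unfold d in Ht; lra. }
  assert (I2 : 0 <= RInt (fun z => (psi z - psi Z) * energy w eps z) (z + d) Z).
  { apply RInt_ge_0; [unfold d; lra | apply X |].
    intros t Ht; apply Nn, Rabs_le_between; unfold d in Ht; lra. }
  assert (I3 : nu * m * (z + d) - nu * m * (z - d)
    <= RInt (fun z => (psi z - psi Z) * energy w eps z) (z - d) (z + d)).
  { apply (increment_le_RInt (fun t => nu * m * t) (fun _ => nu * m));
      [unfold d; lra | | |].
    - intros t _; auto_derive; [exact I | ring].
    - intros t _.
      apply weighted_continuous; [eexists; apply weight_derive | apply DE].
    - intros t Ht.
      assert (B : ball z d0 t).
      { change (Rabs (t - z) < d0); apply Rabs_lt_between; unfold d in Ht; lra. }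
      specialize (Hd0 t B).
      change (Rabs (energy w eps t - energy w eps z) < m) in Hd0.
      apply Rabs_lt_between in Hd0.
      apply Rmult_le_compat; [lra | lra | | unfold m in *; lra].
      assert (Ht' : Rabs t <= Rabs (Rabs z + 1)).
      { rewrite (Rabs_pos_eq (Rabs z + 1)) by lra.
        apply Rabs_le_between; unfold d in Ht; lra. }
      destruct (weight_le kappa e t _ ltac:(lra) ltac:(lra) Ht') as [l1 _].
      assert (HZ' : Rabs (Rabs z + 2) <= Rabs Z) by (rewrite (Rabs_pos_eq Z), (Rabs_pos_eq (Rabs z + 2)); lra).
      destruct (weight_le kappa e _ _ ltac:(lra) ltac:(lra) HZ') as [l2 _].
      unfold nu, psi; lra. }
  unfold plus; simpl; lra. }
assert (gap : 0 < nu * m * (2 * d)).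
{ apply Rmult_lt_0_compat; [now apply Rmult_lt_0_compat | unfold d; lra]. }
destruct (weight_decay kappa e _ (36 * K ^ 2) (Rabs z + 2) (2 * N + 1) k0 ltac:(lra) gap)
  as [Z [HZ dec]]; [nra |].
assert (L := lower Z HZ); assert (U := small eps Z Heps ltac:(lra)).
assert (V : (4 + 2 * Z) * (6 * (K * (1 + Z ^ 2) ^ N) ^ 2) * psi Z
  <= 36 * K ^ 2 * (1 + Z ^ 2) ^ (2 * N + 1) * psi Z).
{ apply Rmult_le_compat_r; [apply Rlt_le, exp_pos |].
  rewrite pow_add, pow_1, Nat.mul_comm, pow_mult.
  replace (36 * K ^ 2 * (((1 + Z ^ 2) ^ N) ^ 2 * (1 + Z ^ 2))) with
    (6 * (1 + Z ^ 2) * (6 * (K * (1 + Z ^ 2) ^ N) ^ 2)) by ring.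
  apply Rmult_le_compat_r; [| nra].
  apply Rmult_le_pos; [lra | apply pow2_ge_0]. }
unfold psi in *; lra.
Qed.

(** * Swirl independent of z *)

Lemma Rpower_le_bracket (d e z : R) : 1 <= Rabs z -> d <= 2 * e -> 0 <= e ->
  Rpower (Rabs z) d <= bracket_pow e z.
Proof.
intros Hz Hd He.
assert (L0 : 0 <= ln (Rabs z)) by (rewrite <- ln_1; apply ln_le; lra).
assert (L : 2 * ln (Rabs z) <= ln (1 + z ^ 2)).
{ replace (2 * ln (Rabs z)) with (ln (Rabs z ^ 2)).
  - apply ln_le; rewrite pow2_abs; [rewrite <- pow2_abs; nra | lra].
  - rewrite ln_pow by lra; simpl INR; ring. }
assert (X : d * ln (Rabs z) <= e * ln (1 + z ^ 2)) by nra.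
unfold Rpower, bracket_pow.
destruct X as [X | ->]; [now apply Rlt_le, exp_increasing | lra].
Qed.

Lemma axial_velocity_bound (c : R -> R -> R) (C delta0 : R) :
  strip_smooth c -> 0 < C -> delta0 < 1 ->
  (forall r z, 0 < r < 1 -> 1 <= Rabs z ->
     Rabs (c r z) <= C * Rpower (Rabs z) delta0) ->
  exists A e, 0 <= A /\ 0 < e <= 1 / 2 /\ forall r z, 0 < r < 1 ->
    Rabs (c r z) <= A * bracket_pow (1 / 2 - e) z.
Proof.
intros Sc HC Hd H.
destruct (strip_bounded c Sc 1) as [B HB].
set (e := Rmin (1 / 2) ((1 - delta0) / 2)).
assert (e1 : e <= 1 / 2) by apply Rmin_l.
assert (e2 : e <= (1 - delta0) / 2) by apply Rmin_r.
assert (e3 : 0 < e) by (apply Rmin_pos; lra).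
exists (Rmax C B), e; repeat split; try lra.
- apply Rle_trans with (2 := Rmax_l _ _); lra.
- intros r z Hr.
  assert (q1 := bracket_pow_ge_1 (1 / 2 - e) z ltac:(lra)).
  assert (M1 := Rmax_l C B); assert (M2 := Rmax_r C B).
  destruct (Rle_dec 1 (Rabs z)) as [Hz | Hz].
  + apply Rle_trans with (1 := H r z Hr Hz).
    apply Rmult_le_compat; [lra | apply Rlt_le, exp_pos | exact M1 |].
    apply Rpower_le_bracket; lra.
  + apply Rle_trans with (1 := HB r z ltac:(lra) ltac:(lra)); nra.
Qed.

Lemma vorticity_bound (w : R -> R -> R) (C M0 : R) :
  strip_smooth w -> 0 < C ->
  (forall r z, 0 < r < 1 -> 1 <= Rabs z ->
     Rabs (w r z) <= C * Rpower (Rabs z) M0) ->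
  exists K N, 1 <= K /\ forall r z, 0 < r < 1 ->
    Rabs (w r z) <= K * (1 + z ^ 2) ^ N.
Proof.
intros Sw HC H.
destruct (strip_bounded w Sw 1) as [B HB].
destruct (INR_unbounded M0) as [N HN].
exists (Rmax 1 (Rmax C B)), N; split; [apply Rmax_l |].
intros r z Hr.
assert (M1 := Rmax_l C B); assert (M2 := Rmax_r C B).
assert (M3 := Rmax_r 1 (Rmax C B)).
assert (P1 : 1 <= (1 + z ^ 2) ^ N) by apply pow_R1_Rle, bracket_pos.
assert (N0 := pos_INR N).
destruct (Rle_dec 1 (Rabs z)) as [Hz | Hz].
- apply Rle_trans with (1 := H r z Hr Hz).
  apply Rmult_le_compat; [lra | apply Rlt_le, exp_pos | lra |].
  rewrite <- Rpower_pow by (assert (b := bracket_pos z); lra).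
  apply (Rpower_le_bracket M0 (INR N)); lra.
- apply Rle_trans with (1 := HB r z ltac:(lra) ltac:(lra)); nra.
Qed.

(** Once the vorticity vanishes, D2 a = D1 c, and the radial derivative of the
    incompressibility condition is the equation of
    [radial_phragmen_lindelof]. *)
Lemma parallel_of_swirl_z_independent (a b c q : R -> R -> R)
  (alpha C gamma0 delta0 M0 : R) :
  meridional_flow a b c q ->
  (forall r z z', 0 < r < 1 -> b r z = b r z') ->
  smallest_positive_root BesselJ1 alpha -> 0 < C -> gamma0 < alpha -> delta0 < 1 ->
  (forall r z, 0 < r < 1 -> Rabs (a r z) <= C * r * exp (gamma0 * Rabs z)) ->
  (forall r z, 0 < r < 1 -> 1 <= Rabs z ->
     Rabs (c r z) <= C * Rpower (Rabs z) delta0) ->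
  (forall r z, 0 < r < 1 -> 1 <= Rabs z ->
     Rabs (vorticity a c r z) <= C * Rpower (Rabs z) M0) ->
  (forall r z, 0 < r < 1 -> a r z = 0) /\
  (forall r z, 0 < r < 1 -> c r z = c (1 / 2) 0).
Proof.
intros F bz Ha HC Hg Hd ba bc bw.
assert (Sa := smooth_a _ _ _ _ F); assert (Sc := smooth_c _ _ _ _ F).
assert (Sw := vorticity_smooth a c Sa Sc).
destruct (axial_velocity_bound c C delta0 Sc HC Hd bc) as [A [e [HA [He bc']]]].
destruct (vorticity_bound _ C M0 Sw HC bw) as [K [N [HK bw']]].
assert (aw : forall z, vorticity a c 0 z = 0).
{ intros z; unfold vorticity; rewrite (axis_c _ _ _ _ F).
  unfold D2; rewrite (Derive_ext _ (fun _ => 0)); [rewrite Derive_const; ring |].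
  exact (axis_a _ _ _ _ F). }
assert (w0 : forall r z, 0 < r < 1 -> vorticity a c r z = 0).
{ apply (vorticity_vanishes a c (vorticity a c) A e K N); auto.
  - exact (continuity_eq _ _ _ _ F).
  - exact (vorticity_equation _ _ _ _ F bz).
  - exact (wall_a _ _ _ _ F).
  - exact (wall_vorticity _ _ _ _ F). }
assert (a2 : forall r z, 0 < r < 1 -> D2 a r z = D1 c r z).
{ intros r z Hr; specialize (w0 r z Hr); unfold vorticity in w0; lra. }
assert (lap : forall r z, 0 < r < 1 ->
  D1 (D1 a) r z + D1 a r z / r - a r z / r ^ 2 + D2 (D2 a) r z = 0).
{ intros r z Hr.
  rewrite (D2_ext_half _ _ a2 r z Hr), <- (D_commute c r z Sc) by lra.
  assert (L : is_derive (fun s => D1 a s z + a s z / s + D2 c s z) r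
    (D1 (D1 a) r z + (D1 a r z / r - a r z / r ^ 2) + D1 (D2 c) r z)).
  { apply @is_derive_plus; [apply @is_derive_plus |].
    - apply (strip_is_derive1 (D1 a)); [now apply strip_D1 | lra].
    - now apply is_derive_over_r.
    - apply (strip_is_derive1 (D2 c)); [now apply strip_D2 | lra]. }
  apply is_derive_unique in L.
  rewrite (Derive_ext_loc _ (fun _ => 0)), Derive_const in L; [lra |].
  apply locally_open_unit; [exact Hr |]; intros s Hs.
  now apply (continuity_eq _ _ _ _ F). }
assert (a0 : forall r z, 0 < r < 1 -> a r z = 0).
{ intros r z Hr.
  assert (up := radial_phragmen_lindelof a 1 alpha C gamma0 Sa Rabs_R1
    (axis_a _ _ _ _ F) (wall_a _ _ _ _ F) lap Ha Hg ba r z Hr).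
  assert (R1 : Rabs (-1) = 1) by (rewrite Rabs_left; lra).
  assert (lo := radial_phragmen_lindelof a (-1) alpha C gamma0 Sa R1
    (axis_a _ _ _ _ F) (wall_a _ _ _ _ F) lap Ha Hg ba r z Hr).
  lra. }
split; [exact a0 |].
assert (a1 := D1_zero a a0).
assert (a20 : forall r z, 0 < r < 1 -> D2 a r z = 0).
{ apply D2_z_independent; intros; now rewrite !a0. }
intros r z Hr.
rewrite (constant_of_D2_zero c r Sc Hr) with (z' := 0).
- apply (constant_of_D1_zero c 0 Sc); [| exact Hr | lra].
  intros s Hs; rewrite <- a2 by exact Hs; now apply a20.
- intros t; assert (E := continuity_eq _ _ _ _ F r t Hr).
  rewrite a1, a0 in E by exact Hr; unfold Rdiv in E; lra.
Qed.

(** * Cylindrical components *)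

Lemma cylindrical_components (u : R3 -> R3) (r z : R) : 0 < r ->
  u_r u r z = slice (component ax1 u) r z /\
  u_theta u r z = slice (component ax2 u) r z.
Proof.
intros Hr; unfold u_r, u_theta, dot, sum3, e_r, e_theta.
rewrite !radius_cyl, cyl_zero by lra; unfold slice, component; simpl.
split; field; lra.
Qed.

Lemma axial_component (u : R3 -> R3) (r z : R) :
  u_z u r z = slice (component ax3 u) r z.
Proof.
unfold u_z, dot, sum3, e_z; rewrite cyl_zero; unfold slice, component; simpl; ring.
Qed.

Lemma omega_theta_eq (u : R3 -> R3) (r z : R) :
  (forall i, smooth_up_to_boundary (component i u)) -> 0 < r < 1 ->
  omega_theta u r z
  = vorticity (slice (component ax1 u)) (slice (component ax3 u)) r z.
Proof.
intros Hu Hr.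
set (a := slice (component ax1 u)); set (c := slice (component ax3 u)).
assert (Sw : strip_smooth (vorticity a c)) by (apply vorticity_smooth; now apply smooth_slice).
unfold omega_theta, extend.
set (D := fun q : R * R => 0 < fst q < 1).
assert (PF : ProperFilter (within D (locally (r, z)))).
{ constructor; [| apply within_filter, locally_filter].
  intros P H; exists (r, z); apply locally_singleton in H; now apply H. }
apply (@iota_filterlim_locally _ R_CompleteNormedModule _ _ (Proper_StrongProper _ PF)).
apply filterlim_ext_loc with (fun q : R * R => vorticity a c (fst q) (snd q)).
- exists (mkposreal 1 Rlt_0_1); intros [s t] _ Hs; unfold D in Hs; simpl in *.
  unfold vorticity, D1, D2.
  rewrite (Derive_ext (fun x => a s x) (fun x => u_r u s x)).
  + rewrite (Derive_ext (fun x => c x t) (fun x => u_z u x t)); [reflexivity |].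
    intros x; symmetry; apply axial_component.
  + intros x; symmetry; apply cylindrical_components; lra.
- eapply filterlim_filter_le_1; [apply filter_le_within |].
  apply (strip_cont _ Sw r z); lra.
Qed.

(** * Back to the cylinder *)

Lemma near_closed_cylinder (x : R3) (d : posreal) : closed_cylinder x ->
  exists x1 x2 x3 : R, ball x d ((x1, x2, x3) : R3) /\ 0 < sqrt (x1 ^ 2 + x2 ^ 2) < 1.
Proof.
destruct x as [[x1 x2] x3]; unfold closed_cylinder; simpl coord; intros H.
set (t := Rmin d 1 / 2).
assert (t1 := Rmin_l d 1); assert (t2 := Rmin_r d 1).
assert (t3 : 0 < Rmin d 1) by (apply Rmin_pos; [apply cond_pos | lra]).
assert (t4 : 0 < t <= 1 / 2) by (unfold t; lra).
assert (rt : forall y, 0 < y < 1 -> 0 < sqrt y < 1).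
{ intros y Hy; split; [apply sqrt_lt_R0; lra |].
  rewrite <- sqrt_1; apply sqrt_lt_1_alt; lra. }
destruct (Req_dec (x1 ^ 2 + x2 ^ 2) 0) as [Z | NZ].
- assert (E1 : x1 = 0) by nra; assert (E2 : x2 = 0) by nra; subst.
  exists t, 0, x3; split.
  + split; [split |]; [| apply ball_center | apply ball_center].
    change (Rabs (t - 0) < d); rewrite Rabs_pos_eq; unfold t; lra.
  + apply rt; split; nra.
- exists ((1 - t) * x1), ((1 - t) * x2), x3; split.
  + assert (cl : forall y, y ^ 2 <= 1 -> Rabs ((1 - t) * y - y) < d).
    { intros y Hy; replace ((1 - t) * y - y) with (- (t * y)) by ring.
      assert (Y : Rabs y <= 1).
      { apply Rsqr_incr_0_var; [| lra]; rewrite <- Rsqr_abs; unfold Rsqr; nra. }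
      rewrite Rabs_Ropp, Rabs_mult, (Rabs_pos_eq t) by (unfold t; lra).
      assert (P := Rabs_pos y); assert (t < d) by (unfold t; lra); nra. }
    split; [split |]; [apply (cl x1); nra | apply (cl x2); nra | apply ball_center].
  + apply rt.
    replace (((1 - t) * x1) ^ 2 + ((1 - t) * x2) ^ 2)
      with ((1 - t) ^ 2 * (x1 ^ 2 + x2 ^ 2)) by ring.
    assert (P : 0 < x1 ^ 2 + x2 ^ 2) by nra.
    assert (Q : 0 < (1 - t) ^ 2 < 1) by (split; nra).
    split; nra.
Qed.

(** The points off the axis in the open cylinder are dense in the closed one. *)
Lemma closed_cylinder_extension (f g : R3 -> R) (x : R3) :
  smooth_up_to_boundary f -> (forall y, continuous g y) ->
  (forall x1 x2 x3, 0 < sqrt (x1 ^ 2 + x2 ^ 2) < 1 ->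
     f (x1, x2, x3) = g (x1, x2, x3)) ->
  closed_cylinder x -> f x = g x.
Proof.
intros [_ [_ Hf]] Hg E Hx.
apply Req_lt_aux; intros e.
assert (He : 0 < e / 2) by (assert (P := cond_pos e); lra).
assert (Lf := proj1 (filterlim_locally _ _) (Hf x Hx) (mkposreal _ He)).
assert (Lg := proj1 (filterlim_locally _ _) (Hg x) (mkposreal _ He)).
unfold within in Lf; destruct (filter_and _ _ Lf Lg) as [d Hd].
destruct (near_closed_cylinder x d Hx) as [x1 [x2 [x3 [B H]]]].
destruct (Hd _ B) as [K1 K2].
assert (C : cylinder (x1, x2, x3)).
{ unfold cylinder; simpl coord.
  assert (S : sqrt (x1 ^ 2 + x2 ^ 2) * sqrt (x1 ^ 2 + x2 ^ 2) = x1 ^ 2 + x2 ^ 2).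
  { apply sqrt_sqrt; nra. }
  rewrite <- S; nra. }
specialize (K1 C).
change (Rabs (f (x1, x2, x3) - f x) < e / 2) in K1.
change (Rabs (g (x1, x2, x3) - g x) < e / 2) in K2.
rewrite E in K1 by exact H.
apply Rabs_lt_between in K1; apply Rabs_lt_between in K2.
apply Rabs_lt_between; lra.
Qed.

Lemma radius_sqr (x : R3) : radius x ^ 2 = fst (fst x) ^ 2 + snd (fst x) ^ 2.
Proof.
unfold radius; simpl coord.
replace (sqrt _ ^ 2) with (sqrt (fst (fst x) ^ 2 + snd (fst x) ^ 2)
  * sqrt (fst (fst x) ^ 2 + snd (fst x) ^ 2)) by ring.
apply sqrt_sqrt; nra.
Qed.

(** On the axis the factor [radius] makes up for the convention on [e_theta]. *)
Lemma rigid_rotation_eq (C1 C2 : R) (x : R3) :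
  plus (scal (C1 * radius x) (e_theta x)) (scal C2 e_z)
  = (- C1 * snd (fst x), C1 * fst (fst x), C2) :> R3.
Proof.
assert (S := radius_sqr x).
destruct x as [[x1 x2] x3]; simpl fst in *; simpl snd in *.
unfold e_theta, e_z; simpl coord.
set (rho := radius (x1, x2, x3)) in *.
assert (H1 : C1 * rho * (- x2 / rho) = - C1 * x2).
{ destruct (Req_dec rho 0) as [-> | N]; [| field; exact N].
  replace x2 with 0 by nra; unfold Rdiv; ring. }
assert (H2 : C1 * rho * (x1 / rho) = C1 * x1).
{ destruct (Req_dec rho 0) as [-> | N]; [| field; exact N].
  replace x1 with 0 by nra; unfold Rdiv; ring. }
unfold plus, scal; simpl; unfold prod_plus, prod_scal, plus, scal; simpl.
unfold prod_plus, prod_scal, plus, scal, mult; simpl; unfold mult; simpl.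
rewrite H1, H2; apply (f_equal2 pair); [apply (f_equal2 pair) |];
  match goal with |- ?x = ?y => change (@eq R x y) end; ring.
Qed.

Lemma continuous_coordinates (x : R3) :
  continuous (fun x : R3 => fst (fst x)) x /\
  continuous (fun x : R3 => snd (fst x)) x.
Proof.
split.
- apply (continuous_comp fst fst); apply continuous_fst.
- apply (continuous_comp fst snd); [apply continuous_fst | apply continuous_snd].
Qed.

Theorem theorem1p3 (u : R3 -> R3) (p : R3 -> R)
  (u_smooth : forall i : axis, smooth_up_to_boundary (component i u))
  (p_smooth : smooth_up_to_boundary p)
  (u_axisym : axially_symmetric u)
  (p_axisym : theta_independent p)
  (u_p_NS : stationary_navier_stokes u p)
  (u_slip : total_navier_slip u)
  (cases :
    (* I *)
    (z_independent (u_theta u) /\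
     exists alpha C gamma0 delta0 M0 : R,
       smallest_positive_root BesselJ1 alpha /\
       0 < C /\ gamma0 < alpha /\ delta0 < 1 /\ 0 < M0 /\
       (forall r z : R, 0 <= r <= 1 ->
          Rabs (u_r u r z) <= C * r * exp (gamma0 * Rabs z)) /\
       (forall r z : R, 0 <= r <= 1 -> 1 <= Rabs z ->
          Rabs (u_z u r z) <= C * Rpower (Rabs z) delta0 /\
          Rabs (omega_theta u r z) <= C * Rpower (Rabs z) M0))
    \/
    (* II *)
    z_independent (u_z u)) :
  exists C1 C2 : R,
    (forall x : R3, closed_cylinder x ->
       u x = plus (scal (C1 * radius x) (e_theta x)) (scal C2 e_z)) /\
    (exists c : R, forall x : R3, closed_cylinder x ->
       p x = C1 ^ 2 * radius x ^ 2 / 2 + c).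
Proof.
assert (F := meridional_flow_of_solution u p u_smooth p_smooth u_axisym p_axisym
  u_p_NS u_slip).
set (a := slice (component ax1 u)) in *; set (b := slice (component ax2 u)) in *.
set (c := slice (component ax3 u)) in *; set (q := slice p) in *.
assert (parallel : (forall r z, 0 < r < 1 -> a r z = 0) /\
  (forall r z z', 0 < r < 1 -> b r z = b r z') /\
  (forall r z, 0 < r < 1 -> c r z = c (1 / 2) 0)).
{ destruct cases as [[tz [alpha [C [gamma0 [delta0 [M0
    [Ha [HC [Hg [Hd [_ [br bz]]]]]]]]]]]] | zz].
  - assert (bzi : forall r z z', 0 < r < 1 -> b r z = b r z').
    { intros r z z' Hr.
      destruct (cylindrical_components u r z ltac:(lra)) as [_ E].
      destruct (cylindrical_components u r z' ltac:(lra)) as [_ E'].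
      unfold b; rewrite <- E, <- E'; apply tz; lra. }
    destruct (parallel_of_swirl_z_independent a b c q alpha C gamma0 delta0 M0 F bzi)
      as [a0 c0]; auto.
    + intros r z Hr; destruct (cylindrical_components u r z ltac:(lra)) as [E _].
      unfold a; rewrite <- E; apply br; lra.
    + intros r z Hr Hz; unfold c; rewrite <- axial_component; apply bz; lra.
    + intros r z Hr Hz; unfold a, c; rewrite <- omega_theta_eq by auto.
      apply bz; lra.
  - apply (parallel_of_axial_z_independent a b c q F).
    intros r z z' Hr; unfold c; rewrite <- !axial_component; apply zz; lra. }
destruct parallel as [a0 [bz c0]].
destruct (parallel_flow a b c q _ F a0 bz c0) as [C1 [k H]].
exists C1, (c (1 / 2) 0).
assert (off_axis : forall x1 x2 x3, 0 < sqrt (x1 ^ 2 + x2 ^ 2) < 1 ->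
  component ax1 u (x1, x2, x3) = - C1 * x2 /\
  component ax2 u (x1, x2, x3) = C1 * x1 /\
  component ax3 u (x1, x2, x3) = c (1 / 2) 0 /\
  p (x1, x2, x3) = C1 ^ 2 * (x1 ^ 2 + x2 ^ 2) / 2 + k).
{ intros x1 x2 x3 Hr.
  destruct (axially_symmetric_components u x1 x2 x3 u_axisym) as [E1 [E2 E3]]; [lra |].
  assert (E4 := theta_independent_eq p x1 x2 x3 p_axisym ltac:(lra)).
  destruct (H _ x3 Hr) as [Hb Hq]; fold a b c q in E1, E2, E3, E4.
  rewrite a0, Hb in E1, E2 by exact Hr; rewrite c0 in E3 by exact Hr.
  rewrite Hq in E4.
  assert (R2 : sqrt (x1 ^ 2 + x2 ^ 2) ^ 2 = x1 ^ 2 + x2 ^ 2)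
    by exact (radius_sqr (x1, x2, x3)).
  rewrite R2 in E4.
  rewrite E1, E2, E3, E4; repeat split; field; lra. }
split.
- intros x Hx; rewrite rigid_rotation_eq.
  assert (X1 : component ax1 u x = - C1 * snd (fst x)).
  { apply (closed_cylinder_extension _ (fun x : R3 => - C1 * snd (fst x))); auto.
    - intros y; apply (continuous_scal_r (- C1) (fun x : R3 => snd (fst x))).
      apply continuous_coordinates.
    - intros; now apply off_axis. }
  assert (X2 : component ax2 u x = C1 * fst (fst x)).
  { apply (closed_cylinder_extension _ (fun x : R3 => C1 * fst (fst x))); auto.
    - intros y; apply (continuous_scal_r C1 (fun x : R3 => fst (fst x))).
      apply continuous_coordinates.
    - intros; now apply off_axis. }
  assert (X3 : component ax3 u x = c (1 / 2) 0).
  { apply (closed_cylinder_extension _ (fun _ => c (1 / 2) 0)); auto.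
    - intros y; apply continuous_const.
    - intros; now apply off_axis. }
  unfold component in X1, X2, X3; destruct (u x) as [[u1 u2] u3]; simpl in *.
  now rewrite X1, X2, X3.
- exists k; intros x Hx; rewrite radius_sqr.
  apply (closed_cylinder_extension _
    (fun x : R3 => C1 ^ 2 * (fst (fst x) ^ 2 + snd (fst x) ^ 2) / 2 + k)); auto.
  + intros y; destruct (continuous_coordinates y) as [Y1 Y2].
    apply (continuous_comp_2 (fun x : R3 => fst (fst x)) (fun x : R3 => snd (fst x))
      (fun s t => C1 ^ 2 * (s ^ 2 + t ^ 2) / 2 + k)); [exact Y1 | exact Y2 |].
    apply (proj2 (continuous2_iff (fun s t => C1 ^ 2 * (s ^ 2 + t ^ 2) / 2 + k) _ _)).
    apply (continuity_2d_pt_ext (fun s t => C1 ^ 2 / 2 * (s * s + t * t) + k)).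
    { intros; field. }
    apply continuity_2d_pt_plus; [| apply continuity_2d_pt_const].
    apply continuity_2d_pt_mult; [apply continuity_2d_pt_const |].
    apply continuity_2d_pt_plus.
    * apply continuity_2d_pt_mult; apply continuity_2d_pt_id1.
    * apply continuity_2d_pt_mult; apply continuity_2d_pt_id2.
  + intros; now apply off_axis.
Qed.
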